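(* Let $B[1..n]$ be a binary string and suppose we are given a straight-line program for $B$ with $g$ rules. Then in $O(g^{2/3} n^{4/3})$ time we can build an index occupying $O(n \log n)$ bits such that, given integers $m$ and $c$, we can list all substrings of $B$ of length $m$ containing exactly $c$ copies of 1, using $O(m)$ time per listed substring.
   Context: A straight-line program (SLP) for a string $B$ with $g$ rules is a context-free grammar with $g$ rules in Chomsky normal form that generates $B$ and only $B$. Substrings are identified by their positions (occurrences) in $B$. Running times are in the standard word RAM model. *)

(* Defs.v *)
From Stdlib Require Import List Arith Bool Permutation Relations.
From Stdlib Require Import Reals.
Import ListNotations.

(** * Straight-line programs *)

Inductive symbol : Type :=
| Tm (b : bool)
| Nt (X : nat).

Inductive rhs : Type :=
| Terminal (b : bool)
| Pair (Y Z : nat).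

Definition rhs_symbols (r : rhs) : list symbol :=
  match r with
  | Terminal b => [Tm b]
  | Pair Y Z => [Nt Y; Nt Z]
  end.

(** The nonterminals are [0 .. g - 1], and nonterminal [X] has exactly one rule,
    the [X]-th entry of [rules].  The rules may be listed in any order, and some
    of them may be unreachable from the start symbol. *)
Record slp : Type := Slp { rules : list rhs; start : nat }.

Definition num_rules (G : slp) : nat := length (rules G).

Definition rhs_wf (g : nat) (r : rhs) : Prop :=
  match r with
  | Terminal _ => True
  | Pair Y Z => Y < g /\ Z < g
  end.

Inductive step (G : slp) : list symbol -> list symbol -> Prop :=
| step_rule (u v : list symbol) (X : nat) (r : rhs) :
    nth_error (rules G) X = Some r ->
    step G (u ++ Nt X :: v) (u ++ rhs_symbols r ++ v).

Definition generates (G : slp) (s : list bool) : Prop :=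
  clos_refl_trans (list symbol) (step G) [Nt (start G)] (map Tm s).

(** Acyclicity of the part of the grammar reachable from the start symbol is a
    consequence of the second conjunct. *)
Definition slp_for (G : slp) (B : list bool) : Prop :=
  Forall (rhs_wf (num_rules G)) (rules G) /\
  (forall s : list bool, generates G s <-> s = B).

(** * Substrings with a given number of ones *)

(** The occurrence [i] (counted from 0) stands for the substring occupying the
    positions [i, ..., i + m - 1] of [B]; the list is empty when [m > length B]. *)
Definition occurrences (B : list bool) (m c : nat) : list nat :=
  filter (fun i => count_occ bool_dec (firstn m (skipn i B)) true =? c)
         (seq 0 (S (length B) - m)).

(** * The word RAM with words of [w] bits

    Programs are structured, and every operator, register access, memory access
    and control step costs one unit.  Registers are addressed only by
    constants, so a program uses finitely many of them; memory addresses are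
    words. *)

Inductive binop : Type :=
| Add | Sub | Mul | Div | Mod | And | Or | Xor | Shl | Shr | Eqb | Ltb.

Inductive expr : Type :=
| Const (k : nat)
| Reg (r : nat)
| Read (e : expr)
| Bin (o : binop) (e1 e2 : expr).

Inductive com : Type :=
| Skip
| Assign (r : nat) (e : expr)
| Store (addr e : expr)
| Emit (e : expr)
| Seq (p q : com)
| If (e : expr) (p q : com)
| While (e : expr) (p : com).

Record state : Type := State {
  regs : nat -> nat;
  mem : nat -> nat;
  out : list nat
}.

Definition update (f : nat -> nat) (k v : nat) : nat -> nat :=
  fun i => if i =? k then v else f i.

(** Arithmetic is modulo [2 ^ w]; as in Stdlib, [a / 0 = 0] and
    [a mod 0 = a]. *)
Definition eval_op (w : nat) (o : binop) (a b : nat) : nat :=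
  (match o with
   | Add => a + b
   | Sub => a + 2 ^ w - b
   | Mul => a * b
   | Div => a / b
   | Mod => a mod b
   | And => Nat.land a b
   | Or => Nat.lor a b
   | Xor => Nat.lxor a b
   | Shl => Nat.shiftl a b
   | Shr => Nat.shiftr a b
   | Eqb => Nat.b2n (a =? b)
   | Ltb => Nat.b2n (a <? b)
   end) mod 2 ^ w.

Fixpoint eval (w : nat) (s : state) (e : expr) : nat :=
  match e with
  | Const k => k mod 2 ^ w
  | Reg r => regs s r
  | Read a => mem s (eval w s a)
  | Bin o e1 e2 => eval_op w o (eval w s e1) (eval w s e2)
  end.

Fixpoint cost (e : expr) : nat :=
  match e with
  | Const _ | Reg _ => 1
  | Read a => S (cost a)
  | Bin _ e1 e2 => S (cost e1 + cost e2)
  end.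

(** [exec w p s t s']: started in [s], the program [p] halts in [s'] after
    exactly [t] units of time. *)
Inductive exec (w : nat) : com -> state -> nat -> state -> Prop :=
| exec_skip s :
    exec w Skip s 1 s
| exec_assign s r e :
    exec w (Assign r e) s (S (cost e))
      (State (update (regs s) r (eval w s e)) (mem s) (out s))
| exec_store s a e :
    exec w (Store a e) s (S (cost a + cost e))
      (State (regs s) (update (mem s) (eval w s a) (eval w s e)) (out s))
| exec_emit s e :
    exec w (Emit e) s (S (cost e))
      (State (regs s) (mem s) (out s ++ [eval w s e]))
| exec_seq p q s s1 s2 t1 t2 :
    exec w p s t1 s1 -> exec w q s1 t2 s2 ->
    exec w (Seq p q) s (t1 + t2) s2
| exec_if_true e p q s s1 t :
    eval w s e <> 0 -> exec w p s t s1 ->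
    exec w (If e p q) s (S (cost e + t)) s1
| exec_if_false e p q s s1 t :
    eval w s e = 0 -> exec w q s t s1 ->
    exec w (If e p q) s (S (cost e + t)) s1
| exec_while_true e p s s1 s2 t1 t2 :
    eval w s e <> 0 -> exec w p s t1 s1 -> exec w (While e p) s1 t2 s2 ->
    exec w (While e p) s (S (cost e + t1 + t2)) s2
| exec_while_false e p s :
    eval w s e = 0 ->
    exec w (While e p) s (S (cost e)) s.

(** The function whose first values are listed, and which is 0 afterwards. *)
Definition of_list (l : list nat) : nat -> nat := fun a => nth a l 0.

(** * Input and index formats *)

Definition encode_rhs (r : rhs) : list nat :=
  match r with
  | Terminal b => [0; Nat.b2n b; 0]
  | Pair Y Z => [1; Y; Z]
  end.

(** The rules are stored from address 0 on, three words per rule; register 0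
    holds the number of rules and register 1 the start symbol. *)
Definition build_input (G : slp) : state :=
  State (of_list [num_rules G; start G])
        (of_list (flat_map encode_rhs (rules G)))
        [].

(** The memory contains the words of the index from address 0 on, and arbitrary
    words elsewhere. *)
Definition holds_index (w : nat) (I : list nat) (mem0 : nat -> nat) : Prop :=
  (forall a, mem0 a < 2 ^ w) /\
  (forall a, a < length I -> mem0 a = nth a I 0).

Definition query_input (m c : nat) (mem0 : nat -> nat) : state :=
  State (of_list [m; c]) mem0 [].

(** [p] lists the occurrences in [O(m)] time each.  The two [max]/[+ 1] terms
    only matter for [m = 0] and for queries without any occurrence, which have
    to be answered in constant time.  The index must survive the query, so that
    it can be queried again. *)
Definition answers (w C : nat) (p : com) (I : list nat) (B : list bool)
    (m c : nat) : Prop :=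
  forall mem0 : nat -> nat,
    holds_index w I mem0 ->
    exists (t : nat) (s : state),
      exec w p (query_input m c mem0) t s /\
      Permutation (out s) (occurrences B m c) /\
      t <= C * (Nat.max 1 m * length (occurrences B m c) + 1) /\
      holds_index w I (mem s).

(** The bit length of a positive integer: [log n] up to a constant factor, and
    still positive at [n = 1]. *)
Definition bitlen (n : nat) : nat := S (Nat.log2 n).

(* Main.v *)
(* The string is cut into aligned blocks of length L for all L = b 2^h, where b
   is the bit length of n.  For every block and every m < L the index holds the
   least and the greatest number of 1s in a window of length m starting in the
   block.  Both change by 0 or 1 when m grows by 1, so a level takes O(n) bits.
   A window that slides by one position gains or loses at most one 1, so a block
   contains the start of a window with c 1s if and only if c lies between its two
   extremes.  A query therefore descends the tree of blocks to every occurrence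
   and scans a block of length at most 2m there; this costs O(log n + m) per
   occurrence.  For m < b the occurrences are instead looked up in bitmaps: there
   is one bit for m consecutive starting positions, one word for b such bits, and
   a linked list of the nonzero words for every m and c.

   To fill a level, the derivation tree is cut into subtrees with at most s
   leaves.  Equal nonterminals have equal yields, so there are at most g types of
   phrases, and few phrases because two consecutive ones together are longer than s.  For
   two phrase types and each relative offset the extremes of a window whose ends
   run through the two phrases are tabulated; sliding a window through a block
   then takes O(L / s) steps.  With s about (L / g)^(2/3) the tables are paid for
   by the slides, and a level costs O(n L / s) = O(n g^(2/3) L^(1/3)), which is a
   geometric progression in L. *)

(* The choice of [s] balances two costs of a block of length [L]. About [g ^ 2] pairs of types, with
   [2 * s + 1] offsets each and up to [s] positions per entry, make O(g^2 s^2) steps for the tables;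
   [L] slides of O(L / s) steps make O(L^2 / s). They agree at [g ^ 2 * s ^ 3 = L ^ 2], which is
   tested in integers. Where this forces [s = 1], the number of phrases takes the place of [g].
   Relative offsets suffice because a slide always stops with one end of the window on a cut. Cuts
   forced at block boundaries break phrases of the grammar, but add at most 8 types per block. A
   logarithmic cost per occurrence is affordable only if [m >= b], hence the separate structure for
   short windows; and a query without occurrences must end in constant time, hence an amortized walk
   over the blocks. Time is part of every invariant and is paid by remaining cuts, by a potential,
   or by occurrences already listed. Fractional powers are kept out until the end: levels are
   charged to differences of an abstract function [tau], which telescope. *)
From Stdlib Require Import List Arith Bool Lia Permutation Relations Reals Lra.
From Stdlib Require Import FunctionalExtensionality.
Require Import Defs.
Import ListNotations.

#[local] Arguments Nat.modulo : simpl never.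
#[local] Arguments Nat.div : simpl never.
#[local] Arguments Nat.pow : simpl never.

(** * A program logic for the word RAM *)

(* Thirty-two arrays are interleaved: cell [x] of array [k] has address
   [32 * (x + base) + k], and register 0 holds [base].  This needs no bounds on
   the lengths of the arrays, and the memory from [32 * base] on is the index. *)
Definition ad (k : nat) (e : expr) : expr :=
  Bin Add (Bin Mul (Const 32) (Bin Add e (Reg 0))) (Const k).
Definition rd (k : nat) (e : expr) : expr := Read (ad k e).
Definition st (k : nat) (e v : expr) : com := Store (ad k e) v.
Definition arr (base : nat) (m : nat -> nat) (k : nat) : nat -> nat :=
  fun x => m (32 * (x + base) + k).
Definition For (r : nat) (lo hi : expr) (p : com) : com :=
  Seq (Assign r lo)
    (While (Bin Ltb (Reg r) hi) (Seq p (Assign r (Bin Add (Reg r) (Const 1))))).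

(** What a program may change is over-approximated from its syntax, so that framing is decided by
    computation. *)
Fixpoint modr (r : nat) (c : com) : bool :=
  match c with
  | Assign r' _ => r =? r'
  | Seq p q | If _ p q => modr r p || modr r q
  | While _ p => modr r p
  | _ => false
  end.

(** The array hit by a store is the residue of the address modulo 32, which the shape [32 * _ + k]
    determines. A store to an address of any other shape counts as a write to every array. *)
Definition class_of (a : expr) : option nat :=
  match a with
  | Bin Add (Bin Mul (Const c) _) (Const k) => if c =? 32 then Some k else None
  | _ => None
  end.

Fixpoint modk (k : nat) (c : com) : bool :=
  match c with
  | Store a _ => match class_of a with Some k' => k =? k' mod 32 | None => true end
  | Seq p q | If _ p q => modk k p || modk k q
  | While _ p => modk k p
  | _ => false
  end.

Fixpoint emits (c : com) : bool :=
  match c with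
  | Emit _ => true
  | Seq p q | If _ p q => emits p || emits q
  | While _ p => emits p
  | _ => false
  end.

Definition setr (s : state) (r v : nat) : state :=
  State (update (regs s) r v) (mem s) (out s).

Definition seta (base : nat) (s : state) (k x v : nat) : state :=
  State (regs s) (update (mem s) (32 * (x + base) + k) v) (out s).

Definition frame (base : nat) (c : com) (s s' : state) : Prop :=
  (forall r, modr r c = false -> regs s' r = regs s r) /\
  (forall k, modk k c = false -> k < 32 -> arr base (mem s') k = arr base (mem s) k) /\
  (emits c = false -> out s' = out s).

Lemma arr_seta_same base s k x v :
  arr base (mem (seta base s k x v)) k = update (arr base (mem s) k) x v.
Proof.
  extensionality y. unfold arr, seta, update. cbn [mem].
  destruct (Nat.eqb_spec (32 * (y + base) + k) (32 * (x + base) + k));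
    destruct (Nat.eqb_spec y x); auto; lia.
Qed.

Lemma arr_seta_other base s k k' x v :
  k < 32 -> k' < 32 -> k' <> k ->
  arr base (mem (seta base s k x v)) k' = arr base (mem s) k'.
Proof.
  intros ? ? ?. extensionality y. unfold arr, seta, update. cbn [mem].
  destruct (Nat.eqb_spec (32 * (y + base) + k') (32 * (x + base) + k)); auto; lia.
Qed.

Lemma mem_seta_low base s k x v a : a < 32 * base -> mem (seta base s k x v) a = mem s a.
Proof.
  intros. unfold seta, update. cbn [mem].
  destruct (Nat.eqb_spec a (32 * (x + base) + k)); auto; lia.
Qed.

Lemma update_same f x v : update f x v x = v.
Proof. unfold update. now rewrite Nat.eqb_refl. Qed.

Lemma update_other f x v y : y <> x -> update f x v y = f y.
Proof. intros. unfold update. destruct (Nat.eqb_spec y x); [contradiction | auto]. Qed.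

Section Logic.
Variables (w base : nat).
Hypothesis Hw : 5 <= w.

Lemma pow2_32 : 2 ^ w = 32 * 2 ^ (w - 5).
Proof. change 32 with (2 ^ 5). rewrite <- Nat.pow_add_r. f_equal. lia. Qed.

(** As [5 <= w], the modulus [2 ^ w] is a multiple of 32, so wrap-around preserves residues modulo
    32. Framing therefore needs no bound on addresses. *)
Lemma class_eval s a k : class_of a = Some k -> eval w s a mod 32 = k mod 32.
Proof.
  destruct a as [| | |o e1 e2]; try discriminate. cbn.
  destruct o; try discriminate. destruct e1 as [| | |o e3 e4]; try discriminate.
  destruct o; try discriminate. destruct e3 as [c| | |]; try discriminate.
  destruct e2 as [k'| | |]; try discriminate.
  destruct (Nat.eqb_spec c 32) as [->|]; try discriminate. intros [= ->].
  change (((32 mod 2 ^ w * eval w s e4) mod 2 ^ w + k mod 2 ^ w) mod 2 ^ w mod 32 = k mod 32).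
  set (v := eval w s e4). rewrite pow2_32.
  set (u := 2 ^ (w - 5)). assert (0 < u) by (unfold u; apply Nat.neq_0_lt_0, Nat.pow_nonzero; lia).
  clearbody v u.
  assert (E : forall x, x mod (32 * u) mod 32 = x mod 32).
  { intros x. rewrite Nat.Div0.mod_mul_r.
    rewrite (Nat.mul_comm 32), Nat.Div0.mod_add, Nat.Div0.mod_mod. reflexivity. }
  rewrite E, (Nat.Div0.add_mod _ _ 32), !E, (Nat.Div0.mul_mod _ _ 32), !E.
  rewrite Nat.Div0.mod_same. cbn [Nat.mul]. rewrite Nat.Div0.mod_0_l. cbn [Nat.add].
  now rewrite Nat.Div0.mod_mod.
Qed.

Lemma frame_refl c s : frame base c s s.
Proof. repeat split; auto. Qed.

Lemma frame_trans c s1 s2 s3 : frame base c s1 s2 -> frame base c s2 s3 -> frame base c s1 s3.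
Proof.
  intros (A1 & A2 & A3) (B1 & B2 & B3). repeat split; intros.
  - rewrite B1, A1; auto.
  - rewrite B2, A2; auto.
  - rewrite B3, A3; auto.
Qed.

Lemma frame_weaken c c' s s' :
  (forall r, modr r c' = false -> modr r c = false) ->
  (forall k, modk k c' = false -> modk k c = false) ->
  (emits c' = false -> emits c = false) ->
  frame base c s s' -> frame base c' s s'.
Proof. intros ? ? ? (? & ? & ?). repeat split; auto. Qed.

Lemma frame_seq_l p q s s' : frame base p s s' -> frame base (Seq p q) s s'.
Proof. apply frame_weaken; cbn; intros; apply orb_false_iff in H; tauto. Qed.
Lemma frame_seq_r p q s s' : frame base q s s' -> frame base (Seq p q) s s'.
Proof. apply frame_weaken; cbn; intros; apply orb_false_iff in H; tauto. Qed.

Lemma exec_frame c s t s' : exec w c s t s' -> frame base c s s'.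
Proof.
  induction 1; try apply frame_refl.
  - repeat split; auto. intros r' Hr. cbn in *. unfold update. now rewrite Hr.
  - repeat split; auto. intros k Hk Hk32. cbn in *. extensionality x. unfold arr, update.
    destruct (Nat.eqb_spec (32 * (x + base) + k) (eval w s a)) as [E|]; auto.
    destruct (class_of a) as [k'|] eqn:Ea; try discriminate.
    apply class_eval with (s := s) in Ea. rewrite <- E in Ea.
    apply Nat.eqb_neq in Hk. exfalso. apply Hk. rewrite <- Ea.
    rewrite Nat.add_comm, Nat.mul_comm, Nat.Div0.mod_add. symmetry. now apply Nat.mod_small.
  - repeat split; auto. discriminate.
  - eapply frame_trans; [eapply frame_seq_l | eapply frame_seq_r]; eauto.
  - eapply frame_weaken; [..|eassumption]; cbn; intros; apply orb_false_iff in H1; tauto.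
  - eapply frame_weaken; [..|eassumption]; cbn; intros; apply orb_false_iff in H1; tauto.
  - eapply frame_trans; [|eassumption]. eapply frame_weaken; [..|eassumption]; auto.
Qed.

(* [t] is the time spent before [c]; keeping it as a ghost counter makes
   amortized time bounds ordinary loop invariants. *)
Definition run (c : com) (t : nat) (s : state) (Q : nat -> state -> Prop) : Prop :=
  exists d s', exec w c s d s' /\ Q (t + d) s'.

Lemma run_conseq c t s (Q Q' : nat -> state -> Prop) :
  run c t s Q -> (forall t' s', Q t' s' -> frame base c s s' -> Q' t' s') -> run c t s Q'.
Proof.
  intros (d & s' & H & HQ) HI. exists d, s'. split; auto. apply HI; auto.
  eapply exec_frame; eauto.
Qed.

Lemma run_seq p q t s Q : run p t s (fun t1 s1 => run q t1 s1 Q) -> run (Seq p q) t s Q.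
Proof using. clear Hw.
  intros (d & s1 & H1 & d' & s2 & H2 & HQ). exists (d + d'), s2. split.
  - econstructor; eauto.
  - now rewrite Nat.add_assoc.
Qed.

Lemma run_skip t s (Q : nat -> state -> Prop) : Q (t + 1) s -> run Skip t s Q.
Proof using. clear Hw. intros. exists 1, s. split; auto. constructor. Qed.

Lemma run_assign r e v t s (Q : nat -> state -> Prop) :
  eval w s e = v -> Q (t + S (cost e)) (setr s r v) -> run (Assign r e) t s Q.
Proof using. clear Hw. intros <- HQ. eexists _, _. split; [constructor | exact HQ]. Qed.

Lemma run_emit e v t s (Q : nat -> state -> Prop) :
  eval w s e = v -> Q (t + S (cost e)) (State (regs s) (mem s) (out s ++ [v])) ->
  run (Emit e) t s Q.
Proof using. clear Hw. intros <- HQ. eexists _, _. split; [constructor | exact HQ]. Qed.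

Lemma eval_ad s k e x :
  k < 32 -> eval w s e = x -> regs s 0 = base -> 32 * (x + base) + 32 < 2 ^ w ->
  eval w s (ad k e) = 32 * (x + base) + k.
Proof using. clear Hw.
  intros Hk He Hb Hx. unfold ad. cbn [eval]; unfold eval_op. rewrite He, Hb.
  rewrite (Nat.mod_small 32) by lia. rewrite (Nat.mod_small (x + base)) by lia.
  rewrite (Nat.mod_small k) by lia. rewrite (Nat.mod_small (32 * _)) by lia.
  rewrite Nat.mod_small; lia.
Qed.

Lemma run_st k e1 e2 x v t s (Q : nat -> state -> Prop) :
  k < 32 -> eval w s e1 = x -> regs s 0 = base -> 32 * (x + base) + 32 < 2 ^ w ->
  eval w s e2 = v ->
  Q (t + (7 + cost e1 + cost e2)) (seta base s k x v) -> run (st k e1 e2) t s Q.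
Proof using. clear Hw.
  intros Hk H1 Hb Hx H2 HQ. unfold st. eexists _, _. split; [constructor|].
  rewrite (eval_ad s k e1 x), H2 by auto.
  replace (t + S (cost (ad k e1) + cost e2)) with (t + (7 + cost e1 + cost e2))
    by (unfold ad; cbn [cost]; lia).
  exact HQ.
Qed.

Lemma run_if e p q v t s Q :
  eval w s e = v ->
  (v <> 0 -> run p (t + S (cost e)) s Q) -> (v = 0 -> run q (t + S (cost e)) s Q) ->
  run (If e p q) t s Q.
Proof using. clear Hw.
  intros Hv HT HF. destruct (Nat.eq_dec v 0) as [E|E].
  - destruct (HF E) as (d & s' & H & HQ). exists (S (cost e + d)), s'. split.
    + apply exec_if_false; congruence.
    + replace (t + S (cost e + d)) with (t + S (cost e) + d) by lia. auto.
  - destruct (HT E) as (d & s' & H & HQ). exists (S (cost e + d)), s'. split.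
    + apply exec_if_true; congruence.
    + replace (t + S (cost e + d)) with (t + S (cost e) + d) by lia. auto.
Qed.

(** The first argument of the invariant is the variant. The frame links every iteration to the state
    before the loop, so that an invariant mentions only what the body changes. *)
Lemma run_while (I : nat -> nat -> state -> Prop) e p (Q : nat -> state -> Prop) k0 t0 s0 :
  I k0 t0 s0 ->
  (forall k t s, frame base p s0 s -> I k t s ->
     exists v, eval w s e = v /\
       (v <> 0 -> run p (t + S (cost e)) s (fun t' s' => exists k', k' < k /\ I k' t' s')) /\
       (v = 0 -> Q (t + S (cost e)) s)) ->
  run (While e p) t0 s0 Q.
Proof.
  intros HI Hstep.
  assert (G : forall k t s, frame base p s0 s -> I k t s -> run (While e p) t s Q).
  { induction k as [k IH] using (well_founded_induction lt_wf). intros t s Hf Hk.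
    destruct (Hstep k t s Hf Hk) as (v & Hv & HT & HF).
    destruct (Nat.eq_dec v 0) as [E|E].
    - eexists _, _. split; [apply exec_while_false; congruence | auto].
    - destruct (HT E) as (d & s' & H & k' & Hk' & HI').
      destruct (fun X => IH k' Hk' _ s' X HI') as (d' & s2 & H2 & HQ).
      { eapply frame_trans; eauto. eapply exec_frame; eauto. }
      exists (S (cost e + d + d')), s2. split.
      + eapply exec_while_true; eauto; congruence.
      + replace (t + S (cost e + d + d')) with (t + S (cost e) + d + d') by lia. auto. }
  eapply G; eauto. apply frame_refl.
Qed.

(* The invariant [I i] is asserted with the loop variable already equal to [i]. *)
Lemma run_for (I : nat -> state -> Prop) c r elo ehi p lo hi t0 s0 (Q : nat -> state -> Prop) :
  modr r p = false ->
  eval w s0 elo = lo -> lo <= hi -> hi < 2 ^ w ->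
  I lo (setr s0 r lo) ->
  (forall i s, i <= hi -> frame base (For r elo ehi p) s0 s -> regs s r = i -> I i s ->
     eval w s ehi = hi) ->
  (forall i t s, lo <= i -> i < hi -> frame base (For r elo ehi p) s0 s -> regs s r = i -> I i s ->
     run p t s (fun t' s' => t' <= t + c /\ I (S i) (setr s' r (S i)))) ->
  (forall t s, frame base (For r elo ehi p) s0 s -> regs s r = hi -> I hi s ->
     t <= t0 + (hi - lo) * (c + cost ehi + 7) + cost elo + cost ehi + 4 -> Q t s) ->
  run (For r elo ehi p) t0 s0 Q.
Proof.
  intros Hr Hlo Hle Hhi I0 Hev Hbody HQ. unfold For. apply run_seq.
  eapply run_assign; [exact Hlo|].
  assert (F0 : frame base (For r elo ehi p) s0 (setr s0 r lo)).
  { apply frame_seq_l. repeat split; auto. intros r' H. cbn in *. unfold update. now rewrite H. }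
  assert (FF : forall s, frame base (Seq p (Assign r (Bin Add (Reg r) (Const 1)))) (setr s0 r lo) s ->
                frame base (For r elo ehi p) s0 s).
  { intros s Hs. eapply frame_trans; [exact F0|]. apply frame_seq_r.
    eapply frame_weaken; [..|exact Hs]; auto. }
  apply run_while with (k0 := hi - lo)
    (I := fun k t s => exists i, lo <= i /\ i <= hi /\ k = hi - i /\ regs s r = i /\ I i s /\
       t <= t0 + S (cost elo) + (i - lo) * (c + cost ehi + 7)).
  - exists lo. repeat split; auto; try lia. cbn. apply update_same.
  - intros k t s Hf (i & Hi1 & Hi2 & -> & Hri & HI & Ht).
    pose proof (FF s Hf) as HF.
    eexists. split; [reflexivity|].
    cbn [eval]; unfold eval_op. rewrite (Hev i s Hi2 HF Hri HI), Hri.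
    assert (1 < 2 ^ w) by (rewrite pow2_32; pose proof (Nat.pow_nonzero 2 (w - 5)); lia).
    destruct (Nat.ltb_spec i hi); cbn [Nat.b2n]; rewrite Nat.mod_small by lia.
    + split; [|lia]. intros _. apply run_seq.
      eapply run_conseq; [apply (Hbody i); auto; lia|].
      intros t' s' (Ht' & HI') Hf'.
      assert (Hri' : regs s' r = i) by (rewrite (proj1 Hf' r Hr); auto).
      eapply run_assign.
      { cbn [eval]; unfold eval_op. rewrite Hri', (Nat.mod_small 1), Nat.mod_small by lia. reflexivity. }
      exists (hi - S i). split; [lia|]. exists (S i).
      replace (i + 1) with (S i) by lia.
      repeat split; auto; try lia.
      * cbn. apply update_same.
      * cbn [cost] in *. replace (S i - lo) with (S (i - lo)) by lia. lia.
    + split; [lia|]. intros _. replace i with hi in * by lia. apply HQ; auto.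
      cbn [cost]. lia.
Qed.

Lemma ev_const s k : k < 2 ^ w -> eval w s (Const k) = k.
Proof using. clear Hw. intros. cbn. now apply Nat.mod_small. Qed.
Lemma ev_reg s r v : regs s r = v -> eval w s (Reg r) = v.
Proof using. clear Hw. auto. Qed.
Lemma ev_rd s k e x f :
  k < 32 -> eval w s e = x -> regs s 0 = base -> 32 * (x + base) + 32 < 2 ^ w ->
  arr base (mem s) k = f -> eval w s (rd k e) = f x.
Proof using. clear Hw.
  intros Hk He Hb Hx <-. unfold rd. cbn [eval]. rewrite (eval_ad s k e x) by auto. reflexivity.
Qed.
Lemma ev_read s e x v : eval w s e = x -> mem s x = v -> eval w s (Read e) = v.
Proof using. clear Hw. intros <- <-. reflexivity. Qed.
Lemma ev_add s a b x y : eval w s a = x -> eval w s b = y -> x + y < 2 ^ w ->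
  eval w s (Bin Add a b) = x + y.
Proof using. clear Hw. intros <- <- ?. cbn [eval]; unfold eval_op. now apply Nat.mod_small. Qed.
Lemma ev_sub s a b x y : eval w s a = x -> eval w s b = y -> y <= x -> x < 2 ^ w ->
  eval w s (Bin Sub a b) = x - y.
Proof using. clear Hw.
  intros <- <- ? ?. cbn [eval]; unfold eval_op. set (x := eval w s a) in *. set (y := eval w s b) in *.
  replace (x + 2 ^ w - y) with (x - y + 1 * 2 ^ w) by lia.
  rewrite Nat.Div0.mod_add. apply Nat.mod_small. lia.
Qed.
Lemma ev_mul s a b x y : eval w s a = x -> eval w s b = y -> x * y < 2 ^ w ->
  eval w s (Bin Mul a b) = x * y.
Proof using. clear Hw. intros <- <- ?. cbn [eval]; unfold eval_op. now apply Nat.mod_small. Qed.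
Lemma div_le_self x y : x / y <= x.
Proof using. clear Hw. destruct y; [change (x / 0) with 0; lia|]. apply Nat.Div0.div_le_upper_bound. nia. Qed.
Lemma ev_div s a b x y : eval w s a = x -> eval w s b = y -> x < 2 ^ w ->
  eval w s (Bin Div a b) = x / y.
Proof using. clear Hw.
  intros <- <- ?. cbn [eval]; unfold eval_op. apply Nat.mod_small.
  pose proof (div_le_self (eval w s a) (eval w s b)). lia.
Qed.
Lemma ev_mod s a b x y : eval w s a = x -> eval w s b = y -> x < 2 ^ w ->
  eval w s (Bin Mod a b) = x mod y.
Proof using. clear Hw.
  intros <- <- ?. cbn [eval]; unfold eval_op. apply Nat.mod_small.
  pose proof (Nat.Div0.mod_le (eval w s a) (eval w s b)). lia.
Qed.
Lemma one_lt_pow2 : 1 < 2 ^ w.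
Proof. rewrite pow2_32. pose proof (Nat.pow_nonzero 2 (w - 5)). lia. Qed.
Lemma ev_ltb s a b x y : eval w s a = x -> eval w s b = y ->
  eval w s (Bin Ltb a b) = Nat.b2n (x <? y).
Proof.
  intros <- <-. cbn [eval]; unfold eval_op. apply Nat.mod_small. pose proof one_lt_pow2.
  destruct (_ <? _); cbn; lia.
Qed.
Lemma ev_eqb s a b x y : eval w s a = x -> eval w s b = y ->
  eval w s (Bin Eqb a b) = Nat.b2n (x =? y).
Proof.
  intros <- <-. cbn [eval]; unfold eval_op. apply Nat.mod_small. pose proof one_lt_pow2.
  destruct (_ =? _); cbn; lia.
Qed.
Lemma ev_or s a b x y : eval w s a = x -> eval w s b = y -> Nat.lor x y < 2 ^ w ->
  eval w s (Bin Or a b) = Nat.lor x y.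
Proof using. clear Hw. intros <- <- ?. cbn [eval]; unfold eval_op. now apply Nat.mod_small. Qed.
Lemma ev_shl s a b x y : eval w s a = x -> eval w s b = y -> x * 2 ^ y < 2 ^ w ->
  eval w s (Bin Shl a b) = x * 2 ^ y.
Proof using. clear Hw. intros <- <- ?. cbn [eval]; unfold eval_op. rewrite Nat.shiftl_mul_pow2 in *. now apply Nat.mod_small. Qed.
Lemma ev_shr s a b x y : eval w s a = x -> eval w s b = y -> x < 2 ^ w ->
  eval w s (Bin Shr a b) = x / 2 ^ y.
Proof using. clear Hw.
  intros <- <- ?. cbn [eval]; unfold eval_op. rewrite Nat.shiftr_div_pow2. apply Nat.mod_small.
  pose proof (div_le_self (eval w s a) (2 ^ eval w s b)). lia.
Qed.

Lemma run_if_ltb a b p q x y t s Q :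
  eval w s a = x -> eval w s b = y ->
  (x < y -> run p (t + (2 + cost a + cost b)) s Q) ->
  (y <= x -> run q (t + (2 + cost a + cost b)) s Q) ->
  run (If (Bin Ltb a b) p q) t s Q.
Proof.
  intros Ha Hb HT HF. eapply run_if; [apply ev_ltb; eassumption| |]; cbn [cost];
    destruct (Nat.ltb_spec x y); cbn; try lia; auto.
Qed.
Lemma run_if_eqb a b p q x y t s Q :
  eval w s a = x -> eval w s b = y ->
  (x = y -> run p (t + (2 + cost a + cost b)) s Q) ->
  (x <> y -> run q (t + (2 + cost a + cost b)) s Q) ->
  run (If (Bin Eqb a b) p q) t s Q.
Proof.
  intros Ha Hb HT HF. eapply run_if; [apply ev_eqb; eassumption| |]; cbn [cost];
    destruct (Nat.eqb_spec x y); cbn; try lia; auto.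
Qed.
Lemma setr_id s r v : regs s r = v -> setr s r v = s.
Proof using.
  intros <-. destruct s as [R m o]. unfold setr. cbn. f_equal. extensionality i. unfold update.
  destruct (Nat.eqb_spec i r); congruence.
Qed.
(** A conditional assignment yields one state containing an [if]; the many updates of minima and
    maxima then do not split the proof into branches. *)
Lemma run_select a b r e x y v u t s (Q : nat -> state -> Prop) :
  eval w s a = x -> eval w s b = y -> eval w s e = v -> regs s r = u ->
  (forall t', t' <= t + (4 + cost a + cost b + cost e) ->
     Q t' (setr s r (if x <? y then v else u))) ->
  run (If (Bin Ltb a b) (Assign r e) Skip) t s Q.
Proof.
  intros Ha Hb He Hr HQ. eapply run_if_ltb; [eassumption|eassumption|intros H|intros H].
  - eapply run_assign; [eassumption|]. destruct (Nat.ltb_spec x y); [|lia]. apply HQ. lia.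
  - apply run_skip. destruct (Nat.ltb_spec x y); [lia|].
    specialize (HQ (t + (2 + cost a + cost b) + 1) ltac:(lia)).
    now rewrite (setr_id s r u Hr) in HQ.
Qed.
Lemma run_while_ltb (I : nat -> nat -> state -> Prop) a b p (Q : nat -> state -> Prop) k0 t0 s0 :
  I k0 t0 s0 ->
  (forall k t s, frame base p s0 s -> I k t s ->
     exists x y, eval w s a = x /\ eval w s b = y /\
       (x < y -> run p (t + (2 + cost a + cost b)) s
                   (fun t' s' => exists k', k' < k /\ I k' t' s')) /\
       (y <= x -> Q (t + (2 + cost a + cost b)) s)) ->
  run (While (Bin Ltb a b) p) t0 s0 Q.
Proof.
  intros H0 Hs. apply (run_while I _ _ _ k0 t0 s0 H0). intros k t s Hf HI.
  destruct (Hs k t s Hf HI) as (x & y & Ha & Hb & HT & HF).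
  eexists. split; [apply ev_ltb; eassumption|]. cbn [cost].
  destruct (Nat.ltb_spec x y); cbn [Nat.b2n]; split; try lia; auto.
Qed.

Lemma run_while_ltb2 (I : nat -> nat -> state -> Prop) a b c d p (Q : nat -> state -> Prop) k0 t0 s0 :
  I k0 t0 s0 ->
  (forall k t s, frame base p s0 s -> I k t s ->
     exists x y x' y', eval w s a = x /\ eval w s b = y /\ eval w s c = x' /\ eval w s d = y' /\
       (x < y -> x' < y' -> run p (t + (4 + cost a + cost b + cost c + cost d)) s
                   (fun t' s' => exists k', k' < k /\ I k' t' s')) /\
       (y <= x \/ y' <= x' -> Q (t + (4 + cost a + cost b + cost c + cost d)) s)) ->
  run (While (Bin Mul (Bin Ltb a b) (Bin Ltb c d)) p) t0 s0 Q.
Proof.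
  intros H0 Hs. apply (run_while I _ _ _ k0 t0 s0 H0). intros k t s Hf HI.
  destruct (Hs k t s Hf HI) as (x & y & x' & y' & Ha & Hb & Hc & Hd & HT & HF).
  pose proof one_lt_pow2.
  eexists. split; [apply ev_mul; [apply ev_ltb; eassumption|apply ev_ltb; eassumption|]|].
  { destruct (x <? y), (x' <? y'); cbn [Nat.b2n]; lia. }
  cbn [cost]. replace (S (S (S (cost a + cost b) + S (cost c + cost d))))
    with (4 + cost a + cost b + cost c + cost d) by lia.
  destruct (Nat.ltb_spec x y), (Nat.ltb_spec x' y'); cbn [Nat.b2n]; split; intros; try lia; auto.
Qed.
End Logic.


(** * Symbolic execution, with registers and arrays looked up through frames *)

Ltac lookup_reg :=
  cbn [regs setr seta update Nat.eqb];
  first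
    [ eassumption
    | match goal with
      | H : frame _ _ ?s0 ?s |- regs ?s ?r = _ =>
          rewrite (proj1 H r eq_refl); lookup_reg
      end
    | reflexivity ].

Ltac lookup_arr :=
  cbn [mem setr];
  first
    [ eassumption
    | match goal with
      | |- arr ?b (mem (seta ?b ?s ?k ?x ?v)) ?k = _ =>
          rewrite (arr_seta_same b s k x v);
          lazymatch goal with
          | |- update ?f _ _ = update ?g _ _ =>
              let H := fresh in assert (H : f = g) by lookup_arr; rewrite H; reflexivity
          | |- _ => apply (f_equal (fun f => update f x v)); lookup_arr
          end
      | |- arr ?b (mem (seta ?b ?s ?k ?x ?v)) ?k' = _ =>
          rewrite (arr_seta_other b s k k' x v) by lia; lookup_arr
      | H : frame ?b _ ?s0 ?s |- arr ?b (mem ?s) ?k = _ =>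
          rewrite (proj1 (proj2 H) k eq_refl ltac:(lia)); lookup_arr
      end
    | reflexivity ].

Ltac lookup_mem :=
  cbn [mem setr]; rewrite ?mem_seta_low by lia; cbn [mem setr];
  first [eassumption | reflexivity].

Ltac ev_step :=
  lazymatch goal with
  | |- eval _ _ (Const _) = _ => apply ev_const
  | |- eval _ _ (Reg _) = _ => apply ev_reg; lookup_reg
  | |- eval _ _ (Read _) = _ => eapply ev_read; [ev_step | lookup_mem]
  | |- eval _ _ (rd _ _) = _ => eapply ev_rd; [lia | ev_step | lookup_reg | | lookup_arr]
  | |- eval _ _ (Bin Add _ _) = _ => eapply ev_add; [ev_step | ev_step | ]
  | |- eval _ _ (Bin Sub _ _) = _ => eapply ev_sub; [ev_step | ev_step | | ]
  | |- eval _ _ (Bin Mul _ _) = _ => eapply ev_mul; [ev_step | ev_step | ]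
  | |- eval _ _ (Bin Div _ _) = _ => eapply ev_div; [ev_step | ev_step | ]
  | |- eval _ _ (Bin Mod _ _) = _ => eapply ev_mod; [ev_step | ev_step | ]
  | |- eval _ _ (Bin Or _ _) = _ => eapply ev_or; [ev_step | ev_step | ]
  | |- eval _ _ (Bin Shl _ _) = _ => eapply ev_shl; [ev_step | ev_step | ]
  | |- eval _ _ (Bin Shr _ _) = _ => eapply ev_shr; [ev_step | ev_step | ]
  | |- eval _ _ (Bin Ltb _ _) = _ => eapply ev_ltb; [assumption | ev_step | ev_step]
  | |- eval _ _ (Bin Eqb _ _) = _ => eapply ev_eqb; [assumption | ev_step | ev_step]
  end.

Ltac ev := ev_step; try lia.

Ltac step :=
  lazymatch goal with
  | |- run _ (Seq _ _) _ _ _ => apply run_seq; step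
  | |- run _ (Assign _ _) _ _ _ => eapply run_assign; [ev | cbn [cost rd ad]]
  | |- run _ (Emit _) _ _ _ => eapply run_emit; [ev | cbn [cost rd ad]]
  | |- run _ (st _ _ _) _ _ _ =>
      eapply run_st; [lia | ev | lookup_reg | try lia | ev | cbn [cost rd ad]]
  | |- run _ Skip _ _ _ => apply run_skip
  | |- run _ (If (Bin Ltb _ _) (Assign _ _) Skip) ?t _ _ =>
      eapply run_select; [assumption | ev | ev | ev | lookup_reg |
        let t' := fresh "t" in let H := fresh "Ht" in
        cbn [cost rd ad]; intros t' H]
  | |- run _ (If (Bin Ltb _ _) _ _) _ _ _ =>
      eapply run_if_ltb; [assumption | ev | ev | intro; cbn [cost rd ad] | intro; cbn [cost rd ad]]
  | |- run _ (If (Bin Eqb _ _) _ _) _ _ _ =>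
      eapply run_if_eqb; [assumption | ev | ev | intro; cbn [cost rd ad] | intro; cbn [cost rd ad]]
  end.

Ltac steps := repeat (step; try lia).

Ltac simp_state := cbn [regs setr seta update Nat.eqb out].

Ltac simp_arr :=
  repeat (cbn [mem setr];
    first
      [ rewrite arr_seta_same
      | match goal with
        | |- context [arr ?b (mem (seta ?b ?s ?k ?x ?v)) ?k'] =>
            rewrite (arr_seta_other b s k k' x v) by lia
        end ]);
  cbn [mem setr].

(** * The programs *)

Declare Scope prog_scope.
Delimit Scope prog_scope with prog.
Coercion Const : nat >-> expr.
Notation "$ r" := (Reg r) (at level 1, r at level 0, format "$ r") : prog_scope.
Notation "a + b" := (Bin Add a b) : prog_scope.
Notation "a - b" := (Bin Sub a b) : prog_scope.
Notation "a * b" := (Bin Mul a b) : prog_scope.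
Notation "a / b" := (Bin Div a b) : prog_scope.
Notation "a 'mod' b" := (Bin Mod a b) : prog_scope.
Notation "a < b" := (Bin Ltb a b) : prog_scope.
Notation "a == b" := (Bin Eqb a b) (at level 70) : prog_scope.
Notation "r <- e" := (Assign r e) (at level 75) : prog_scope.
Notation "k .[ e ]" := (rd k e) (at level 2, left associativity, e at level 200, format "k .[ e ]") : prog_scope.
Notation "k .[ e := v ]" := (st k e v)
  (at level 2, left associativity, e at level 200, v at level 200, format "k .[ e  :=  v ]") : prog_scope.
Notation "p ;; q" := (Seq p q) (at level 85, right associativity) : prog_scope.

(* P: numbers of 1s in the prefixes; J: junctions of the derivation tree, in
   preorder; Z, K: stack of the traversal; POP, LOW: number of 1s and position of
   the lowest 1 of a word; EO, SO: ends and starts of phrases; CT: cuts; ST, NX: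
   last cut and next cut; RP: representatives of the phrase types; ID: types;
   T1, T2: tables for pairs of types; MN, MX: extremes of one level; MS, MB, XS,
   XB: samples and increment bits of the minima and maxima; BM, NS, HD: bitmaps,
   next nonzero bitmap and list heads for short windows; H: header. *)
Notation aP := 0 (only parsing).
Notation aJ := 1 (only parsing).
Notation aZ := 2 (only parsing).
Notation aK := 3 (only parsing).
Notation aPOP := 4 (only parsing).
Notation aLOW := 5 (only parsing).
Notation aEO := 6 (only parsing).
Notation aSO := 7 (only parsing).
Notation aCT := 8 (only parsing).
Notation aST := 9 (only parsing).
Notation aNX := 10 (only parsing).
Notation aRP := 11 (only parsing).
Notation aID := 12 (only parsing).
Notation aT1 := 13 (only parsing).
Notation aT2 := 14 (only parsing).
Notation aMN := 15 (only parsing).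
Notation aMX := 16 (only parsing).
Notation aMS := 17 (only parsing).
Notation aMB := 18 (only parsing).
Notation aXS := 19 (only parsing).
Notation aXB := 20 (only parsing).
Notation aBM := 21 (only parsing).
Notation aNS := 22 (only parsing).
Notation aHD := 23 (only parsing).
Notation aH := 24 (only parsing).

Section Programs.
Local Open Scope prog_scope.

(** An explicit stack holds the right siblings still to be expanded, with the preorder numbers of
    their junctions: the position of a junction is known only when its right sibling is popped.
    Register 2 is the number of letters produced, 3 the current nonterminal, 4 the next junction
    number, 5 the height of the stack, 6 a flag that is cleared at the end. *)
Definition traverse : com :=
  3 <- $1;; 6 <- 1;;
  While (0 < $6)
    (If (0 < Read (3 * $3))
       (aZ.[$5 := Read (3 * $3 + 2)];; aK.[$5 := $4];; 5 <- $5 + 1;; 4 <- $4 + 1;;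
        3 <- Read (3 * $3 + 1))
       (aP.[$2 + 1 := aP.[$2] + Read (3 * $3 + 1)];; 2 <- $2 + 1;;
        If (0 < $5)
          (5 <- $5 - 1;; 3 <- aZ.[$5];; aJ.[aK.[$5] := $2])
          (6 <- 0))).

(** From here on register 7 holds [b], register 8 holds [2 ^ b], and register 9 the number of words
    that a level takes in each encoded array. *)
Definition find_b : com :=
  7 <- 1;; 8 <- 2;;
  While ($8 < $2 + 1) (8 <- $8 * 2;; 7 <- $7 + 1);;
  9 <- $2 / $7 + 1.

(** No instruction counts or locates the 1s of a word; tables for all words of [b] bits do, in
    linear space since [2 ^ b <= 2 * n]. *)
Definition tables : com :=
  For 13 1 $8
    (aPOP.[$13 := aPOP.[$13 / 2] + $13 mod 2];;
     If ($13 mod 2 == 0) (aLOW.[$13 := aLOW.[$13 / 2] + 1]) (aLOW.[$13 := 0])).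

(** Register 0, the base of the arrays, is also [g]: with this base the arrays start at [32 * g],
    above the [3 * g] words of the input. The loop ends at the largest [s] with
    [s ^ 3 * g ^ 2 <= L ^ 2], or at 1 if there is none. *)
Definition choose_s : com :=
  12 <- 1;;
  While (($12 + 1) * ($12 + 1) * ($12 + 1) * $0 * $0 < $10 * $10 + 1) (12 <- $12 + 1).

Definition init_cuts : com :=
  For 13 0 $2 (aEO.[$13 := $13 + 1];; aSO.[$13 + 1 := $13];; aCT.[$13 + 1 := 1]).

(** Reverse preorder of the junctions finishes both subtrees before the phrases at their common
    junction are joined. *)
Definition merge : com :=
  For 13 0 ($2 - 1)
    (14 <- aJ.[$2 - 2 - $13];; 15 <- aSO.[$14];; 16 <- aEO.[$14];;
     If ($16 < $15 + $12 + 1)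
       (aEO.[$15 := $16];; aSO.[$16 := $15];; aCT.[$14 := 0]) Skip).

(** Multiples of [L] become cuts so that no phrase crosses a block boundary, and their predecessors
    so that the last start [a + L - 1] of a block ends a segment of a slide. *)
Definition forward : com :=
  aST.[0 := 0];;
  For 13 1 ($2 + 1)
    (aCT.[$13 := aCT.[$13] + ($13 mod $10 == 0) + (($13 + 1) mod $10 == 0)];;
     If (0 < aCT.[$13]) (aST.[$13 := $13]) (aST.[$13 := aST.[$13 - 1]])).

Definition backward : com :=
  For 13 0 $2
    (14 <- $2 - 1 - $13;;
     If (0 < aCT.[$14 + 1]) (aNX.[$14 := $14 + 1]) (aNX.[$14 := aNX.[$14 + 1]])).

(** The string is present only through its prefix counts; two phrases agree when the counts relative
    to their starts do. *)
Definition compare_letters : com :=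
  23 <- 1;;
  For 24 0 ($40 + 1)
    (If (aP.[$19 + $24] + aP.[$15] == aP.[$15 + $24] + aP.[$19]) Skip (23 <- 0)).

Definition compare : com :=
  15 <- aRP.[$21];;
  If (aNX.[$15] == $15 + $40)
    (compare_letters;; If (0 < $23) (22 <- $21) Skip) Skip.

Definition find_type : com :=
  40 <- aNX.[$19] - $19;; 22 <- $18;;
  For 21 0 $18 compare;;
  aID.[$19 := $22];;
  If ($22 == $18) (aRP.[$18 := $19];; 18 <- $18 + 1) Skip.

Definition types : com :=
  18 <- 0;; 19 <- $17;; 20 <- $17 + 2 * $10;;
  If ($2 < $20) (20 <- $2) Skip;;
  While ($19 < $20) (find_type;; 19 <- aNX.[$19]).

Definition entry_loop : com :=
  While (($13 < $15) * ($14 < $16))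
    (13 <- $13 + 1;; 14 <- $14 + 1;;
     32 <- aP.[$14] + aP.[$35] + $12 - (aP.[$13] + aP.[$36]);;
     If ($32 < $30) (30 <- $32) Skip;;
     If ($31 < $32) (31 <- $32) Skip).

Definition entry_tail : com :=
  35 <- $13;; 36 <- $14;; 30 <- $12;; 31 <- $12;;
  entry_loop;;
  37 <- ($25 * $18 + $26) * (2 * $12 + 1) + $27;;
  aT1.[$37 := $30];; aT2.[$37 := $31].

(** Register 27 is the offset in the right phrase minus the offset in the left one, shifted by [s].
    One of the two offsets is 0, so this number determines both. *)
Definition entry : com :=
  13 <- aRP.[$25];; 14 <- aRP.[$26];; 15 <- aNX.[$13];; 16 <- aNX.[$14];;
  If ($27 < $12) (13 <- $13 + ($12 - $27)) (14 <- $14 + ($27 - $12));;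
  entry_tail.

Definition table : com :=
  For 25 0 $18 (For 26 0 $18 (For 27 0 (2 * $12 + 1) entry)).

(** Registers 35 and 36 are the two ends of the window. Each round moves both by the distance to the
    nearer of their next cuts and takes the extremes in between from the tables, where the shift by
    [s] is undone. *)
Definition slide_loop : com :=
  While ($35 < $34)
    (15 <- aST.[$35];; 16 <- aST.[$36];;
     37 <- (aID.[$15] * $18 + aID.[$16]) * (2 * $12 + 1) + ($36 - $16 + $12 - ($35 - $15));;
     38 <- aP.[$36] + aT1.[$37] - (aP.[$35] + $12);;
     If ($38 < $30) (30 <- $38) Skip;;
     38 <- aP.[$36] + aT2.[$37] - (aP.[$35] + $12);;
     If ($31 < $38) (31 <- $38) Skip;;
     38 <- aNX.[$35] - $35;;
     If (aNX.[$36] - $36 < $38) (38 <- aNX.[$36] - $36) Skip;;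
     35 <- $35 + $38;; 36 <- $36 + $38).

Definition slide : com :=
  34 <- $17 + $10 - 1;;
  If ($17 + $2 - $33 < $34) (34 <- $17 + $2 - $33) Skip;;
  35 <- $17;; 36 <- $33;; 30 <- aP.[$36] - aP.[$35];; 31 <- $30;;
  slide_loop;;
  aMN.[$33 := $30];; aMX.[$33 := $31].

Definition slides : com :=
  39 <- $17 + $10;;
  If ($2 + 1 < $39) (39 <- $2 + 1) Skip;;
  For 33 $17 $39 slide.

Definition nodes : com :=
  17 <- 0;;
  While ($17 < $2 + 1) (types;; table;; slides;; 17 <- $17 + $10).

Definition encode : com :=
  For 13 0 ($2 + 1)
    (14 <- $11 + $13 / $7;; 15 <- $13 mod $7;;
     If ($15 == 0)
       (aMS.[$14 := aMN.[$13]];; aMB.[$14 := 0];; aXS.[$14 := aMX.[$13]];; aXB.[$14 := 0];;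
        16 <- 1)
       (aMB.[$14 := aMB.[$14] + (aMN.[$13] - aMN.[$13 - 1]) * $16];;
        aXB.[$14 := aXB.[$14] + (aMX.[$13] - aMX.[$13 - 1]) * $16];;
        16 <- 2 * $16)).

Definition level : com :=
  choose_s;; init_cuts;; merge;; forward;; backward;; nodes;; encode.

(** Running up to [2 * n] makes the last [L] exceed [n], hence every window length. *)
Definition levels : com :=
  10 <- $7;; 11 <- 0;;
  While ($10 < 2 * $2 + 1) (level;; 10 <- 2 * $10;; 11 <- $11 + $9).

(** Starts come in decreasing order, so that pushing a superblock onto the front of its list keeps
    the list increasing. *)
Definition small_step : com :=
  14 <- $2 - $42 - $13;; 15 <- $14 / $42;; 16 <- aP.[$14 + $42] - aP.[$14];;
  17 <- $15 / $7;; 18 <- $42 * $41 + $16;; 19 <- $18 + $17 * ($42 + 1);;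
  If (aBM.[$19] == 0) (aNS.[$19 := aHD.[$18]];; aHD.[$18 := $17 + 1]) Skip;;
  aBM.[$19 := Bin Or (aBM.[$19]) (Bin Shl 1 ($15 mod $7))].

Definition small : com :=
  41 <- 2 * $9 + $7 + 2;;
  For 42 1 $7 (For 13 0 ($2 + 1 - $42) small_step).

(** The loop over the levels has moved one level past the top, hence the half and the difference in
    the header. All 32 arrays are emitted up to one common length, which is enough for each that a
    query reads. *)
Definition finish : com :=
  aH.[0 := $2];; aH.[1 := $7];; aH.[2 := $9];; aH.[3 := $10 / 2];; aH.[4 := $11 - $9];;
  aH.[5 := $41];;
  13 <- 32 * ($8 + ($7 + 1) * $41 + 6);;
  For 14 0 $13 (Emit (Read ($14 + 32 * $0))).

Definition build : com :=
  traverse;; find_b;; tables;; levels;; small;; finish.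

Definition scan (len : expr) : com :=
  12 <- $11 + len;;
  If ($3 + 1 < $12 + $2) (12 <- $3 + 1 - $2) Skip;;
  For 13 $11 $12 (If (aP.[$13 + $2] == aP.[$13] + $1) (Emit $13) Skip).

Definition bits_loop : com :=
  While (0 < $8)
    (10 <- aLOW.[$8];; 9 <- $9 + $10;; 11 <- $9 * $2;; scan $2;;
     8 <- Bin Shr $8 ($10 + 1);; 9 <- $9 + 1).

Definition query_small : com :=
  5 <- $2 * aH.[5] + $1;; 6 <- aHD.[$5];;
  While (0 < $6)
    (7 <- $5 + ($6 - 1) * ($2 + 1);; 8 <- aBM.[$7];; 9 <- ($6 - 1) * $4;;
     bits_loop;; 6 <- aNS.[$7]).

(** At most one level is climbed per step, even if a still larger block begins at the new
    position. *)
Definition advance : com :=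
  5 <- $5 + $6;;
  If ($6 < $14) (If ($5 mod (2 * $6) == 0) (6 <- 2 * $6;; 7 <- $7 + $15) Skip) Skip.

(** A block is split only while [2 * m < L], so that its halves are still longer than [m], as the
    stored extremes require; the blocks that are scanned have length at most [2 * m]. *)
Definition walk : com :=
  While ($5 + $2 < $3 + 1)
    (8 <- $7 + ($5 + $2) / $4;; 9 <- Bin Shl 1 (($5 + $2) mod $4);; 16 <- 0;;
     If (aMS.[$8] + aPOP.[aMB.[$8] mod $9] < $1 + 1)
       (If ($1 < aXS.[$8] + aPOP.[aXB.[$8] mod $9] + 1) (16 <- 1) Skip) Skip;;
     If (0 < $16)
       (If (2 * $2 < $6) (6 <- $6 / 2;; 7 <- $7 - $15) (11 <- $5;; scan $6;; advance))
       advance).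

Definition query_large : com :=
  5 <- 0;; 6 <- aH.[3];; 14 <- $6;; 7 <- aH.[4];; 15 <- aH.[2];; walk.

(** Register 0 must hold the base of the index, which is 0, so [m] is moved first. Lengths above [n]
    and counts above [m] have no occurrence, and the empty window occurs at all [n + 1]
    positions. *)
Definition query : com :=
  2 <- $0;; 0 <- 0;; 3 <- aH.[0];;
  If ($2 < $3 + 1)
    (If ($1 < $2 + 1)
       (4 <- aH.[1];;
        If ($2 == 0) (For 5 0 ($3 + 1) (Emit $5))
          (If ($2 < $4) query_small query_large)) Skip) Skip.
End Programs.

(** * Ranges of a function on an interval *)

Definition is_range (F : nat -> nat) (lo hi mn mx : nat) : Prop :=
  (forall i, lo <= i <= hi -> mn <= F i <= mx) /\
  (exists i, lo <= i <= hi /\ F i = mn) /\ (exists i, lo <= i <= hi /\ F i = mx).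

Lemma is_range_point F x : is_range F x x (F x) (F x).
Proof. repeat split; try (exists x; lia); replace i with x by lia; lia. Qed.

Lemma is_range_union F a b c mn mx mn' mx' :
  a <= b <= c -> is_range F a b mn mx -> is_range F b c mn' mx' ->
  is_range F a c (if mn' <? mn then mn' else mn) (if mx <? mx' then mx' else mx).
Proof.
  intros Ho (H1 & (i1 & ? & E1) & (j1 & ? & F1)) (H2 & (i2 & ? & E2) & (j2 & ? & F2)).
  split; [|split].
  - intros i Hi. destruct (le_lt_dec i b); [specialize (H1 i) | specialize (H2 i)];
      destruct (Nat.ltb_spec mn' mn), (Nat.ltb_spec mx mx'); lia.
  - destruct (Nat.ltb_spec mn' mn); [exists i2 | exists i1]; lia.
  - destruct (Nat.ltb_spec mx mx'); [exists j2 | exists j1]; lia.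
Qed.

Lemma is_range_ext F G lo hi mn mx :
  (forall i, lo <= i <= hi -> F i = G i) -> is_range F lo hi mn mx -> is_range G lo hi mn mx.
Proof.
  intros E (H1 & (i & Hi & Ei) & (j & Hj & Ej)). split; [|split].
  - intros x Hx. rewrite <- E; auto.
  - exists i. rewrite <- E; auto.
  - exists j. rewrite <- E; auto.
Qed.

Lemma is_range_extend F lo hi mn mx : lo <= hi ->
  is_range F lo hi mn mx ->
  is_range F lo (S hi) (if F (S hi) <? mn then F (S hi) else mn)
    (if mx <? F (S hi) then F (S hi) else mx).
Proof.
  intros Ho (H1 & (i & Hi & Ei) & (j & Hj & Ej)). split; [|split].
  - intros x Hx. destruct (Nat.eq_dec x (S hi)) as [->|]; [|specialize (H1 x)];
      destruct (Nat.ltb_spec (F (S hi)) mn), (Nat.ltb_spec mx (F (S hi))); lia.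
  - destruct (Nat.ltb_spec (F (S hi)) mn); [exists (S hi) | exists i]; lia.
  - destruct (Nat.ltb_spec mx (F (S hi))); [exists (S hi) | exists j]; lia.
Qed.

Lemma le_mul_pos x y : 1 <= y -> x <= x * y.
Proof. nia. Qed.

(** The interval excludes [lo] and includes [hi]. Moving to a next cut decreases this number, which
    therefore serves both as a variant and as the time still available. *)
Definition ncut (cut : nat -> bool) (lo hi : nat) : nat := length (filter cut (seq (S lo) (hi - lo))).

Lemma ncut_split cut lo x hi : lo <= x <= hi -> ncut cut lo hi = ncut cut lo x + ncut cut x hi.
Proof. intros. unfold ncut. rewrite <- length_app, <- filter_app.
  replace (hi - lo) with ((x - lo) + (hi - x)) by lia. rewrite seq_app.
  do 4 f_equal. lia.
Qed.

Lemma ncut_le cut lo x hi : lo <= x <= hi -> ncut cut x hi <= ncut cut lo hi.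
Proof. intros. rewrite (ncut_split cut lo x hi) by lia. lia. Qed.

Lemma ncut_lt cut lo x hi : lo < x <= hi -> cut x = true -> ncut cut x hi < ncut cut lo hi.
Proof. intros ? Hx. rewrite (ncut_split cut lo x hi) by lia.
  rewrite (ncut_split cut lo (x - 1) x) by lia. unfold ncut at 3.
  replace (x - (x - 1)) with 1 by lia. replace (S (x - 1)) with x by lia.
  cbn [seq filter]. rewrite Hx. cbn [length]. lia.
Qed.

(** * Range tables of one node *)

Section Node.
Variables (w base AB n L s : nat).
Hypothesis Hw : 5 <= w.
Hypothesis HAB : 64 * (AB + base + 1) < 2 ^ w.
Hypothesis Hn : 16 * (n + 1) <= AB.
Hypothesis HL : L <= 2 * n.
Hypothesis HL1 : 1 <= L.
Hypothesis Hs : s <= L.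
Hypothesis Hs1 : 1 <= s.
Variables (P ST NX : nat -> nat) (cut : nat -> bool).
Hypothesis P_lip : forall i j, i <= j -> j <= n -> P i <= P j <= P i + (j - i).
Hypothesis P_le : forall i, i <= n -> P i <= n.
Hypothesis ST_cut : forall i, i <= n ->
  ST i <= i /\ cut (ST i) = true /\ forall q, ST i < q <= i -> cut q = false.
Hypothesis NX_cut : forall i, i < n ->
  i < NX i <= n /\ cut (NX i) = true /\ forall q, i < q < NX i -> cut q = false.
Hypothesis cut_len : forall i, i < n -> cut i = true -> NX i <= i + s.

(** The change in the number of 1s when the ends of a window have moved [t] steps from [u] and [v].
    The change is at least [-t], so the shift by [s] keeps it natural for [t <= s]. *)
Definition tab (u v t : nat) : nat := s + P (v + t) + P u - (P (u + t) + P v).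

Lemma entry_loop_ok t0 s0 u v ue ve :
  regs s0 0 = base -> arr base (mem s0) aP = P ->
  regs s0 12 = s -> regs s0 13 = u -> regs s0 14 = v -> regs s0 15 = ue -> regs s0 16 = ve ->
  regs s0 35 = u -> regs s0 36 = v -> regs s0 30 = s -> regs s0 31 = s ->
  ue <= n -> ve <= n -> u <= ue + s -> v <= ve + s -> Nat.min (ue - u) (ve - v) <= s ->
  run w entry_loop t0 s0 (fun t' s' =>
    t' <= t0 + 100 * (s + 1) /\
    is_range (tab u v) 0 (Nat.min (ue - u) (ve - v)) (regs s' 30) (regs s' 31)).
Proof.
  intros R0 AP R12 R13 R14 R15 R16 R35 R36 R30 R31 Hu Hv Hu' Hv' Hl.
  set (l := Nat.min (ue - u) (ve - v)) in *.
  unfold entry_loop.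
  apply run_while_ltb2 with (base := base) (k0 := l)
    (I := fun k t s' => exists x, x + k = l /\ regs s' 13 = u + x /\ regs s' 14 = v + x /\
       t <= t0 + 90 * x /\ is_range (tab u v) 0 x (regs s' 30) (regs s' 31)); auto.
  { exists 0. rewrite R30, R31. repeat split; try lia.
    replace s with (tab u v 0) at 1 2 by (unfold tab; rewrite !Nat.add_0_r; lia).
    all: try apply is_range_point.
    all: try (exists 0; unfold tab; rewrite !Nat.add_0_r; lia).
    all: replace i with 0 by lia; unfold tab; rewrite !Nat.add_0_r; lia. }
  intros k t s1 Hf (x & Hx & S13 & S14 & Ht & HR).
  do 4 eexists. do 4 (split; [ev|]). cbn [cost]. split.
  - intros H1 H2.
    assert (Pu := P_lip u (u + x + 1) ltac:(lia) ltac:(lia)).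
    assert (Pv := P_lip v (v + x + 1) ltac:(lia) ltac:(lia)).
    pose proof (P_le (u + x + 1) ltac:(lia)). pose proof (P_le (v + x + 1) ltac:(lia)).
    pose proof (P_le u ltac:(lia)). pose proof (P_le v ltac:(lia)).
    steps. exists (k - 1). split; [lia|]. exists (x + 1). simp_state.
    split; [lia|]. split; [lia|]. split; [lia|]. split; [lia|].
    replace (x + 1) with (S x) by lia.
    replace (P (v + x + 1) + P u + s - (P (u + x + 1) + P v)) with (tab u v (S x))
      by (unfold tab; replace (v + S x) with (v + x + 1) by lia;
          replace (u + S x) with (u + x + 1) by lia; lia).
    apply is_range_extend; [lia | exact HR].
  - intros Hex. replace l with x in * by lia. split; [nia | exact HR].
Qed.

Lemma NX_le_cut i q : i < q <= n -> cut q = true -> NX i <= q.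
Proof. clear HAB Hn Hw HL. intros ? Hq. destruct (NX_cut i ltac:(lia)) as (? & ? & H1).
  destruct (le_lt_dec (NX i) q); auto. rewrite H1 in Hq by lia. discriminate.
Qed.

Lemma ST_ge_cut i q : q <= i <= n -> cut q = true -> q <= ST i.
Proof. clear HAB Hn Hw HL. intros ? Hq. destruct (ST_cut i ltac:(lia)) as (? & ? & H1).
  destruct (le_lt_dec q (ST i)); auto. rewrite H1 in Hq by lia. discriminate.
Qed.

Lemma ST_of_cut i : i <= n -> cut i = true -> ST i = i.
Proof. clear HAB Hn Hw HL. intros Hi Hc. pose proof (ST_ge_cut i i ltac:(lia) Hc). pose proof (ST_cut i Hi). lia. Qed.

Lemma NX_ST i : i < n -> NX (ST i) = NX i.
Proof. clear HAB Hn Hw HL. intros Hi. destruct (ST_cut i) as (A1 & A2 & A3); [lia|].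
  destruct (NX_cut i) as (B1 & B2 & B3); [lia|].
  destruct (NX_cut (ST i)) as (C1 & C2 & C3); [lia|].
  destruct (lt_eq_lt_dec (NX (ST i)) (NX i)) as [[D|D]|D]; auto; exfalso.
  - destruct (le_lt_dec (NX (ST i)) i).
    + rewrite A3 in C2 by lia. discriminate.
    + rewrite B3 in C2 by lia. discriminate.
  - rewrite C3 in B2 by lia. discriminate.
Qed.

(* The phrases starting at [p] and [r] have the same content. *)
Definition same (p r : nat) : Prop :=
  NX p - p = NX r - r /\ forall x, x <= NX p - p -> P (p + x) + P r = P (r + x) + P p.

(** Equal texts after [i] and [u], and after [e] and [v], make both windows gain and lose the same
    letters. The extremes of one slide are those of the other, translated by [P e - P i - s]. *)
Lemma segment_range i e u v l lo hi :
  i <= e -> e + l <= n -> l <= s ->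
  (forall t, t <= l -> P (i + t) + P u = P (u + t) + P i) ->
  (forall t, t <= l -> P (e + t) + P v = P (v + t) + P e) ->
  is_range (tab u v) 0 l lo hi ->
  P i + s <= P e + lo /\ P i + s <= P e + hi /\ lo <= s + 2 * n /\ hi <= s + 2 * n /\
  is_range (fun t => P (t + (e - i)) - P t) i (i + l) (P e + lo - (P i + s)) (P e + hi - (P i + s)).
Proof.
  clear HAB Hn Hw HL HL1 Hs Hs1. intros Hie Hel Hls HI HE HR.
  assert (X : forall t, t <= l -> P i + s <= P e + tab u v t /\ tab u v t <= s + 2 * n /\
             P (i + t + (e - i)) - P (i + t) = P e + tab u v t - (P i + s)).
  { intros t Ht. unfold tab. specialize (HI t Ht). specialize (HE t Ht).
    replace (i + t + (e - i)) with (e + t) by lia.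
    pose proof (P_lip (i + t) (e + t) ltac:(lia) ltac:(lia)).
    pose proof (P_lip i (i + t) ltac:(lia) ltac:(lia)).
    pose proof (P_le (e + t) ltac:(lia)). pose proof (P_le (i + t) ltac:(lia)).
    pose proof (P_le e ltac:(lia)). pose proof (P_le i ltac:(lia)).
    pose proof (P_lip e (e + t) ltac:(lia) ltac:(lia)).
    set (x := P (v + t)) in *. set (x' := P (u + t)) in *.
    clear - HI HE Hls Ht H H0 H1 H2 H3 H4 H5. lia. }
  destruct HR as (R1 & (t1 & Ht1 & R2) & (t2 & Ht2 & R3)).
  destruct (X t1 ltac:(lia)) as (A1 & A2 & A3). destruct (X t2 ltac:(lia)) as (B1 & B2 & B3).
  rewrite <- R2, <- R3 in *. repeat (split; [assumption|]).
  split; [|split; [exists (i + t1) | exists (i + t2)]; split; auto; lia].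
  intros j Hj. destruct (X (j - i) ltac:(lia)) as (C1 & C2 & C3). specialize (R1 (j - i) ltac:(lia)).
  replace (i + (j - i)) with j in C3 by lia. rewrite C3. clear - R1 C1 A1 B1. lia.
Qed.

Section Table.
Variables (kk KK lim a : nat) (RP : nat -> nat).
Hypothesis Hkk : kk <= KK.
Hypothesis HKK : KK * KK * (2 * s + 1) < AB.
Hypothesis Hlim : lim <= n.
Hypothesis HRP : forall U, U < kk -> a <= RP U < lim /\ cut (RP U) = true.

Definition idx (U V d : nat) : nat := (U * kk + V) * (2 * s + 1) + d.

(** With truncated subtraction at most one of [s - d] and [d - s] is positive, namely the offset of
    the end that may lie inside its phrase. *)
Definition ent (U V d lo hi : nat) : Prop :=
  is_range (tab (RP U + (s - d)) (RP V + (d - s))) 0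
    (Nat.min (NX (RP U) - (RP U + (s - d))) (NX (RP V) - (RP V + (d - s)))) lo hi.

Definition done (T1 T2 : nat -> nat) (N : nat) : Prop :=
  forall U V d, U < kk -> V < kk -> d < 2 * s + 1 -> idx U V d < N ->
    ent U V d (T1 (idx U V d)) (T2 (idx U V d)).

Lemma idx_inj U V d U' V' d' :
  V < kk -> d < 2 * s + 1 -> V' < kk -> d' < 2 * s + 1 ->
  idx U V d = idx U' V' d' -> U = U' /\ V = V' /\ d = d'.
Proof.
  unfold idx. intros.
  destruct (Nat.div_mod_unique (2 * s + 1) (U * kk + V) (U' * kk + V') d d') as [E1 E2]; try lia.
  destruct (Nat.div_mod_unique kk U U' V V') as [E3 E4]; try lia.
Qed.

Lemma idx_lt U V d : U < kk -> V < kk -> d < 2 * s + 1 -> idx U V d < kk * kk * (2 * s + 1).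
Proof.
  intros. unfold idx. assert (U * kk + V + 1 <= kk * kk) by nia. nia.
Qed.

Lemma kk_AB : kk * kk * (2 * s + 1) < AB.
Proof.
  eapply Nat.le_lt_trans; [|exact HKK].
  apply Nat.mul_le_mono_r, Nat.mul_le_mono; exact Hkk.
Qed.

Lemma kk_lt : kk < AB.
Proof. pose proof kk_AB. nia. Qed.

Lemma done_step T1 T2 U V d lo hi :
  U < kk -> V < kk -> d < 2 * s + 1 -> done T1 T2 (idx U V d) -> ent U V d lo hi ->
  done (update T1 (idx U V d) lo) (update T2 (idx U V d) hi) (S (idx U V d)).
Proof.
  intros HU HV Hd HD HE U' V' d' HU' HV' Hd' Hlt.
  destruct (Nat.eq_dec (idx U' V' d') (idx U V d)) as [E|E].
  - destruct (idx_inj U' V' d' U V d) as (-> & -> & ->); auto. now rewrite !update_same.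
  - rewrite !update_other by auto. apply HD; auto; lia.
Qed.

Lemma entry_ok t0 s0 U V d T1 T2 :
  regs s0 0 = base -> arr base (mem s0) aP = P -> arr base (mem s0) aNX = NX ->
  arr base (mem s0) aRP = RP -> arr base (mem s0) aT1 = T1 -> arr base (mem s0) aT2 = T2 ->
  regs s0 12 = s -> regs s0 18 = kk -> regs s0 25 = U -> regs s0 26 = V -> regs s0 27 = d ->
  U < kk -> V < kk -> d < 2 * s + 1 ->
  run w entry t0 s0 (fun t' s' => t' <= t0 + 200 * (s + 1) /\
    exists lo hi, ent U V d lo hi /\ arr base (mem s') aT1 = update T1 (idx U V d) lo /\
      arr base (mem s') aT2 = update T2 (idx U V d) hi).
Proof.
  intros R0 AP ANX ARP AT1 AT2 R12 R18 R25 R26 R27 HU HV Hd.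
  destruct (HRP U HU) as (HU1 & HU2). destruct (HRP V HV) as (HV1 & HV2).
  pose proof (NX_cut (RP U) ltac:(lia)) as [HU3 _]. pose proof (NX_cut (RP V) ltac:(lia)) as [HV3 _].
  pose proof (cut_len (RP U) ltac:(lia) HU2). pose proof (cut_len (RP V) ltac:(lia) HV2).
  pose proof (idx_lt U V d HU HV Hd) as Hi.
  pose proof kk_AB. assert (Hi' : idx U V d < AB) by lia.
  assert (UK : (U * kk + V) * (2 * s + 1) <= AB) by (unfold idx in Hi'; lia).
  assert (UK' : U * kk + V <= AB) by (eapply Nat.le_trans; [apply (le_mul_pos _ (2 * s + 1)); lia | exact UK]).
  assert (tail : forall t1 s1 u v, t1 <= t0 + 60 ->
    regs s1 0 = base -> arr base (mem s1) aP = P -> arr base (mem s1) aT1 = T1 ->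
    arr base (mem s1) aT2 = T2 ->
    regs s1 12 = s -> regs s1 18 = kk -> regs s1 25 = U -> regs s1 26 = V -> regs s1 27 = d ->
    regs s1 15 = NX (RP U) -> regs s1 16 = NX (RP V) -> regs s1 13 = u -> regs s1 14 = v ->
    u = RP U + (s - d) -> v = RP V + (d - s) ->
    run w entry_tail t1 s1 (fun t' s' => t' <= t0 + 200 * (s + 1) /\
    exists lo hi, ent U V d lo hi /\ arr base (mem s') aT1 = update T1 (idx U V d) lo /\
      arr base (mem s') aT2 = update T2 (idx U V d) hi)).
  { clear R0 AP AT1 AT2 R12 R18 R25 R26 R27 ANX ARP.
    intros t1 s1 u v Ht R0 AP AT1 AT2 R12 R18 R25 R26 R27 R15 R16 R13 R14 Eu Ev.
    unfold entry_tail. steps. apply run_seq.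
    eapply (run_conseq w base Hw); [eapply entry_loop_ok with (u := u) (v := v) (ue := NX (RP U)) (ve := NX (RP V));
      try lookup_reg; try lookup_arr; try lia|].
    cbn beta. intros t2 s2 (Ht2 & HR) Hf.
    steps. split; [lia|]. exists (regs s2 30), (regs s2 31).
    split; [unfold ent; rewrite <- Eu, <- Ev; exact HR|].
    split; lookup_arr. }
  pose proof kk_lt. unfold entry. steps.
  - apply tail with (u := RP U + (s - d)) (v := RP V); try lookup_reg; try lookup_arr; lia.
  - apply tail with (u := RP U) (v := RP V + (d - s)); try lookup_reg; try lookup_arr; lia.
Qed.
Lemma table_time k x :
  (2 * x + 1) * (200 * (x + 1) + 13) <= 450 * ((x + 1) * (x + 1)) /\
  k * (k * ((2 * x + 1) * (200 * (x + 1) + 13) + 40) + 40)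
  <= 900 * (k * k * ((x + 1) * (x + 1)) + k).
Proof.
  assert (A : (2 * x + 1) * (200 * (x + 1) + 13) <= 450 * ((x + 1) * (x + 1))) by nia.
  split; [exact A|].
  set (y := (x + 1) * (x + 1)) in *. set (z := (2 * x + 1) * (200 * (x + 1) + 13) + 40) in *.
  assert (1 <= y) by (unfold y; nia). assert (z <= 490 * y) by (unfold z; lia). clearbody y z.
  assert (k * z <= k * (490 * y)) by (apply Nat.mul_le_mono_l; assumption).
  assert (k * (k * z) <= k * (k * (490 * y))) by (apply Nat.mul_le_mono_l; assumption).
  rewrite !Nat.mul_assoc in *. rewrite (Nat.mul_comm (k * k) 490), <- !Nat.mul_assoc in *.
  rewrite !Nat.mul_assoc in *. lia.
Qed.

(** Entries are filled in increasing order of [idx], so [done] with a single bound is the invariant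
    of all three loops. *)
Lemma table_ok t0 s0 :
  regs s0 0 = base -> arr base (mem s0) aP = P -> arr base (mem s0) aNX = NX ->
  arr base (mem s0) aRP = RP -> regs s0 12 = s -> regs s0 18 = kk ->
  run w table t0 s0 (fun t' s' => t' <= t0 + 1000 * (kk * kk * ((s + 1) * (s + 1)) + kk + 1) /\
    exists T1 T2, arr base (mem s') aT1 = T1 /\ arr base (mem s') aT2 = T2 /\
      forall U V d, U < kk -> V < kk -> d < 2 * s + 1 ->
        ent U V d (T1 (idx U V d)) (T2 (idx U V d))).
Proof.
  intros R0 AP ANX ARP R12 R18. pose proof kk_AB. pose proof kk_lt. unfold table.
  set (D := fun N s' => done (arr base (mem s') aT1) (arr base (mem s') aT2) N).
  eapply run_for with (base := base) (lo := 0) (hi := kk) (I := fun U s' => D (idx U 0 0) s')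
    (c := kk * ((2 * s + 1) * (200 * (s + 1) + 13) + 40) + 30); auto; try ev; try lia.
  { intros U V d HU HV Hd. unfold idx. lia. }
  { intros. ev. }
  2: { cbn [cost]. intros t s' Hf Hs' HD Ht. split.
    { pose proof (proj2 (table_time kk s)). lia. }
    exists (arr base (mem s') aT1), (arr base (mem s') aT2). split; [auto|]. split; [auto|].
    intros. apply HD; auto. pose proof (idx_lt U V d ltac:(auto) ltac:(auto) ltac:(auto)).
    replace (idx kk 0 0) with (kk * kk * (2 * s + 1)) by (unfold idx; lia). auto. }
  intros U tU sU _ HU HfU RU HDU.
  eapply run_for with (base := base) (lo := 0) (hi := kk) (I := fun V s' => D (idx U V 0) s')
    (c := (2 * s + 1) * (200 * (s + 1) + 13) + 20); auto; try ev; try lia.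
  { intros. ev. }
  2: { cbn [cost]. intros t s' Hf Hs' HD Ht. split; [lia|].
    unfold D in *. replace (idx (S U) 0 0) with (idx U kk 0) by (unfold idx; lia). exact HD. }
  intros V tV sV _ HV HfV RV HDV.
  eapply run_for with (base := base) (lo := 0) (hi := 2 * s + 1) (I := fun d s' => D (idx U V d) s')
    (c := 200 * (s + 1)); auto; try ev; try lia.
  { intros. ev. }
  2: { cbn [cost]. intros t s' Hf Hs' HD Ht. split; [lia|].
    unfold D in *. replace (idx U (S V) 0) with (idx U V (2 * s + 1)) by (unfold idx; lia). exact HD. }
  intros d td sd _ Hd Hfd Rd HDd.
  eapply (run_conseq w base Hw).
  { eapply entry_ok with (U := U) (V := V) (d := d); try lookup_reg; try lookup_arr; try lia. }
  cbn beta. intros t' s' (Ht' & lo & hi & HE & E1 & E2) Hf'. split; [lia|].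
  unfold D. cbn [mem setr]. rewrite E1, E2.
  replace (idx U V (S d)) with (S (idx U V d)) by (unfold idx; lia).
  apply done_step; auto.
Qed.

Variables (ID T1 T2 : nat -> nat) (PH : nat).
Hypothesis Hlim' : lim = Nat.min n (a + 2 * L).
Hypothesis HID : forall x, a <= x < lim -> cut x = true -> ID x < kk /\ same x (RP (ID x)).
Hypothesis HT : forall U V d, U < kk -> V < kk -> d < 2 * s + 1 ->
  ent U V d (T1 (idx U V d)) (T2 (idx U V d)).
Hypothesis cut_a : cut a = true.
Hypothesis cut_aL : a + L - 1 <= n -> cut (a + L - 1) = true.
Hypothesis cut_lim : cut lim = true.
Hypothesis HPH : ncut cut a lim <= PH.

Lemma phrase_copy i : a <= i < lim ->
  let U := ID (ST i) in let u := RP U + (i - ST i) in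
  a <= ST i <= i /\ U < kk /\ NX i <= ST i + s /\ NX (RP U) - u = NX i - i /\
  (forall t, t <= NX i - i -> P (i + t) + P u = P (u + t) + P i).
Proof.
  clear HAB Hn HKK Hkk Hw HL HT.
  intros Hi U u. destruct (ST_cut i ltac:(lia)) as (H1 & H2 & _).
  pose proof (ST_ge_cut i a ltac:(lia) cut_a).
  destruct (HID (ST i) ltac:(lia) H2) as (HU & E1 & E2). fold U in HU, E1, E2.
  pose proof (cut_len (ST i) ltac:(lia) H2) as Hc.
  rewrite (NX_ST i) in * by lia. destruct (NX_cut i ltac:(lia)) as (H3 & _).
  repeat split; try lia.
  intros t Ht. unfold u. pose proof (E2 (i - ST i) ltac:(lia)) as X1.
  pose proof (E2 (i - ST i + t) ltac:(lia)) as X2.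
  replace (ST i + (i - ST i)) with i in X1 by lia.
  replace (ST i + (i - ST i + t)) with (i + t) in X2 by lia.
  rewrite Nat.add_assoc in X2. lia.
Qed.

(* One table entry answers a whole aligned segment of windows. *)
Lemma segment i e : a <= i -> i <= e -> i < lim -> e < lim -> cut i = true \/ cut e = true ->
  let d := e - ST e + s - (i - ST i) in
  let k := idx (ID (ST i)) (ID (ST e)) d in
  let l := Nat.min (NX i - i) (NX e - e) in
  d < 2 * s + 1 /\ ID (ST i) < kk /\ ID (ST e) < kk /\
  i - ST i <= e - ST e + s /\ ST i <= i /\ ST e <= e /\
  P i + s <= P e + T1 k /\ P i + s <= P e + T2 k /\
  T1 k <= s + 2 * n /\ T2 k <= s + 2 * n /\
  is_range (fun t => P (t + (e - i)) - P t) i (i + l)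
    (P e + T1 k - (P i + s)) (P e + T2 k - (P i + s)).
Proof.
  clear HAB Hn HKK Hkk Hw HL.
  intros Hai Hie Hil Hel Hc d k l.
  destruct (phrase_copy i ltac:(lia)) as (I1 & I2 & I3 & I4 & I5).
  destruct (phrase_copy e ltac:(lia)) as (E1 & E2 & E3 & E4 & E5).
  destruct (NX_cut i ltac:(lia)) as (I6 & _). destruct (NX_cut e ltac:(lia)) as (E6 & _).
  pose proof (ST_of_cut i) as SI. pose proof (ST_of_cut e) as SE.
  (* One of [i] and [e] is a cut and has offset 0, so the truncated differences recover both offsets
     from [d]. *)
  assert (Ed : s - d = i - ST i /\ d - s = e - ST e /\ d < 2 * s + 1).
  { unfold d. clear - Hc I1 E1 I3 E3 I6 E6 SI SE Hlim Hil Hel. destruct Hc as [Hc|Hc]; [apply SI in Hc | apply SE in Hc]; lia. }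
  destruct Ed as (Ed1 & Ed2 & Ed3).
  pose proof (HT (ID (ST i)) (ID (ST e)) d I2 E2 Ed3) as HE. fold k in HE. unfold ent in HE.
  rewrite Ed1, Ed2, I4, E4 in HE. fold l in HE.
  destruct (segment_range i e (RP (ID (ST i)) + (i - ST i)) (RP (ID (ST e)) + (e - ST e)) l (T1 k) (T2 k))
    as (F1 & F2 & F3 & F4 & F5); auto; clear HE Ed1 Ed2.
  { unfold l; clear - I6 E6; lia. }
  { unfold l; clear - I3 I1; lia. }
  { intros t Ht. apply I5. unfold l in Ht; clear - Ht; lia. }
  { intros t Ht. apply E5. unfold l in Ht; clear - Ht; lia. }
  assert (i - ST i <= e - ST e + s).
  2: { do 10 (split; [first [assumption | tauto]|]). exact F5. }
  clear - Hc SI SE I1 I3 I6 Hlim Hil Hel. destruct Hc as [Hc|Hc]; [apply SI in Hc | apply SE in Hc]; lia.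
Qed.

Definition ones_at (m i : nat) : nat := P (i + m) - P i.
(** For [y = a + m] the two bounds are the last position of the block and the last start [n - m] of
    a window in the string. *)
Definition last_start (y : nat) : nat := Nat.min (a + L - 1) (a + n - y).

(** Every round takes at least one end of the window to its next cut. The cuts ahead of the two
    ends, at most [2 * PH] in all, thus pay for the time, and one end is always on a cut, as the
    tables require. *)
Lemma slide_loop_ok t0 s0 y :
  regs s0 0 = base -> arr base (mem s0) aP = P -> arr base (mem s0) aNX = NX ->
  arr base (mem s0) aST = ST -> arr base (mem s0) aID = ID ->
  arr base (mem s0) aT1 = T1 -> arr base (mem s0) aT2 = T2 ->
  regs s0 12 = s -> regs s0 18 = kk -> regs s0 34 = last_start y ->
  regs s0 35 = a -> regs s0 36 = y -> regs s0 30 = P y - P a -> regs s0 31 = P y - P a ->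
  a <= y <= n -> y < a + L ->
  run w slide_loop t0 s0 (fun t' s' =>
    t' <= t0 + 200 * (2 * PH + 1) /\
    is_range (ones_at (y - a)) a (last_start y) (regs s' 30) (regs s' 31)).
Proof.
  intros R0 AP ANX AST AID AT1 AT2 R12 R18 R34 R35 R36 R30 R31 Hy Hy'.
  pose proof kk_AB. set (stop := last_start y) in *.
  assert (Hstop : stop = Nat.min (a + L - 1) (a + n - y)) by reflexivity. clearbody stop.
  unfold slide_loop.
  pose proof kk_lt as Hkk'.
  apply run_while_ltb with (base := base) (k0 := ncut cut a lim + ncut cut y lim)
    (I := fun k t s' => exists i e, a <= i <= stop /\ e + a = y + i /\ regs s' 35 = i /\ regs s' 36 = e /\
       (i < stop -> cut i = true \/ cut e = true) /\
       k = ncut cut i lim + ncut cut e lim /\ t + 190 * k <= t0 + 190 * (2 * PH) /\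
       is_range (ones_at (y - a)) a i (regs s' 30) (regs s' 31)); auto.
  { exists a, y. pose proof (ncut_le cut a y lim ltac:(lia)).
    rewrite R30, R31.
    repeat split; auto; try lia; try (exists a; unfold ones_at; replace (a + (y - a)) with y by lia; lia);
      unfold ones_at; replace i with a by lia; replace (a + (y - a)) with y by lia; lia. }
  intros k t s1 Hf (i & e & Hi & Hie' & S35 & S36 & Hc & Hk & Ht & HR).
  do 2 eexists. do 2 (split; [ev|]). cbn [cost]. split.
  2: { intros. split; [lia|]. replace stop with i by lia. exact HR. }
  intros Hlt.
  assert (Hel : e < lim) by lia.
  assert (Hil : i < lim) by lia. assert (Hai : a <= i) by lia. assert (Hie : i <= e) by lia.
  assert (Hym : y - a = e - i) by lia.
  assert (Hn' : n <= AB) by lia. assert (Hin : i < n /\ e < n) by lia.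
  assert (Hn3 : s + 2 * n <= AB) by lia.
  pose proof (fun _ : unit => segment i e Hai Hie Hil Hel (Hc Hlt)) as HS. cbv zeta in HS.
  destruct (NX_cut i (proj1 Hin)) as (I1 & I2 & _). destruct (NX_cut e (proj2 Hin)) as (E1 & E2 & _).
  pose proof (P_le i ltac:(lia)) as Pi. pose proof (P_le e ltac:(lia)) as Pe.
  set (l := Nat.min (NX i - i) (NX e - e)) in HS.
  assert (El : l = Nat.min (NX i - i) (NX e - e)) by reflexivity. clearbody l.
  assert (Hl : 1 <= l /\ i + l <= NX i /\ e + l <= NX e /\ (i + l = NX i \/ e + l = NX e)) by (clear - El I1 E1; lia).
  assert (Hl0 : (if NX e - e <? NX i - i then NX e - e else NX i - i) = l)
    by (clear - El; destruct (Nat.ltb_spec (NX e - e) (NX i - i)); lia).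
  clear El.
  (* No round jumps over the last start: [a + L - 1] is a cut if it is in the string, and the right
     end never passes [n]. *)
  assert (Hi' : i + l <= stop).
  { destruct (le_lt_dec (a + L - 1) n) as [Hb|Hb].
    - pose proof (NX_le_cut i (a + L - 1) ltac:(lia) (cut_aL Hb)). lia.
    - lia. }
  assert (Hcut : cut (i + l) = true \/ cut (e + l) = true)
    by (destruct Hl as (_ & _ & _ & [Hl|Hl]); rewrite Hl; auto).
  assert (Hmeas : ncut cut (i + l) lim + ncut cut (e + l) lim < ncut cut i lim + ncut cut e lim).
  { pose proof (NX_le_cut e lim ltac:(lia) cut_lim).
    pose proof (NX_le_cut i lim ltac:(lia) cut_lim).
    pose proof (ncut_le cut i (i + l) lim ltac:(lia)). pose proof (ncut_le cut e (e + l) lim ltac:(lia)).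
    destruct Hcut as [Hx|Hx].
    - pose proof (ncut_lt cut i (i + l) lim ltac:(lia) Hx). lia.
    - pose proof (ncut_lt cut e (e + l) lim ltac:(lia) Hx). lia. }
  assert (Hin' : NX i <= n /\ NX e <= n) by (clear - I1 E1; lia).
  destruct (HS tt) as (D1 & D2 & D3 & D4 & D5 & D6 & D7 & D8 & D9 & D10 & D11).
  rewrite <- Hym in D11. fold (ones_at (y - a)) in D11.
  pose proof (idx_lt _ _ _ D2 D3 D1) as Hx.
  clear Hstop Hlim' HL Hs HPH Hn HKK Hkk HS.
  assert (Hx' : idx (ID (ST i)) (ID (ST e)) (e - ST e + s - (i - ST i)) < AB)
    by (clear - Hx H; lia).
  assert (K1 : ID (ST i) * kk <= AB /\ ID (ST i) * kk + ID (ST e) <= AB /\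
    (ID (ST i) * kk + ID (ST e)) * (2 * s + 1) <= AB).
  { assert (H0 : ID (ST i) * kk + ID (ST e) <= (ID (ST i) * kk + ID (ST e)) * (2 * s + 1))
      by (clear; apply le_mul_pos; lia).
    unfold idx in Hx'. clear - Hx' H0. lia. }
  assert (K2 : ID (ST i) < AB /\ ID (ST e) < AB /\ ST i < AB /\ ST e < AB)
    by (clear - Hkk' D2 D3 D5 D6 Hin Hn'; lia).
  assert (Et : t + 190 * k <= t0 + 190 * (2 * PH)) by exact Ht.
  pose proof (is_range_union _ _ _ _ _ _ _ _ (conj Hai (Nat.le_add_r i l)) HR D11) as HR'.
  assert (Hi0 : a <= i + l <= stop) by (clear - Hi Hi'; lia).
  pose proof (fun _ : unit => conj (conj Hmeas Hi0) (conj Hie' (conj Hk Ht))) as Hfin.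
  assert (Hl1 : l <= NX i /\ l <= NX e /\ i + l <= n /\ e + l <= n) by (clear - Hl Hin'; lia).
  clear Hx H Hkk' D1 D2 D3 HR D11 Hc Hmeas Hi' Hi0 Hi Hie' Hk Ht Hl Et Hlt Hym.
  unfold idx in *.
  steps. destruct (Hfin tt) as ((Hmeas & Hi0) & Hie' & Hk & HtI).
  exists (ncut cut (i + l) lim + ncut cut (e + l) lim). split; [rewrite Hk; exact Hmeas|].
  exists (i + l), (e + l). simp_state.
  split; [exact Hi0|]. split; [clear - Hie'; lia|]. do 2 (split; [reflexivity|]).
  split; [intros _; exact Hcut|]. split; [reflexivity|].
  split; [clear - HtI Hk Hmeas Ht Ht0 Ht1; lia | exact HR'].
Qed.

Lemma slide_ok t0 s0 y MN MX :
  regs s0 0 = base -> arr base (mem s0) aP = P -> arr base (mem s0) aNX = NX ->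
  arr base (mem s0) aST = ST -> arr base (mem s0) aID = ID ->
  arr base (mem s0) aT1 = T1 -> arr base (mem s0) aT2 = T2 ->
  arr base (mem s0) aMN = MN -> arr base (mem s0) aMX = MX ->
  regs s0 2 = n -> regs s0 10 = L -> regs s0 17 = a -> regs s0 33 = y ->
  regs s0 12 = s -> regs s0 18 = kk ->
  a <= y <= n -> y < a + L ->
  run w slide t0 s0 (fun t' s' => t' <= t0 + 400 * (PH + 1) /\
    exists mn mx, is_range (ones_at (y - a)) a (last_start y) mn mx /\
      arr base (mem s') aMN = update MN y mn /\ arr base (mem s') aMX = update MX y mx).
Proof.
  intros R0 AP ANX AST AID AT1 AT2 AMN AMX R2 R10 R17 R33 R12 R18 Hy Hy'.
  pose proof (P_lip a y ltac:(lia) ltac:(lia)). pose proof (P_le y ltac:(lia)).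
  unfold slide. steps. apply run_seq. eapply (run_conseq w base Hw).
  { eapply slide_loop_ok with (y := y); try lookup_reg; try lookup_arr; try lia.
    simp_state. unfold last_start. destruct (Nat.ltb_spec (a + n - y) (a + L - 1)); lia. }
  cbn beta. intros t1 s1 (Ht1 & HR) Hf. steps. split; [lia|].
  exists (regs s1 30), (regs s1 31). split; [exact HR|]. split; lookup_arr.
Qed.

Lemma slides_ok t0 s0 MN MX :
  regs s0 0 = base -> arr base (mem s0) aP = P -> arr base (mem s0) aNX = NX ->
  arr base (mem s0) aST = ST -> arr base (mem s0) aID = ID ->
  arr base (mem s0) aT1 = T1 -> arr base (mem s0) aT2 = T2 ->
  arr base (mem s0) aMN = MN -> arr base (mem s0) aMX = MX ->
  regs s0 2 = n -> regs s0 10 = L -> regs s0 17 = a -> regs s0 12 = s -> regs s0 18 = kk ->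
  a <= n ->
  run w slides t0 s0 (fun t' s' => t' <= t0 + 500 * (L * (PH + 1)) + 100 /\
    exists MN' MX', arr base (mem s') aMN = MN' /\ arr base (mem s') aMX = MX' /\
      (forall y, y < a -> MN' y = MN y /\ MX' y = MX y) /\
      (forall y, a <= y <= n -> y < a + L ->
         is_range (ones_at (y - a)) a (last_start y) (MN' y) (MX' y))).
Proof.
  intros R0 AP ANX AST AID AT1 AT2 AMN AMX R2 R10 R17 R12 R18 Ha.
  unfold slides. steps.
  set (hi := if n + 1 <? a + L then n + 1 else a + L).
  assert (Hhi : hi = Nat.min (a + L) (n + 1)) by (unfold hi; destruct (Nat.ltb_spec (n + 1) (a + L)); lia).
  eapply run_for with (base := base) (lo := a) (hi := hi) (c := 400 * (PH + 1))
    (I := fun y s' =>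
      (forall x, x < a -> arr base (mem s') aMN x = MN x /\ arr base (mem s') aMX x = MX x) /\
      (forall x, a <= x < y -> is_range (ones_at (x - a)) a (last_start x)
                                (arr base (mem s') aMN x) (arr base (mem s') aMX x)));
    auto; try ev; try lia.
  { cbn [mem setr]. rewrite AMN, AMX. split; [auto|]. intros. lia. }
  { intros. ev. }
  - intros y t1 s1 Hy1 Hy2 Hf Hr (I1 & I2).
    eapply (run_conseq w base Hw).
    { eapply slide_ok with (y := y); try lookup_reg; try lookup_arr; try lia. }
    cbn beta. intros t2 s2 (Ht2 & mn & mx & HR & E1 & E2) Hf2. split; [exact Ht2|].
    cbn [mem setr]. rewrite E1, E2. split.
    + intros x Hx. rewrite !update_other by lia. auto.
    + intros x Hx. destruct (Nat.eq_dec x y) as [->|].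
      * rewrite !update_same. exact HR.
      * rewrite !update_other by lia. apply I2. lia.
  - cbn [cost]. intros t1 s1 Hf Hr (I1 & I2) Ht1. split.
    { assert ((hi - a) * (400 * (PH + 1) + 1 + 7) <= L * (408 * (PH + 1)))
        by (apply Nat.mul_le_mono; lia). lia. }
    do 2 eexists. split; [reflexivity|]. split; [reflexivity|]. split; [exact I1|].
    intros y Hy1 Hy2. apply I2. lia.
Qed.
End Table.
End Node.

(** * Classifying the phrases of a node by content *)

Section Types.
Variables (w base AB n L s a lim KK PH : nat).
Hypothesis Hw : 5 <= w.
Hypothesis HAB : 64 * (AB + base + 1) < 2 ^ w.
Hypothesis Hn : 16 * (n + 1) <= AB.
Hypothesis HL : L <= 2 * n.
Variables (P NX : nat -> nat) (cut : nat -> bool).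
Hypothesis P_le : forall i, i <= n -> P i <= n.
Hypothesis NX_cut : forall i, i < n ->
  i < NX i <= n /\ cut (NX i) = true /\ forall q, i < q < NX i -> cut q = false.
Hypothesis cut_len : forall i, i < n -> cut i = true -> NX i <= i + s.
Hypothesis Hlim : lim = Nat.min n (a + 2 * L).
Hypothesis Ha : a <= n.
Hypothesis cut_a : cut a = true.
Hypothesis cut_lim : cut lim = true.
Hypothesis HPH : ncut cut a lim <= PH.
Hypothesis HKK : KK <= AB.
Hypothesis HKKb : forall k RP,
  (forall U, U < k -> a <= RP U < lim /\ cut (RP U) = true) ->
  (forall U V, U < V -> V < k -> ~ same P NX (RP V) (RP U)) -> k <= KK.

Lemma compare_letters_ok t0 s0 p r len :
  regs s0 0 = base -> arr base (mem s0) aP = P ->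
  regs s0 19 = p -> regs s0 15 = r -> regs s0 40 = len ->
  p + len <= n -> r + len <= n -> len <= s ->
  run w compare_letters t0 s0 (fun t' s' => t' <= t0 + 80 * (s + 2) /\
    ((regs s' 23 = 1 /\ forall x, x <= len -> P (p + x) + P r = P (r + x) + P p) \/
     (regs s' 23 = 0 /\ ~ forall x, x <= len -> P (p + x) + P r = P (r + x) + P p))).
Proof.
  intros R0 AP R19 R15 R40 Hp Hr Hlen. unfold compare_letters. steps.
  eapply run_for with (base := base) (lo := 0) (hi := len + 1) (c := 60)
    (I := fun i s' =>
      (regs s' 23 = 1 /\ forall x, x < i -> P (p + x) + P r = P (r + x) + P p) \/
      (regs s' 23 = 0 /\ ~ forall x, x <= len -> P (p + x) + P r = P (r + x) + P p));
    auto; try ev; try lia.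
  { left. simp_state. split; [auto|]. intros. lia. }
  { intros. ev. }
  - intros i t1 s1 _ Hi Hf Hr1 HI.
    pose proof (P_le (p + i) ltac:(lia)). pose proof (P_le (r + i) ltac:(lia)).
    pose proof (P_le p ltac:(lia)). pose proof (P_le r ltac:(lia)).
    steps.
    + split; [lia|]. simp_state. destruct HI as [(I1 & I2)|(I1 & I2)]; [left|right]; split; auto.
      intros x Hx. destruct (Nat.eq_dec x i) as [->|]; auto. apply I2. lia.
    + split; [lia|]. right. simp_state. split; auto. intros HE. apply H3. apply HE. lia.
  - cbn [cost]. intros t1 s1 Hf Hr1 HI Ht1. split; [lia|].
    destruct HI as [(I1 & I2)|(I1 & I2)]; [left|right]; split; auto. intros. apply I2. lia.
Qed.

Lemma compare_ok t0 s0 p U RP old :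
  regs s0 0 = base -> arr base (mem s0) aP = P -> arr base (mem s0) aNX = NX ->
  arr base (mem s0) aRP = RP ->
  regs s0 19 = p -> regs s0 40 = NX p - p -> regs s0 21 = U -> regs s0 22 = old ->
  p < n -> cut p = true -> U < KK -> RP U < n ->
  run w compare t0 s0 (fun t' s' => t' <= t0 + 100 * (s + 2) /\
    ((same P NX p (RP U) /\ regs s' 22 = U) \/ (~ same P NX p (RP U) /\ regs s' 22 = old))).
Proof.
  intros R0 AP ANX ARP R19 R40 R21 R22 Hp Hcp HU HR.
  destruct (NX_cut p Hp) as (N1 & _). destruct (NX_cut (RP U) HR) as (N2 & _).
  pose proof (cut_len p Hp Hcp).
  unfold compare. steps.
  - apply run_seq. eapply (run_conseq w base Hw).
    { eapply compare_letters_ok with (p := p) (r := RP U) (len := NX p - p);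
        try lookup_reg; try lookup_arr; lia. }
    cbn beta. intros t1 s1 (Ht1 & HC) Hf.
    destruct HC as [(E & HC)|(E & HC)]; steps; (split; [lia|]); simp_state.
    + left. split; [|lookup_reg]. split; [lia | auto].
    + right. split; [|lookup_reg]. intros (_ & HE). auto.
  - split; [lia|]. right. split; [|lookup_reg]. intros (HE & _). lia.
Qed.

Lemma find_type_ok t0 s0 p kk RP ID :
  regs s0 0 = base -> arr base (mem s0) aP = P -> arr base (mem s0) aNX = NX ->
  arr base (mem s0) aRP = RP -> arr base (mem s0) aID = ID ->
  regs s0 19 = p -> regs s0 18 = kk ->
  p < n -> cut p = true -> kk <= KK -> (forall U, U < kk -> RP U < n) ->
  run w find_type t0 s0 (fun t' s' => t' <= t0 + (KK + 1) * (130 * (s + 2)) /\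
    exists f, arr base (mem s') aID = update ID p f /\
    ((f < kk /\ same P NX p (RP f) /\ arr base (mem s') aRP = RP /\ regs s' 18 = kk) \/
     (f = kk /\ (forall U, U < kk -> ~ same P NX p (RP U)) /\
      arr base (mem s') aRP = update RP kk p /\ regs s' 18 = kk + 1))).
Proof.
  intros R0 AP ANX ARP AID R19 R18 Hp Hcp Hkk HR.
  destruct (NX_cut p Hp) as (N1 & _).
  unfold find_type. steps. apply run_seq.
  eapply run_for with (base := base) (lo := 0) (hi := kk) (c := 100 * (s + 2))
    (I := fun i s' =>
      (regs s' 22 < i /\ same P NX p (RP (regs s' 22))) \/
      (regs s' 22 = kk /\ forall U, U < i -> ~ same P NX p (RP U))); auto; try ev; try lia.
  { right. simp_state. split; [auto|]. intros. lia. }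
  { intros. ev. }
  - intros i t1 s1 _ Hi Hf Hr HI.
    eapply (run_conseq w base Hw).
    { eapply compare_ok with (p := p) (U := i) (RP := RP); try lookup_reg; try lookup_arr; auto. lia. }
    cbn beta. intros t2 s2 (Ht2 & HC) Hf2. split; [exact Ht2|]. simp_state.
    destruct HC as [(C1 & C2)|(C1 & C2)]; rewrite C2.
    + left. auto.
    + destruct HI as [(I1 & I2)|(I1 & I2)]; [left; split; [lia | auto] | right; split; auto].
      intros U HU. destruct (Nat.eq_dec U i) as [->|]; auto. apply I2. lia.
  - cbn [cost]. intros t1 s1 Hf Hr HI Ht1.
    assert (Ht1' : t1 + 60 <= t0 + (KK + 1) * (130 * (s + 2))).
    { assert ((kk - 0) * (100 * (s + 2) + 1 + 7) <= KK * (130 * (s + 2))) by (apply Nat.mul_le_mono; lia).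
      lia. }
    clear Ht1. steps; (split; [lia|]).
    + exists kk. split; [rewrite <- H; lookup_arr|]. right.
      destruct HI as [(I1 & _)|(_ & I2)]; [lia|].
      split; [auto|]. split; [auto|]. split; [lookup_arr | lookup_reg].
    + exists (regs s1 22). split; [lookup_arr|]. left.
      destruct HI as [(I1 & I2)|(I1 & _)]; [|lia].
      split; [auto|]. split; [auto|]. split; [lookup_arr | lookup_reg].
Qed.

(** The representatives found so far are pairwise different, so [HKKb] bounds their number at every
    moment; each phrase is compared with each of them in time O(s). *)
Lemma types_ok t0 s0 :
  regs s0 0 = base -> arr base (mem s0) aP = P -> arr base (mem s0) aNX = NX ->
  regs s0 2 = n -> regs s0 10 = L -> regs s0 17 = a ->
  run w types t0 s0 (fun t' s' =>
    t' <= t0 + (PH + 1) * ((KK + 1) * (150 * (s + 2))) /\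
    exists kk RP ID, arr base (mem s') aRP = RP /\ arr base (mem s') aID = ID /\
      regs s' 18 = kk /\ kk <= KK /\
      (forall U, U < kk -> a <= RP U < lim /\ cut (RP U) = true) /\
      (forall x, a <= x < lim -> cut x = true -> ID x < kk /\ same P NX x (RP (ID x)))).
Proof.
  intros R0 AP ANX R2 R10 R17. unfold types. steps.
  set (D := (KK + 1) * (130 * (s + 2)) + 20).
  eapply run_while_ltb with (base := base) (k0 := ncut cut a lim)
    (I := fun k t s' => exists p kk RP ID, a <= p <= lim /\ cut p = true /\
      regs s' 19 = p /\ regs s' 18 = kk /\ arr base (mem s') aRP = RP /\ arr base (mem s') aID = ID /\
      (forall U, U < kk -> a <= RP U < p /\ cut (RP U) = true) /\
      (forall U V, U < V -> V < kk -> ~ same P NX (RP V) (RP U)) /\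
      (forall x, a <= x < p -> cut x = true -> ID x < kk /\ same P NX x (RP (ID x))) /\
      k = ncut cut p lim /\ t + k * D <= t0 + 100 + PH * D); auto.
  { exists a, 0, (arr base (mem s0) aRP), (arr base (mem s0) aID). simp_state.
    split; [lia|]. split; [auto|]. split; [auto|]. split; [auto|]. split; [lookup_arr|]. split; [lookup_arr|].
    split; [lia|]. split; [lia|]. split; [lia|]. split; [auto|].
    assert (ncut cut a lim * D <= PH * D) by (apply Nat.mul_le_mono_r; exact HPH). lia. }
  intros k t1 s1 Hf (p & kk & RP & ID & Hp & Hcp & S19 & S18 & SRP & SID & I1 & I2 & I3 & Hk & Ht1).
  assert (Hkk : kk <= KK).
  { apply (HKKb kk RP); auto. intros U HU. specialize (I1 U HU). split; [lia | tauto]. }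
  assert (HR : regs s1 20 = lim).
  { rewrite (proj1 Hf 20 eq_refl). simp_state. destruct (Nat.ltb_spec n (a + 2 * L)); lia. }
  do 2 eexists. do 2 (split; [ev|]). cbn [cost]. split.
  2: { intros Hge. assert (Ep : p = lim) by lia. rewrite Ep in I1, I3. split.
    - assert (PH * D + 110 <= (PH + 1) * ((KK + 1) * (150 * (s + 2)))).
      { unfold D. set (E := (KK + 1) * (s + 2)).
        replace ((KK + 1) * (130 * (s + 2))) with (130 * E) by (unfold E; lia).
        replace ((KK + 1) * (150 * (s + 2))) with (150 * E) by (unfold E; lia).
        assert (2 <= E) by (unfold E; nia). clearbody E.
        assert (PH * (130 * E + 20) <= PH * (150 * E)) by (apply Nat.mul_le_mono_l; lia). lia. }
      lia.
    - exists kk, RP, ID. do 4 (split; [assumption|]). split; [exact I1 | exact I3]. }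
  intros Hlt. destruct (NX_cut p ltac:(lia)) as (N1 & N2 & N3).
  apply run_seq. eapply (run_conseq w base Hw).
  { eapply find_type_ok with (p := p) (kk := kk) (RP := RP) (ID := ID);
      try lookup_reg; try lookup_arr; auto; try lia.
    intros U HU. specialize (I1 U HU). lia. }
  cbn beta. intros t2 s2 (Ht2 & f & EID & HC) Hf2. steps.
  assert (Hle : NX p <= lim) by (destruct (le_lt_dec (NX p) lim); [auto | rewrite N3 in cut_lim by lia; discriminate]).
  exists (ncut cut (NX p) lim).
  assert (Hm : ncut cut (NX p) lim < k) by (rewrite Hk; apply ncut_lt; [lia | auto]).
  split; [exact Hm|].
  assert (Htm : t2 + 12 + ncut cut (NX p) lim * D <= t0 + 100 + PH * D).
  { assert ((ncut cut (NX p) lim + 1) * D <= k * D) by (apply Nat.mul_le_mono_r; lia).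
    unfold D in *. lia. }
  assert (HID : forall x kk' RP', f < kk' -> same P NX p (RP' f) ->
    (forall y, a <= y < p -> cut y = true -> ID y < kk' /\ same P NX y (RP' (ID y))) ->
    a <= x < NX p -> cut x = true -> update ID p f x < kk' /\ same P NX x (RP' (update ID p f x))).
  { intros x kk' RP' F1 F2 F3 Hx Hcx. destruct (lt_eq_lt_dec x p) as [[Hxp|Hxp]|Hxp]; [|subst x|].
    - rewrite update_other by lia. apply F3; auto; lia.
    - rewrite update_same. auto.
    - rewrite N3 in Hcx by lia. discriminate. }
  destruct HC as [(C1 & C2 & C3 & C4)|(C1 & C2 & C3 & C4)].
  - exists (NX p), kk, RP, (update ID p f). simp_state. cbn [mem setr].
    split; [lia|]. split; [auto|]. split; [auto|]. split; [auto|]. split; [auto|]. split; [auto|].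
    split. { intros U HU. specialize (I1 U HU). split; [lia | tauto]. }
    split; [auto|]. split; [|split; [auto | lia]].
    intros x Hx Hcx. apply HID; auto.
  - exists (NX p), (kk + 1), (update RP kk p), (update ID p f). simp_state. cbn [mem setr].
    assert (Hold : forall U, U < kk -> update RP kk p U = RP U) by (intros; apply update_other; lia).
    split; [lia|]. split; [auto|]. split; [auto|]. split; [auto|]. split; [auto|]. split; [auto|].
    split.
    { intros U HU. destruct (Nat.eq_dec U kk) as [->|].
      - rewrite update_same. split; [lia | auto].
      - rewrite Hold by lia. specialize (I1 U ltac:(lia)). split; [lia | tauto]. }
    split.
    { intros U V HUV HV. rewrite (Hold U) by lia. destruct (Nat.eq_dec V kk) as [->|].
      - rewrite update_same. apply C2. lia.
      - rewrite Hold by lia. apply I2; lia. }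
    split; [|split; [auto | lia]].
    intros x Hx Hcx. apply HID; auto; try lia.
    + subst f. rewrite update_same. split; auto.
    + intros y Hy Hcy. specialize (I3 y Hy Hcy). rewrite Hold by lia. split; [lia | tauto].
Qed.
End Types.

(** * Encoding a sequence with increments 0 and 1 *)

Fixpoint popn (k x : nat) : nat :=
  match k with 0 => 0 | S k' => x mod 2 + popn k' (x / 2) end.

Lemma popn_0 k : popn k 0 = 0.
Proof. induction k; cbn [popn]; auto. Qed.

Lemma pow2_pos k : 1 <= 2 ^ k.
Proof. pose proof (Nat.pow_nonzero 2 k). lia. Qed.

(** All bits of [v] are below position [k], so the addition sets a fresh bit without carry. *)
Lemma popn_add K k v d : k < K -> v < 2 ^ k -> d <= 1 ->
  popn K (v + d * 2 ^ k) = popn K v + d.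
Proof.
  revert k v. induction K as [|K IH]; intros k v Hk Hv Hd; [lia|].
  destruct k as [|k].
  - change (2 ^ 0) with 1 in *. replace v with 0 by lia. rewrite popn_0.
    replace (0 + d * 1) with d by lia. cbn [popn].
    rewrite Nat.mod_small, Nat.div_small, popn_0 by lia. lia.
  - cbn [popn]. rewrite Nat.pow_succ_r' in *.
    replace (v + d * (2 * 2 ^ k)) with (v + (d * 2 ^ k) * 2) by lia.
    rewrite Nat.Div0.mod_add, Nat.div_add, IH by (auto; try lia; apply Nat.Div0.div_lt_upper_bound; lia). lia.
Qed.

Lemma popn_S k x : x < 2 ^ k -> popn (S k) x = popn k x.
Proof.
  revert x. induction k as [|k IH]; intros x Hx.
  - change (2 ^ 0) with 1 in Hx. replace x with 0 by lia. reflexivity.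
  - change (popn (S (S k)) x) with (x mod 2 + popn (S k) (x / 2)).
    rewrite IH; [reflexivity|]. rewrite Nat.pow_succ_r' in Hx. apply Nat.Div0.div_lt_upper_bound. lia.
Qed.

Lemma succ_divmod b y : 1 <= b ->
  (S y mod b = 0 /\ S y / b = S (y / b)) \/
  (S y mod b = S (y mod b) /\ S y / b = y / b /\ S (y mod b) < b).
Proof.
  intros Hb. pose proof (Nat.div_mod_eq y b). pose proof (Nat.mod_upper_bound y b ltac:(lia)).
  destruct (Nat.eq_dec (S (y mod b)) b) as [E|E].
  - left. assert (S y = b * S (y / b) + 0) by lia.
    split; symmetry; [apply (Nat.mod_unique _ _ (S (y / b))) | apply (Nat.div_unique _ _ _ 0)]; lia.
  - right. assert (S y = b * (y / b) + S (y mod b)) by lia.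
    split; [|split]; [symmetry; apply (Nat.mod_unique _ _ (y / b)) |
      symmetry; apply (Nat.div_unique _ _ _ (S (y mod b)))|]; lia.
Qed.

Lemma div_mult_coarse b c x y : 1 <= b -> 1 <= c -> x / b = y / b -> x / (b * c) = y / (b * c).
Proof. intros. rewrite <- !Nat.Div0.div_div. congruence. Qed.

(* Value number [y] of the sequence stored in the samples [S] and the
   increment bits [D], one word for [b] values, from cell [h] on. *)
Definition decode (b h : nat) (S D : nat -> nat) (y : nat) : nat :=
  S (h + y / b) + popn b (D (h + y / b) mod 2 ^ (y mod b)).

(** The increment from remainder [r - 1] to remainder [r] is bit [r - 1] of the word. So [p2] is the
    weight of the bit to be written next, and the word is still below it. At remainder 0 a new word
    begins and nothing is assumed. *)
Definition sampled (b h : nat) (M S D : nat -> nat) (y p2 : nat) : Prop :=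
  (forall x, x < y -> decode b h S D x = M x) /\
  (y mod b <> 0 -> p2 = 2 ^ (y mod b - 1) /\ D (h + y / b) < p2).

Lemma sampled_new b h M S D y v : 1 <= b -> sampled b h M S D y v -> y mod b = 0 ->
  sampled b h M (update S (h + y / b) (M y)) (update D (h + y / b) 0) (Datatypes.S y) 1.
Proof.
  intros Hb (H1 & _) Hy. pose proof (Nat.div_mod_eq y b).
  split.
  - intros x Hx. unfold decode. destruct (Nat.eq_dec x y) as [->|].
    + rewrite !update_same, Nat.Div0.mod_0_l, popn_0. lia.
    (* Earlier values lie in earlier words, because [y] opens a new one. *)
    + assert (x / b <> y / b).
      { intros E. pose proof (Nat.div_mod_eq x b).
        pose proof (Nat.Div0.div_le_mono x y b). nia. }
      rewrite !update_other by lia. apply H1. lia.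
  - intros Hm. destruct (succ_divmod b y Hb) as [(E & _)|(E & E2 & E3)]; [lia|].
    rewrite E, E2, Hy. rewrite update_same. split; [reflexivity|lia].
Qed.

Lemma sampled_add b h M S D y v : 1 <= b -> sampled b h M S D y v -> y mod b <> 0 ->
  M (y - 1) <= M y <= M (y - 1) + 1 ->
  sampled b h M S (update D (h + y / b) (D (h + y / b) + (M y - M (y - 1)) * v)) (Datatypes.S y) (2 * v).
Proof.
  intros Hb (H1 & H2) Hy HM. destruct (H2 Hy) as (-> & H3). clear H2.
  set (r := y mod b) in *. set (c := h + y / b) in *. set (d := M y - M (y - 1)).
  pose proof (Nat.mod_upper_bound y b ltac:(lia)) as Hr. fold r in Hr.
  assert (Hy1 : y <> 0). { intros E. apply Hy. unfold r. rewrite E. apply Nat.Div0.mod_0_l. }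
  assert (Hprev : (y - 1) mod b = r - 1 /\ (y - 1) / b = y / b).
  { destruct (succ_divmod b (y - 1) Hb) as [(E & _)|(E & E2 & E3)];
      replace (Datatypes.S (y - 1)) with y in * by lia; unfold r; [contradiction|]; lia. }
  assert (Hdbl : 2 ^ r = 2 * 2 ^ (r - 1)) by (rewrite <- Nat.pow_succ_r'; f_equal; lia).
  assert (Hd : d <= 1) by (unfold d; lia).
  split.
  - intros x Hx. unfold decode.
    destruct (Nat.eq_dec (h + x / b) c) as [E|E].
    2: { rewrite update_other by auto. apply H1. destruct (Nat.eq_dec x y); [subst x; contradiction|lia]. }
    rewrite E, update_same. destruct (Nat.eq_dec x y) as [->|Hxy].
    + fold r. rewrite Nat.mod_small by (rewrite Hdbl; nia).
      rewrite popn_add by (auto; lia).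
      specialize (H1 (y - 1) ltac:(lia)). unfold decode in H1.
      destruct Hprev as (Hp1 & Hp2). rewrite Hp1, Hp2 in H1. fold c in H1.
      rewrite Nat.mod_small in H1 by auto. unfold d. lia.
    + specialize (H1 x ltac:(lia)). unfold decode in H1. rewrite E in H1. rewrite <- H1.
      (* An earlier value of the same word masks it to the bits below [x mod b], so the new bit
         [r - 1] is invisible to it. *)
      assert (Hx2 : x mod b <= r - 1).
      { pose proof (Nat.div_mod_eq x b). pose proof (Nat.div_mod_eq y b). fold r in H0.
        assert (x / b = y / b) by (unfold c in E; lia). nia. }
      do 2 f_equal.
      replace (2 ^ (r - 1)) with (2 ^ (r - 1 - x mod b) * 2 ^ (x mod b))
        by (rewrite <- Nat.pow_add_r; f_equal; lia).
      rewrite Nat.mul_assoc. apply Nat.Div0.mod_add.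
  - intros Hm. destruct (succ_divmod b y Hb) as [(E & _)|(E & E2 & E3)]; [lia|].
    rewrite E, E2. fold r c. replace (Datatypes.S r - 1) with r by lia.
    rewrite update_same. split; [auto|]. nia.
Qed.

(** * One level of the tree *)

(** Here [f] and [g] count the 1s in windows of lengths [m] and [m + 1]. A window can be prolonged
    by one letter to the right or to the left; the left is needed for the last start [h1], whose
    window may end the string. Each way the count grows by 0 or 1, and so do both extremes. *)
Lemma is_range_step f g a h1 h2 mn mx mn' mx' :
  a <= h2 -> h2 <= h1 <= S h2 ->
  (forall i, a <= i <= h2 -> f i <= g i <= f i + 1) ->
  (forall i, a < i <= h1 -> f i <= g (i - 1) <= f i + 1) ->
  is_range f a h1 mn mx -> is_range g a h2 mn' mx' ->
  mn <= mn' <= mn + 1 /\ mx <= mx' <= mx + 1.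
Proof.
  intros Ha Hh X Y (R1 & (i1 & Hi1 & E1) & (i2 & Hi2 & E2)) (S1 & (j1 & Hj1 & F1) & (j2 & Hj2 & F2)).
  assert (Z : forall i, a <= i <= h1 -> exists j, a <= j <= h2 /\ f i <= g j <= f i + 1).
  { intros i Hi. destruct (le_lt_dec i h2).
    - exists i. split; [lia|]. apply X. lia.
    - exists (i - 1). split; [lia|]. apply Y. lia. }
  destruct (Z i1 Hi1) as (k1 & K1 & L1). destruct (Z i2 Hi2) as (k2 & K2 & L2).
  pose proof (S1 k1 K1). pose proof (S1 k2 K2). pose proof (X j1 Hj1). pose proof (X j2 Hj2).
  pose proof (R1 j1 ltac:(lia)). pose proof (R1 j2 ltac:(lia)). lia.
Qed.

Lemma range_delta P n L a y mn mx mn' mx' :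
  (forall i j, i <= j -> j <= n -> P i <= P j <= P i + (j - i)) ->
  1 <= L -> a <= y -> S y <= n ->
  is_range (ones_at P (y - a)) a (last_start n L a y) mn mx ->
  is_range (ones_at P (S y - a)) a (last_start n L a (S y)) mn' mx' ->
  mn <= mn' <= mn + 1 /\ mx <= mx' <= mx + 1.
Proof.
  intros HP HL Ha Hy. apply is_range_step; unfold last_start; try lia.
  - intros i Hi. unfold ones_at. replace (i + (S y - a)) with (S (i + (y - a))) by lia.
    pose proof (HP (i + (y - a)) (S (i + (y - a))) ltac:(lia) ltac:(lia)).
    pose proof (HP i (i + (y - a)) ltac:(lia) ltac:(lia)). clear Hi. lia.
  - intros i Hi. unfold ones_at. replace (i - 1 + (S y - a)) with (i + (y - a)) by lia.
    pose proof (HP (i - 1) i ltac:(lia) ltac:(lia)).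
    pose proof (HP i (i + (y - a)) ltac:(lia) ltac:(lia)). clear Hi. lia.
Qed.

Section Level.
Variables (w base AB n b L s KK PH : nat).
Hypothesis Hw : 5 <= w.
Hypothesis HAB : 64 * (AB + base + 1) < 2 ^ w.
Hypothesis Hn : 16 * (n + 1) <= AB.
Hypothesis HL : L <= 2 * n.
Hypothesis HL1 : 1 <= L.
Hypothesis Hs : s <= L.
Hypothesis Hs1 : 1 <= s.
Variables (P ST NX : nat -> nat) (cut : nat -> bool).
Hypothesis P_lip : forall i j, i <= j -> j <= n -> P i <= P j <= P i + (j - i).
Hypothesis P_le : forall i, i <= n -> P i <= n.
Hypothesis ST_cut : forall i, i <= n ->
  ST i <= i /\ cut (ST i) = true /\ forall q, ST i < q <= i -> cut q = false.
Hypothesis NX_cut : forall i, i < n ->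
  i < NX i <= n /\ cut (NX i) = true /\ forall q, i < q < NX i -> cut q = false.
Hypothesis cut_len : forall i, i < n -> cut i = true -> NX i <= i + s.
Hypothesis cut_n : cut n = true.
Hypothesis cut_mod : forall q, q <= n -> q mod L = 0 \/ (q + 1) mod L = 0 -> cut q = true.
Hypothesis HPH : forall a, a <= n -> a mod L = 0 -> ncut cut a (Nat.min n (a + 2 * L)) <= PH.
Hypothesis HKK : KK * KK * (2 * s + 1) < AB.
Hypothesis HKKb : forall a k RP, a <= n -> a mod L = 0 ->
  (forall U, U < k -> a <= RP U < Nat.min n (a + 2 * L) /\ cut (RP U) = true) ->
  (forall U V, U < V -> V < k -> ~ same P NX (RP V) (RP U)) -> k <= KK.

Definition node_time : nat :=
  (PH + 1) * ((KK + 1) * (150 * (s + 2))) +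
  1000 * (KK * KK * ((s + 1) * (s + 1)) + KK + 1) + 500 * (L * (PH + 1)) + 200.

(** The index [y] codes a block, starting at [L * (y / L)], and a length, [y mod L]: it is the right
    end of the window of that length at the start of the block. A whole level is thus one sequence
    of [n + 1] values. *)
Definition covers (y mn mx : nat) : Prop :=
  is_range (ones_at P (y - L * (y / L))) (L * (y / L)) (last_start n L (L * (y / L)) y) mn mx.

Lemma node_ok t0 s0 a MN MX :
  regs s0 0 = base -> arr base (mem s0) aP = P -> arr base (mem s0) aNX = NX ->
  arr base (mem s0) aST = ST -> arr base (mem s0) aMN = MN -> arr base (mem s0) aMX = MX ->
  regs s0 2 = n -> regs s0 10 = L -> regs s0 17 = a -> regs s0 12 = s ->
  a <= n -> a mod L = 0 ->
  run w (types;; (table;; (slides;; 17 <- $17 + $10)))%prog t0 s0 (fun t' s' =>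
    t' <= t0 + node_time /\ regs s' 17 = a + L /\
    exists MN' MX', arr base (mem s') aMN = MN' /\ arr base (mem s') aMX = MX' /\
      (forall y, y < a -> MN' y = MN y /\ MX' y = MX y) /\
      (forall y, a <= y <= n -> y < a + L ->
         is_range (ones_at P (y - a)) a (last_start n L a y) (MN' y) (MX' y))).
Proof.
  intros R0 AP ANX AST AMN AMX R2 R10 R17 R12 Ha Ham.
  assert (Hlc : cut (Nat.min n (a + 2 * L)) = true).
  { destruct (le_lt_dec n (a + 2 * L)); [rewrite Nat.min_l by lia; auto|].
    rewrite Nat.min_r by lia. apply cut_mod; [lia|]. left.
    rewrite Nat.Div0.mod_add. exact Ham. }
  assert (HKK' : KK <= AB) by nia.
  apply run_seq. eapply (run_conseq w base Hw).
  { eapply types_ok with (base := base) (lim := Nat.min n (a + 2 * L)) (KK := KK) (PH := PH) (AB := AB)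
      (n := n) (L := L) (s := s) (a := a) (P := P) (NX := NX) (cut := cut); auto;
      try lookup_reg; try lookup_arr; eauto. }
  cbn beta. intros t1 s1 (Ht1 & kk & RP & ID & ARP & AID & R18 & Hkk & HRP & HID) Hf1.
  apply run_seq. eapply (run_conseq w base Hw).
  { eapply table_ok with (base := base) (kk := kk) (KK := KK) (RP := RP) (lim := Nat.min n (a + 2 * L)) (a := a)
      (AB := AB) (n := n) (L := L) (s := s) (P := P) (NX := NX) (cut := cut); auto; try lia;
      try lookup_reg; try lookup_arr. }
  cbn beta. intros t2 s2 (Ht2 & T1 & T2 & AT1 & AT2 & HT) Hf2.
  apply run_seq. eapply (run_conseq w base Hw).
  { eapply slides_ok with (base := base) (kk := kk) (KK := KK) (RP := RP) (lim := Nat.min n (a + 2 * L)) (a := a)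
      (PH := PH) (AB := AB) (n := n) (L := L) (s := s) (P := P) (NX := NX) (cut := cut) (ST := ST)
      (ID := ID) (T1 := T1) (T2 := T2) (MN := MN) (MX := MX); auto; try lia; try lookup_reg; try lookup_arr; auto.
    intros Hb. apply cut_mod; [lia|]. right. replace (a + L - 1 + 1) with (a + 1 * L) by lia.
    rewrite Nat.Div0.mod_add. exact Ham. }
  cbn beta. intros t3 s3 (Ht3 & MN' & MX' & EN & EX & H1 & H2) Hf3.
  steps. split.
  { unfold node_time.
    assert (kk * kk * ((s + 1) * (s + 1)) <= KK * KK * ((s + 1) * (s + 1)))
      by (apply Nat.mul_le_mono_r, Nat.mul_le_mono; lia). lia. }
  split; [lookup_reg|]. exists MN', MX'. do 3 (split; [assumption|]). exact H2.
Qed.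

Lemma nodes_ok t0 s0 :
  regs s0 0 = base -> arr base (mem s0) aP = P -> arr base (mem s0) aNX = NX ->
  arr base (mem s0) aST = ST ->
  regs s0 2 = n -> regs s0 10 = L -> regs s0 12 = s ->
  run w nodes t0 s0 (fun t' s' =>
    t' <= t0 + (n / L + 1) * (node_time + 10) + 20 /\
    exists MN MX, arr base (mem s') aMN = MN /\ arr base (mem s') aMX = MX /\
      forall y, y <= n -> covers y (MN y) (MX y)).
Proof.
  intros R0 AP ANX AST R2 R10 R12. unfold nodes. steps.
  apply (run_while_ltb w base Hw) with (k0 := n / L + 1)
    (I := fun k t s' => exists j, j + k = n / L + 1 /\ regs s' 17 = L * j /\
       t <= t0 + 2 + j * (node_time + 10) /\
       forall y, y <= n -> y < L * j -> covers y (arr base (mem s') aMN y) (arr base (mem s') aMX y)).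
  { exists 0. simp_state. split; [lia|]. split; [lia|]. split; [lia|]. intros. lia. }
  intros k t s1 Hf (j & Hj & R17 & Ht & HI).
  pose proof (Nat.div_mod_eq n L) as Hdm. pose proof (Nat.mod_upper_bound n L ltac:(lia)) as Hmb.
  do 2 eexists. split; [ev|]. split; [ev|]. cbn [cost]. split.
  - intros Hlt.
    assert (Hm : (L * j) mod L = 0) by (rewrite Nat.mul_comm; apply Nat.Div0.mod_mul).
    assert (Hjn : j <= n / L) by (apply Nat.div_le_lower_bound; lia).
    eapply (run_conseq w base Hw).
    { eapply node_ok with (a := L * j); auto; try lookup_reg; try lookup_arr; lia. }
    cbn beta. intros t2 s2 (Ht2 & E17 & MN & MX & EN & EX & H1 & H2) Hf2.
    exists (k - 1). split; [lia|]. exists (j + 1). rewrite EN, EX.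
    split; [lia|]. split; [lia|]. split; [lia|].
    intros y Hy Hyj. destruct (le_lt_dec (L * j) y) as [Hc|Hc].
    + assert (Ey : y / L = j) by (symmetry; apply (Nat.div_unique y L j (y - L * j)); lia).
      unfold covers. rewrite Ey. apply H2; lia.
    + destruct (H1 y Hc) as (-> & ->). apply HI; auto.
  - intros Hge. assert (Hjn : n / L < j).
    { destruct (le_lt_dec j (n / L)) as [Hc|Hc]; auto. exfalso.
      assert (L * j <= L * (n / L)) by (apply Nat.mul_le_mono_l; auto). lia. }
    assert (j = n / L + 1) by lia. split; [subst j; lia|].
    do 2 eexists. split; [reflexivity|]. split; [reflexivity|].
    intros y Hy. apply HI; lia.
Qed.

Variables (hb : nat) (MN MX : nat -> nat).
Hypothesis Hb1 : 1 <= b.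
Hypothesis Hdvd : exists c, 1 <= c /\ L = b * c.
Hypothesis Hcov : forall y, y <= n -> covers y (MN y) (MX y).
Hypothesis Hhb : hb + n / b < AB.
Hypothesis H2b : 2 ^ b <= AB.
Hypothesis Hbn : b <= AB.

(** As [b] divides [L], a group of [b] values stays inside one block, where consecutive indices are
    consecutive window lengths. *)
Lemma MN_MX_delta y : y <= n -> y mod b <> 0 ->
  MN (y - 1) <= MN y <= MN (y - 1) + 1 /\ MX (y - 1) <= MX y <= MX (y - 1) + 1.
Proof.
  intros Hy Hym. destruct Hdvd as (c & Hc & EL).
  assert (Hy1 : y <> 0). { intros ->. apply Hym. apply Nat.Div0.mod_0_l. }
  assert (Ed : y / L = (y - 1) / L).
  { rewrite EL. apply div_mult_coarse; auto.
    destruct (succ_divmod b (y - 1) Hb1) as [(E & _)|(E & E2 & _)];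
      replace (S (y - 1)) with y in * by lia; [contradiction | auto]. }
  pose proof (Hcov y Hy) as C1. pose proof (Hcov (y - 1) ltac:(lia)) as C2.
  unfold covers in *. rewrite <- Ed in C2.
  pose proof (Nat.Div0.mul_div_le (y - 1) L) as Hle. rewrite <- Ed in Hle.
  assert (Hle2 : L * (y / L) <= y - 1) by lia. clear Hle.
  pose proof (range_delta P n L (L * (y / L)) (y - 1) (MN (y - 1)) (MX (y - 1)) (MN y) (MX y)) as X.
  replace (S (y - 1)) with y in X by lia. apply X; auto.
Qed.

Lemma covers_le y : y <= n -> MN y <= n /\ MX y <= n.
Proof.
  intros Hy. destruct (Hcov y Hy) as (_ & (i & Hi & E1) & (j & Hj & E2)).
  unfold last_start, ones_at in *.
  pose proof (Nat.Div0.mul_div_le y L).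
  pose proof (P_le (i + (y - L * (y / L))) ltac:(lia)).
  pose proof (P_le (j + (y - L * (y / L))) ltac:(lia)). lia.
Qed.

Definition encoded (MS MB XS XB : nat -> nat) : Prop :=
  forall y, y <= n -> covers y (decode b hb MS MB y) (decode b hb XS XB y).

Lemma encode_ok t0 s0 MS MB XS XB :
  regs s0 0 = base -> arr base (mem s0) aMN = MN -> arr base (mem s0) aMX = MX ->
  arr base (mem s0) aMS = MS -> arr base (mem s0) aMB = MB ->
  arr base (mem s0) aXS = XS -> arr base (mem s0) aXB = XB ->
  regs s0 2 = n -> regs s0 7 = b -> regs s0 11 = hb ->
  run w encode t0 s0 (fun t' s' => t' <= t0 + 200 * (n + 1) /\
    exists MS' MB' XS' XB', arr base (mem s') aMS = MS' /\ arr base (mem s') aMB = MB' /\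
      arr base (mem s') aXS = XS' /\ arr base (mem s') aXB = XB' /\
      (forall c, c < hb -> MS' c = MS c /\ MB' c = MB c /\ XS' c = XS c /\ XB' c = XB c) /\
      encoded MS' MB' XS' XB').
Proof.
  intros R0 AMN AMX AMS AMB AXS AXB R2 R7 R11. unfold encode.
  eapply (run_for w base Hw) with (lo := 0) (hi := n + 1) (c := 150)
    (I := fun y s' =>
      (forall c, c < hb -> arr base (mem s') aMS c = MS c /\ arr base (mem s') aMB c = MB c /\
                   arr base (mem s') aXS c = XS c /\ arr base (mem s') aXB c = XB c) /\
      sampled b hb MN (arr base (mem s') aMS) (arr base (mem s') aMB) y (regs s' 16) /\
      sampled b hb MX (arr base (mem s') aXS) (arr base (mem s') aXB) y (regs s' 16));
    auto; try ev; try lia.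
  { cbn [mem setr]. rewrite AMS, AMB, AXS, AXB. simp_state. split; [auto|].
    split; (split; [intros; lia | rewrite Nat.Div0.mod_0_l; lia]). }
  { intros. ev. }
  - intros y t1 s1 _ Hy Hf R13 (I0 & I1 & I2).
    assert (Hyb : y / b <= n / b) by (apply Nat.Div0.div_le_mono; lia).
    pose proof (div_le_self y b). pose proof (Nat.Div0.mod_le y b).
    pose proof (covers_le y ltac:(lia)) as (B1 & B2).
    step. step. step; try lia.
    + steps. split; [lia|]. simp_arr. simp_state. split.
      { intros c Hc. rewrite !update_other by lia. apply I0. exact Hc. }
      split; eapply sampled_new; eauto.
    + destruct (MN_MX_delta y ltac:(lia) H1) as (D1 & D2).
      destruct (proj2 I1 H1) as (E1 & E2). destruct (proj2 I2 H1) as (_ & E3).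
      assert (Hp : regs s1 16 * 2 <= AB).
      { rewrite E1. rewrite Nat.mul_comm, <- Nat.pow_succ_r'. eapply Nat.le_trans; [|exact H2b].
        apply Nat.pow_le_mono_r; [lia|]. pose proof (Nat.mod_upper_bound y b ltac:(lia)). lia. }
      assert (F1 : (MN y - MN (y - 1)) * regs s1 16 <= regs s1 16).
      { rewrite <- (Nat.mul_1_l (regs s1 16)) at 2. apply Nat.mul_le_mono_r. lia. }
      assert (F2 : (MX y - MX (y - 1)) * regs s1 16 <= regs s1 16).
      { rewrite <- (Nat.mul_1_l (regs s1 16)) at 2. apply Nat.mul_le_mono_r. lia. }
      clear E1. steps. split; [lia|]. simp_arr. simp_state. split.
      { intros c Hc. rewrite !update_other by lia. apply I0. exact Hc. }
      split; eapply sampled_add; eauto.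
  - cbn [cost]. intros t1 s1 Hf R13 (I0 & I1 & I2) Ht. split; [lia|].
    do 4 eexists. do 4 (split; [reflexivity|]). split; [exact I0|].
    intros y Hy. rewrite (proj1 I1 y ltac:(lia)), (proj1 I2 y ltac:(lia)). apply Hcov. exact Hy.
Qed.
End Level.

(** * Cutting the string into phrases *)

(* [eo] maps the start of a phrase to its end, [so] its end to its start, and
   [ct q] tells whether [q] is still a cut. *)
Definition mstep (s : nat) (f : (nat -> nat) * (nat -> nat) * (nat -> nat)) (q : nat) :=
  let '(eo, so, ct) := f in
  if eo q <? so q + s + 1
  then (update eo (so q) (eo q), update so (eo q) (so q), update ct q 0) else f.

Definition wf_phrases (n : nat) (f : (nat -> nat) * (nat -> nat) * (nat -> nat)) : Prop :=
  let '(eo, so, ct) := f in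
  (forall i, i < n -> eo i <= n) /\ (forall i, 1 <= i <= n -> so i < n) /\
  (forall i, 1 <= i <= n -> ct i <= 1).

Lemma mstep_wf n s f q : 1 <= q < n -> wf_phrases n f -> wf_phrases n (mstep s f q).
Proof.
  destruct f as [[eo so] ct]. intros Hq (H1 & H2 & H3). unfold mstep.
  destruct (eo q <? so q + s + 1); [|repeat split; auto].
  pose proof (H1 q ltac:(lia)). pose proof (H2 q ltac:(lia)).
  repeat split; intros i Hi; unfold update; destruct (_ =? _); auto; lia.
Qed.

Section Cuts.
Variables (w base AB n L : nat).
Hypothesis Hw : 5 <= w.
Hypothesis HAB : 64 * (AB + base + 1) < 2 ^ w.
Hypothesis Hn : 16 * (n + 1) <= AB.
Hypothesis Hn1 : 1 <= n.
Hypothesis HL : L <= 2 * n.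
Hypothesis HL1 : 1 <= L.

Lemma choose_s_ok t0 s0 g :
  regs s0 0 = g -> regs s0 10 = L -> 1 <= g -> 8 * (g * g) <= AB -> 8 * (L * L) <= AB ->
  run w choose_s t0 s0 (fun t' s' => exists s, regs s' 12 = s /\ 1 <= s /\ s <= L /\
    t' <= t0 + 60 * (s + 1) /\
    (s = 1 \/ s * s * s * (g * g) <= L * L) /\ L * L < (s + 1) * (s + 1) * (s + 1) * (g * g)).
Proof.
  intros R0 R10 Hg Hgg HLL. unfold choose_s. steps.
  eapply (run_while_ltb w base Hw) with (k0 := L)
    (I := fun k t s' => exists s, regs s' 12 = s /\ 1 <= s /\ s + k = L + 1 /\ t <= t0 + 40 * s /\
       (s = 1 \/ s * s * s * (g * g) <= L * L)).
  { exists 1. simp_state. repeat split; auto; lia. }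
  intros k t s1 Hf (s & R12 & Hs & Hk & Ht & HC).
  assert (Hgg1 : 1 <= g * g) by nia.
  set (u := (s + 1) * (s + 1) * (s + 1)).
  (* [s + 1 <= 2 * s] bounds the next number to be compared by 8 times one already known to be
     small, so the test cannot overflow. *)
  assert (Hu : u <= 8 * (s * s * s)) by (unfold u; nia).
  assert (Hub : u * (g * g) <= AB).
  { assert (u * (g * g) <= 8 * (s * s * s) * (g * g)) by (apply Nat.mul_le_mono_r; auto).
    destruct HC as [->|HC]; lia. }
  assert (Hg2 : g <= g * g) by (apply le_mul_pos; auto).
  assert (Hu1 : u * g <= AB) by (eapply Nat.le_trans; [apply Nat.mul_le_mono_l; exact Hg2|exact Hub]).
  assert (Hu2 : u <= AB) by (eapply Nat.le_trans; [apply le_mul_pos; exact Hg|exact Hu1]).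
  assert (Hu3 : (s + 1) * (s + 1) <= AB) by (eapply Nat.le_trans; [apply (le_mul_pos _ (s + 1)); lia|exact Hu2]).
  assert (Hu4 : s + 1 <= AB) by (eapply Nat.le_trans; [apply (le_mul_pos _ (s + 1)); lia|exact Hu3]).
  rewrite Nat.mul_assoc in Hub.
  do 2 eexists. unfold u in Hub, Hu1, Hu2. split; [ev|].
  split; [ev|]. cbn [cost]. fold u. split.
  - intros Hlt. assert (Hlt' : u * (g * g) <= L * L) by lia.
    assert (Hs2 : s + 1 <= L).
    { assert (u * 1 <= u * (g * g)) by (apply Nat.mul_le_mono_l; lia).
      destruct (le_lt_dec (s + 1) L); auto. exfalso.
      assert ((L + 1) * (L + 1) <= (s + 1) * (s + 1)) by (apply Nat.mul_le_mono; lia).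
      assert ((s + 1) * (s + 1) * 1 <= u) by (unfold u; apply Nat.mul_le_mono_l; lia). lia. }
    steps. exists (k - 1). split; [lia|]. exists (s + 1). simp_state.
    split; [auto|]. split; [lia|]. split; [lia|]. split; [lia|]. right. exact Hlt'.
  - intros Hge. exists s. split; [auto|]. split; [auto|].
    assert (Hs2 : s <= L).
    { destruct HC as [->|HC]; [lia|].
      assert (s * s * s * 1 <= s * s * s * (g * g)) by (apply Nat.mul_le_mono_l; lia).
      destruct (le_lt_dec s L); auto. exfalso.
      assert ((L + 1) * (L + 1) <= s * s) by (apply Nat.mul_le_mono; lia).
      assert (s * s * 1 <= s * s * s) by (apply Nat.mul_le_mono_l; lia). lia. }
    split; [auto|]. split; [lia|]. split; [auto|]. fold u. lia.
Qed.

Lemma init_cuts_ok t0 s0 :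
  regs s0 0 = base -> regs s0 2 = n ->
  run w init_cuts t0 s0 (fun t' s' => t' <= t0 + 100 * (n + 1) /\
    exists EO SO CT, arr base (mem s') aEO = EO /\ arr base (mem s') aSO = SO /\
      arr base (mem s') aCT = CT /\
      forall i, i < n -> EO i = i + 1 /\ SO (i + 1) = i /\ CT (i + 1) = 1).
Proof.
  intros R0 R2. unfold init_cuts.
  eapply (run_for w base Hw) with (lo := 0) (hi := n) (c := 80)
    (I := fun y s' => forall i, i < y -> arr base (mem s') aEO i = i + 1 /\
       arr base (mem s') aSO (i + 1) = i /\ arr base (mem s') aCT (i + 1) = 1);
    auto; try ev; try lia.
  { intros. ev. }
  - intros y t1 s1 _ Hy Hf R13 HI. steps. split; [lia|]. simp_arr.
    intros i Hi. destruct (Nat.eq_dec i y) as [->|].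
    + rewrite !update_same. auto.
    + rewrite !update_other by lia. apply HI. lia.
  - cbn [cost]. intros t1 s1 Hf R13 HI Ht. split; [lia|].
    do 3 eexists. do 3 (split; [reflexivity|]). exact HI.
Qed.

Lemma merge_ok t0 s0 s J EO SO CT :
  regs s0 0 = base -> regs s0 2 = n -> regs s0 12 = s -> s <= L ->
  arr base (mem s0) aJ = J -> arr base (mem s0) aEO = EO -> arr base (mem s0) aSO = SO ->
  arr base (mem s0) aCT = CT ->
  (forall k, k < n - 1 -> 1 <= J k < n) -> wf_phrases n (EO, SO, CT) ->
  run w merge t0 s0 (fun t' s' => t' <= t0 + 200 * (n + 1) /\
    (arr base (mem s') aEO, arr base (mem s') aSO, arr base (mem s') aCT) =
    fold_left (mstep s) (map (fun x => J (n - 2 - x)) (seq 0 (n - 1))) (EO, SO, CT) /\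
    wf_phrases n (arr base (mem s') aEO, arr base (mem s') aSO, arr base (mem s') aCT)).
Proof.
  intros R0 R2 R12 Hs AJ AEO ASO ACT HJ Hwf. unfold merge.
  eapply (run_for w base Hw) with (lo := 0) (hi := n - 1) (c := 150)
    (I := fun y s' =>
      (arr base (mem s') aEO, arr base (mem s') aSO, arr base (mem s') aCT) =
        fold_left (mstep s) (map (fun x => J (n - 2 - x)) (seq 0 y)) (EO, SO, CT) /\
      wf_phrases n (arr base (mem s') aEO, arr base (mem s') aSO, arr base (mem s') aCT));
    auto; try ev; try lia.
  { cbn [mem setr seq map fold_left]. rewrite AEO, ASO, ACT. auto. }
  { intros. ev. }
  - intros y t1 s1 _ Hy Hf R13 (HI & HW).
    set (q := J (n - 2 - y)). pose proof (HJ (n - 2 - y) ltac:(lia)) as Hq. fold q in Hq.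
    pose proof HW as (W1 & W2 & W3).
    pose proof (W1 q ltac:(lia)). pose proof (W2 q ltac:(lia)).
    rewrite seq_S, map_app, fold_left_app, <- HI. cbn [map fold_left Nat.add]. fold q.
    assert (HW' := mstep_wf n s _ q Hq HW).
    unfold mstep in *.
    unfold q in *. clear q. steps; (split; [lia|]); simp_arr.
    + destruct (Nat.ltb_spec (arr base (mem s1) 6 (J (n - 2 - y))) (arr base (mem s1) 7 (J (n - 2 - y)) + s + 1)); [auto|lia].
    + destruct (Nat.ltb_spec (arr base (mem s1) 6 (J (n - 2 - y))) (arr base (mem s1) 7 (J (n - 2 - y)) + s + 1)); [lia|auto].
  - cbn [cost]. intros t1 s1 Hf R13 (HI & HW) Ht. split; [lia|]. auto.
Qed.

(** Cell 0 is never filled, and position 0 is a cut by decree. Elsewhere the cell counts the reasons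
    for a cut, up to three. *)
Definition is_cut (CT : nat -> nat) (q : nat) : bool := (q =? 0) || negb (CT q =? 0).

Lemma forward_ok t0 s0 CT :
  regs s0 0 = base -> regs s0 2 = n -> regs s0 10 = L -> arr base (mem s0) aCT = CT ->
  (forall i, 1 <= i <= n -> CT i <= 1) ->
  run w forward t0 s0 (fun t' s' => t' <= t0 + 200 * (n + 1) /\
    exists CT' ST, arr base (mem s') aCT = CT' /\ arr base (mem s') aST = ST /\
      (forall i, 1 <= i <= n -> CT' i <= 3 /\ is_cut CT' i =
         negb (CT i =? 0) || (i mod L =? 0) || ((i + 1) mod L =? 0)) /\
      forall i, i <= n -> ST i <= i /\ is_cut CT' (ST i) = true /\
        forall q, ST i < q <= i -> is_cut CT' q = false).
Proof.
  intros R0 R2 R10 ACT HCT. unfold forward. steps.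
  eapply (run_for w base Hw) with (lo := 1) (hi := n + 1) (c := 120)
    (I := fun y s' =>
      (forall i, y <= i <= n -> arr base (mem s') aCT i = CT i) /\
      (forall i, 1 <= i < y -> arr base (mem s') aCT i =
         CT i + Nat.b2n (i mod L =? 0) + Nat.b2n ((i + 1) mod L =? 0)) /\
      forall i, i < y -> arr base (mem s') aST i <= i /\
        is_cut (arr base (mem s') aCT) (arr base (mem s') aST i) = true /\
        forall q, arr base (mem s') aST i < q <= i -> is_cut (arr base (mem s') aCT) q = false);
    auto; try ev; try lia.
  { simp_arr. rewrite ACT. split; [auto|]. split; [intros; lia|].
    intros i Hi. replace i with 0 by lia. rewrite update_same. split; [lia|]. split; [reflexivity|]. intros; lia. }
  { intros. ev. }
  - intros y t1 s1 Hy1 Hy2 Hf R13 (I1 & I2 & I3).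
    pose proof (I1 y ltac:(lia)) as Ey. pose proof (HCT y ltac:(lia)).
    pose proof (Nat.Div0.mod_le y L). pose proof (Nat.Div0.mod_le (y + 1) L).
    set (v := CT y + Nat.b2n (y mod L =? 0) + Nat.b2n ((y + 1) mod L =? 0)).
    assert (Hb : Nat.b2n (y mod L =? 0) <= 1 /\ Nat.b2n ((y + 1) mod L =? 0) <= 1)
      by (destruct (y mod L =? 0), ((y + 1) mod L =? 0); cbn; lia).
    pose proof (one_lt_pow2 w Hw).
    set (CT' := update (arr base (mem s1) aCT) y v).
    assert (Hold : forall q, q <= y - 1 -> is_cut CT' q = is_cut (arr base (mem s1) aCT) q).
    { intros q Hq. unfold is_cut, CT'. rewrite update_other by lia. reflexivity. }
    assert (J1 : forall i, S y <= i <= n -> CT' i = CT i).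
    { intros i Hi. unfold CT'. rewrite update_other by lia. apply I1. lia. }
    assert (J2 : forall i, 1 <= i < S y -> CT' i =
         CT i + Nat.b2n (i mod L =? 0) + Nat.b2n ((i + 1) mod L =? 0)).
    { intros i Hi. unfold CT'. destruct (Nat.eq_dec i y) as [->|].
      - rewrite update_same. reflexivity.
      - rewrite update_other by lia. apply I2. lia. }
    assert (J3 : forall ST', (forall i, i < y -> ST' i = arr base (mem s1) aST i) ->
      ST' y = (if v =? 0 then arr base (mem s1) aST (y - 1) else y) ->
      forall i, i < S y -> ST' i <= i /\ is_cut CT' (ST' i) = true /\
        forall q, ST' i < q <= i -> is_cut CT' q = false).
    { intros ST' E1 E2 i Hi. destruct (Nat.eq_dec i y) as [->|].
      - rewrite E2. destruct (Nat.eqb_spec v 0) as [Ev|Ev].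
        + destruct (I3 (y - 1) ltac:(lia)) as (A1 & A2 & A3). split; [lia|].
          split; [rewrite Hold by lia; exact A2|]. intros q Hq.
          destruct (Nat.eq_dec q y) as [->|]; [|rewrite Hold by lia; apply A3; lia].
          unfold is_cut, CT'. rewrite update_same, Ev. destruct (Nat.eqb_spec y 0); [lia|reflexivity].
        + split; [lia|]. split; [|intros; lia]. unfold is_cut, CT'. rewrite update_same.
          destruct (Nat.eqb_spec v 0); [contradiction|]. apply orb_true_r.
      - rewrite E1 by lia. destruct (I3 i ltac:(lia)) as (A1 & A2 & A3). split; [auto|].
        split; [rewrite Hold by lia; exact A2|]. intros q Hq. rewrite Hold by lia. auto. }
    assert (Ev : arr base (mem s1) 8 y + Nat.b2n (y mod L =? 0) + Nat.b2n ((y + 1) mod L =? 0) = v)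
      by (unfold v; rewrite Ey; reflexivity).
    step; try lia. rewrite Ev. fold CT'.
    step; try lia.
    all: match goal with H : _ |- _ => rewrite update_same in H end.
    all: steps; (split; [lia|]); simp_arr; fold CT'.
    all: split; [exact J1|]; split; [exact J2|]; apply J3.
    1, 3: intros i Hi; rewrite update_other by lia; reflexivity.
    all: rewrite update_same; destruct (Nat.eqb_spec v 0); auto; lia.
  - cbn [cost]. intros t1 s1 Hf R13 (I1 & I2 & I3) Ht. split; [lia|].
    do 2 eexists. do 2 (split; [reflexivity|]). split; [|intros i Hi; apply I3; lia].
    intros i Hi. rewrite (I2 i ltac:(lia)). pose proof (HCT i Hi). split.
    + destruct (i mod L =? 0), ((i + 1) mod L =? 0); cbn [Nat.b2n]; lia.
    + unfold is_cut. rewrite (I2 i ltac:(lia)).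
      destruct (Nat.eqb_spec i 0); [lia|]. cbn [orb].
      destruct (Nat.eqb_spec (CT i) 0) as [E|E], (i mod L =? 0), ((i + 1) mod L =? 0); cbn [Nat.b2n negb orb];
        rewrite ?E; try reflexivity; destruct (CT i); try lia; reflexivity.
Qed.

Lemma backward_ok t0 s0 CT :
  regs s0 0 = base -> regs s0 2 = n -> arr base (mem s0) aCT = CT -> is_cut CT n = true ->
  run w backward t0 s0 (fun t' s' => t' <= t0 + 200 * (n + 1) /\
    exists NX, arr base (mem s') aNX = NX /\
      forall i, i < n -> i < NX i <= n /\ is_cut CT (NX i) = true /\
        forall q, i < q < NX i -> is_cut CT q = false).
Proof.
  intros R0 R2 ACT Hc. unfold backward.
  eapply (run_for w base Hw) with (lo := 0) (hi := n) (c := 120)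
    (I := fun y s' => forall i, n - y <= i -> i < n ->
      i < arr base (mem s') aNX i <= n /\ is_cut CT (arr base (mem s') aNX i) = true /\
        forall q, i < q < arr base (mem s') aNX i -> is_cut CT q = false);
    auto; try ev; try lia.
  { intros. ev. }
  - intros y t1 s1 _ Hy Hf R13 HI.
    assert (J : forall NX', (forall i, n - y <= i -> i < n -> NX' i = arr base (mem s1) aNX i) ->
      NX' (n - 1 - y) = (if CT (n - 1 - y + 1) =? 0 then arr base (mem s1) aNX (n - 1 - y + 1) else n - 1 - y + 1) ->
      forall i, n - S y <= i -> i < n -> i < NX' i <= n /\ is_cut CT (NX' i) = true /\
        forall q, i < q < NX' i -> is_cut CT q = false).
    { intros NX' E1 E2 i Hi1 Hi2. destruct (Nat.eq_dec i (n - 1 - y)) as [->|].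
      - rewrite E2. destruct (Nat.eqb_spec (CT (n - 1 - y + 1)) 0) as [E|E].
        + assert (Hne : n - 1 - y + 1 <> n).
          { intros E'. rewrite E' in E. unfold is_cut in Hc. rewrite E in Hc.
            destruct (Nat.eqb_spec n 0); [lia|discriminate]. }
          destruct (HI (n - 1 - y + 1) ltac:(lia) ltac:(lia)) as (A1 & A2 & A3).
          split; [lia|]. split; [auto|]. intros q Hq.
          destruct (Nat.eq_dec q (n - 1 - y + 1)) as [->|]; [|apply A3; lia].
          unfold is_cut. rewrite E. destruct (Nat.eqb_spec (n - 1 - y + 1) 0); [lia|reflexivity].
        + split; [lia|]. split; [|intros; lia]. unfold is_cut.
          destruct (Nat.eqb_spec (CT (n - 1 - y + 1)) 0); [contradiction|]. apply orb_true_r.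
      - rewrite E1 by lia. apply HI; lia. }
    steps; (split; [lia|]); simp_arr.
    all: apply J; [intros i Hi1 Hi2; rewrite update_other by lia; reflexivity|].
    all: rewrite update_same; destruct (Nat.eqb_spec (CT (n - 1 - y + 1)) 0); auto; lia.
  - cbn [cost]. intros t1 s1 Hf R13 HI Ht. split; [lia|].
    eexists. split; [reflexivity|]. intros i Hi. apply HI; lia.
Qed.
End Cuts.

(** * Derivation trees *)

Inductive tree : Type :=
| Leaf (X : nat) (b : bool)
| Node (X : nat) (l r : tree).

Definition root (t : tree) : nat := match t with Leaf X _ | Node X _ _ => X end.

Fixpoint yield (t : tree) : list bool :=
  match t with Leaf _ b => [b] | Node _ l r => yield l ++ yield r end.

Fixpoint deriv (rs : list rhs) (t : tree) : Prop :=
  match t with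
  | Leaf X b => nth_error rs X = Some (Terminal b)
  | Node X l r => nth_error rs X = Some (Pair (root l) (root r)) /\ deriv rs l /\ deriv rs r
  end.

(* The positions at which the yields of two siblings meet, in preorder. *)
Fixpoint junctions (t : tree) (off : nat) : list nat :=
  match t with
  | Leaf _ _ => []
  | Node _ l r =>
      let q := off + length (yield l) in q :: junctions l off ++ junctions r q
  end.

(** A nonterminal has one rule, so the root determines the roots of the children and, inductively,
    the tree. This is what turns few nonterminals into few phrases. *)
Lemma deriv_unique rs t t' : deriv rs t -> deriv rs t' -> root t = root t' -> t = t'.
Proof.
  revert t'. induction t as [X b|X l IHl r IHr]; intros [X' b'|X' l' r'] H H' E; cbn in *; subst X'.
  - congruence.
  - destruct H' as (H' & _). congruence.
  - destruct H as (H & _). congruence.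
  - destruct H as (H & Hl & Hr), H' as (H' & Hl' & Hr').
    assert (E : root l = root l' /\ root r = root r') by (split; congruence). destruct E as (El & Er).
    f_equal; auto.
Qed.

Lemma yield_pos t : 1 <= length (yield t).
Proof. induction t; cbn; [lia|]. rewrite length_app. lia. Qed.

(** A forest with one derivation tree for each nonterminal of a sentential form; unlike a
    derivation, it does not depend on the order of the rewriting steps. *)
Inductive parses (rs : list rhs) : list symbol -> list bool -> Prop :=
| parses_nil : parses rs [] []
| parses_tm b u v : parses rs u v -> parses rs (Tm b :: u) (b :: v)
| parses_nt t u v : deriv rs t -> parses rs u v -> parses rs (Nt (root t) :: u) (yield t ++ v).

Lemma parses_tm_inv rs b u v : parses rs (Tm b :: u) v -> exists v', v = b :: v' /\ parses rs u v'.
Proof. intros H. inversion H; subst. eauto. Qed.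

Lemma parses_nt_inv rs X u v : parses rs (Nt X :: u) v ->
  exists t v', deriv rs t /\ root t = X /\ v = yield t ++ v' /\ parses rs u v'.
Proof. intros H. inversion H; subst. eexists _, _. eauto. Qed.

Lemma parses_nil_inv rs v : parses rs [] v -> v = [].
Proof. intros H. inversion H; auto. Qed.

Lemma parses_app rs a b v : parses rs (a ++ b) v ->
  exists v1 v2, v = v1 ++ v2 /\ parses rs a v1 /\ parses rs b v2.
Proof.
  revert v. induction a as [|[c|X] a IH]; cbn; intros v H.
  - exists [], v. repeat split; auto. constructor.
  - apply parses_tm_inv in H. destruct H as (v' & -> & H).
    destruct (IH _ H) as (v1 & v2 & -> & ? & ?). exists (c :: v1), v2. repeat split; auto. now constructor.
  - apply parses_nt_inv in H. destruct H as (t & v' & Ht & <- & -> & H).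
    destruct (IH _ H) as (v1 & v2 & -> & ? & ?). exists (yield t ++ v1), v2.
    rewrite app_assoc. repeat split; auto. now constructor.
Qed.

Lemma parses_cat rs a b v1 v2 : parses rs a v1 -> parses rs b v2 -> parses rs (a ++ b) (v1 ++ v2).
Proof. induction 1; intros; cbn; [auto|constructor; auto|]. rewrite <- app_assoc. constructor; auto. Qed.

(** Undoing a rewriting step joins the trees of the right-hand side below a new root. Going
    backwards from the terminal string, a derivation becomes one tree. *)
Lemma parses_step G u v s : step G u v -> parses (rules G) v s -> parses (rules G) u s.
Proof.
  intros [a c X r HX] H. apply parses_app in H. destruct H as (v1 & v2 & -> & H1 & H2).
  apply parses_cat; auto. apply parses_app in H2. destruct H2 as (v3 & v4 & -> & H3 & H4).
  destruct r as [b|Y Z]; cbn in H3.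
  - apply parses_tm_inv in H3. destruct H3 as (v' & -> & H3). apply parses_nil_inv in H3. subst v'.
    exact (parses_nt (rules G) (Leaf X b) c v4 HX H4).
  - apply parses_nt_inv in H3. destruct H3 as (l & v' & Hl & <- & -> & H3).
    apply parses_nt_inv in H3. destruct H3 as (r & v5 & Hr & <- & -> & H3).
    apply parses_nil_inv in H3. subst v5. rewrite app_nil_r.
    apply (parses_nt (rules G) (Node X l r) c v4); auto. cbn. auto.
Qed.

Lemma slp_tree G B : slp_for G B ->
  exists t, deriv (rules G) t /\ root t = start G /\ yield t = B.
Proof.
  intros (_ & H). pose proof (proj2 (H B) eq_refl) as HB. clear H.
  unfold generates in HB. apply clos_rt_rt1n in HB.
  assert (P : parses (rules G) [Nt (start G)] B).
  { remember (map Tm B) as v. induction HB; subst.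
    - clear. induction B; constructor; auto.
    - eapply parses_step; eauto. }
  apply parses_nt_inv in P. destruct P as (t & v' & Ht & HX & -> & P). apply parses_nil_inv in P.
  subst v'. exists t. rewrite app_nil_r. auto.
Qed.

Lemma deriv_root_lt rs t : deriv rs t -> root t < length rs.
Proof. intros H. apply nth_error_Some. destruct t; cbn in *; [|destruct H]; congruence. Qed.

(** * The phrases of a derivation tree *)

Fixpoint glue (s : nat) (P Q : list (list bool)) : list (list bool) :=
  match P with
  | [] => Q
  | [x] =>
      match Q with
      | [] => [x]
      | y :: Q' => if length x + length y <=? s then (x ++ y) :: Q' else x :: y :: Q'
      end
  | x :: P' => x :: glue s P' Q
  end.

(* Concatenating the phrases of two siblings creates at most one new phrase,
   so that there are at most as many distinct phrases as rules. *)
Fixpoint phrases (s : nat) (t : tree) : list (list bool) :=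
  match t with Leaf _ b => [[b]] | Node _ l r => glue s (phrases s l) (phrases s r) end.

Fixpoint spaced (s : nat) (P : list (list bool)) : Prop :=
  match P with
  | x :: ((y :: _) as P') => s < length x + length y /\ spaced s P'
  | _ => True
  end.

Lemma glue_cons s x y P Q : glue s (x :: y :: P) Q = x :: glue s (y :: P) Q.
Proof. reflexivity. Qed.

Lemma glue_concat s P Q : concat (glue s P Q) = concat P ++ concat Q.
Proof.
  induction P as [|x [|y P] IH]; [reflexivity| |].
  - destruct Q as [|y Q]; cbn; [now rewrite !app_nil_r|].
    destruct (_ <=? _); cbn; rewrite ?app_nil_r, ?app_assoc; auto.
  - rewrite glue_cons. cbn [concat]. rewrite IH. cbn [concat]. now rewrite !app_assoc.
Qed.

Lemma glue_in s P Q u : In u (glue s P Q) -> In u P \/ In u Q \/ u = last P [] ++ hd [] Q.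
Proof.
  induction P as [|x [|y P] IH]; [auto| |].
  - destruct Q as [|y Q]; [cbn; tauto|]. cbn [glue last hd]. destruct (_ <=? _); cbn; intuition.
  - rewrite glue_cons. intros [->|H]; [cbn; tauto|]. destruct (IH H) as [H'|[H'|H']]; cbn in *; tauto.
Qed.

Lemma glue_Forall s (A : list bool -> Prop) P Q :
  (forall x y, A x -> A y -> length x + length y <= s -> A (x ++ y)) ->
  Forall A P -> Forall A Q -> Forall A (glue s P Q).
Proof.
  intros HA HP HQ. induction HP as [|x P Hx HP IH]; [auto|]. destruct P as [|y P].
  - cbn. destruct HQ as [|y Q Hy HQ]; [auto|]. destruct (Nat.leb_spec (length x + length y) s); auto.
  - rewrite glue_cons. constructor; auto.
Qed.

Lemma glue_head s x P Q : exists y R, glue s (x :: P) Q = y :: R /\ length x <= length y.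
Proof.
  destruct P as [|z P]; [|rewrite glue_cons; eauto].
  destruct Q as [|z Q]; cbn; [eauto|]. destruct (_ <=? _); [|eauto].
  do 2 eexists. split; [reflexivity|]. rewrite length_app. lia.
Qed.

(** Neighbours at the junction that are not joined are together longer than [s]; joining only
    lengthens phrases, so all other pairs stay long enough. *)
Lemma glue_spaced s P Q : spaced s P -> spaced s Q -> spaced s (glue s P Q).
Proof.
  intros HP HQ. induction P as [|x [|y P] IH]; [auto| |].
  - destruct Q as [|y Q]; [exact I|]. cbn [glue].
    destruct (Nat.leb_spec (length x + length y) s); [|split; auto].
    destruct Q as [|z Q]; [exact I|]. destruct HQ as (H1 & H2). split; auto. rewrite length_app. lia.
  - rewrite glue_cons. destruct HP as (H1 & H2). specialize (IH H2).
    destruct (glue_head s y P Q) as (z & R & E & Hz). rewrite E in *. split; [lia | auto].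
Qed.

Lemma phrases_concat s t : concat (phrases s t) = yield t.
Proof. induction t; cbn; auto. rewrite glue_concat. congruence. Qed.

Lemma phrases_spaced s t : spaced s (phrases s t).
Proof. induction t; cbn; auto using glue_spaced. Qed.

Lemma phrases_length s t : 1 <= s -> Forall (fun u => 1 <= length u <= s) (phrases s t).
Proof.
  intros Hs. induction t; cbn.
  - constructor; [cbn; lia | constructor].
  - apply glue_Forall; auto. intros. rewrite length_app. lia.
Qed.

(** The only phrase that may occur at a node without occurring at a child. If the two parts are too
    long to be joined it need not be a phrase at all, which is harmless for an upper bound. *)
Definition own_phrase (s : nat) (t : tree) : list bool :=
  match t with
  | Leaf _ b => [b]
  | Node _ l r => last (phrases s l) [] ++ hd [] (phrases s r)
  end.

Fixpoint subtrees (t : tree) : list tree :=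
  t :: match t with Leaf _ _ => [] | Node _ l r => subtrees l ++ subtrees r end.

Lemma phrases_own s t u : In u (phrases s t) -> exists t', In t' (subtrees t) /\ u = own_phrase s t'.
Proof.
  induction t as [X b|X l IHl r IHr]; cbn [phrases]; intros H.
  - destruct H as [<-|[]]. exists (Leaf X b). cbn. auto.
  - apply glue_in in H. destruct H as [H|[H|H]].
    + destruct (IHl H) as (t' & H1 & H2). exists t'. split; auto. cbn. rewrite in_app_iff. auto.
    + destruct (IHr H) as (t' & H1 & H2). exists t'. split; auto. cbn. rewrite in_app_iff. auto.
    + exists (Node X l r). cbn. auto.
Qed.

Lemma deriv_subtrees rs t : deriv rs t -> forall t', In t' (subtrees t) -> deriv rs t'.
Proof.
  induction t as [X b|X l IHl r IHr]; cbn [subtrees]; intros H t' [<-|H']; auto; [destruct H'|].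
  destruct H as (_ & Hl & Hr). apply in_app_iff in H'. destruct H'; auto.
Qed.

(** [D] lists one own phrase per nonterminal. Subtrees with equal roots are equal, so any subtree
    found for a nonterminal gives the right one. *)
Lemma few_phrases s rs t : deriv rs t ->
  exists D, length D = length rs /\ forall u, In u (phrases s t) -> In u D.
Proof.
  intros Ht.
  set (f := fun X => match find (fun t' => root t' =? X) (subtrees t) with
                     | Some t' => own_phrase s t' | None => [] end).
  exists (map f (seq 0 (length rs))). split; [now rewrite length_map, length_seq|].
  intros u Hu. destruct (phrases_own s t u Hu) as (t' & H1 & ->).
  pose proof (deriv_subtrees rs t Ht t' H1) as H2.
  apply in_map_iff. exists (root t'). split.
  - unfold f. destruct (find _ _) as [t2|] eqn:E.
    + apply find_some in E. destruct E as (E1 & E2). apply Nat.eqb_eq in E2.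
      f_equal. apply (deriv_unique rs); auto. now apply (deriv_subtrees rs t).
    + eapply find_none in E; [|exact H1]. cbn in E. rewrite Nat.eqb_refl in E. discriminate.
  - apply in_seq. pose proof (deriv_root_lt rs t' H2). lia.
Qed.

(* The three arrays describe the phrases [P] laid out from position [off] on. *)
Fixpoint lays (off : nat) (P : list (list bool)) (f : (nat -> nat) * (nat -> nat) * (nat -> nat)) : Prop :=
  match P with
  | [] => True
  | x :: P' =>
      let '(eo, so, ct) := f in
      let e := off + length x in
      eo off = e /\ so e = off /\ ct e = 1 /\ (forall q, off < q < e -> ct q = 0) /\ lays e P' f
  end.

(** Ends are indexed by the starts of phrases, starts and cuts by their ends; hence the opposite
    half-open intervals. *)
Definition agree (lo hi : nat) (f f' : (nat -> nat) * (nat -> nat) * (nat -> nat)) : Prop :=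
  let '(eo, so, ct) := f in let '(eo', so', ct') := f' in
  (forall i, lo <= i < hi -> eo' i = eo i) /\ (forall i, lo < i <= hi -> so' i = so i) /\
  (forall i, lo < i <= hi -> ct' i = ct i).

Lemma lays_agree off P f f' :
  Forall (fun u => 1 <= length u) P -> agree off (off + length (concat P)) f f' ->
  lays off P f -> lays off P f'.
Proof.
  destruct f as [[eo so] ct], f' as [[eo' so'] ct']. revert off.
  induction P as [|x P IH]; cbn [lays concat]; intros off HF (A1 & A2 & A3); auto.
  inversion HF as [|? ? Hx HP]; subst. rewrite length_app in *.
  intros (H1 & H2 & H3 & H4 & H5). repeat split.
  - rewrite A1 by lia. auto.
  - rewrite A2 by lia. auto.
  - rewrite A3 by lia. auto.
  - intros q Hq. rewrite A3 by lia. auto.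
  - apply IH; auto. repeat split; intros i Hi; [apply A1 | apply A2 | apply A3]; lia.
Qed.

(** At the junction [q], [so q] is the start of the last phrase of [P] and [eo q] the end of the
    first phrase of [Q]; the test in [mstep] compares the sum of their lengths with [s], exactly as
    [glue] does. The induction only moves the left border. *)
Lemma glue_lays s P Q off eo so ct :
  P <> [] -> Q <> [] -> Forall (fun u => 1 <= length u) P -> Forall (fun u => 1 <= length u) Q ->
  let q := off + length (concat P) in
  lays off P (eo, so, ct) -> lays q Q (eo, so, ct) ->
  off <= so q < q /\ q < eo q <= q + length (concat Q) /\
  lays off (glue s P Q) (mstep s (eo, so, ct) q).
Proof.
  intros HP HQ FP FQ. revert off. induction FP as [|x P Hx FP IH]; [contradiction|]. intros off q LP LQ.
  destruct P as [|y P].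
  - destruct Q as [|y Q]; [contradiction|]. inversion FQ as [|? ? Hy FQ']; subst.
    assert (Eq : q = off + length x) by (unfold q; cbn [concat]; rewrite app_nil_r; auto).
    cbn [lays] in LP, LQ. destruct LP as (P1 & P2 & P3 & P4 & _). rewrite <- Eq in *.
    destruct LQ as (Q1 & Q2 & Q3 & Q4 & Q5). split; [lia|].
    split; [cbn [concat]; rewrite length_app; lia|].
    unfold mstep. rewrite Q1, P2. cbn [glue].
    destruct (Nat.leb_spec (length x + length y) s), (Nat.ltb_spec (q + length y) (off + s + 1)); try lia.
    + cbn [lays]. rewrite length_app, Nat.add_assoc, <- Eq.
      rewrite update_same, update_same. split; [auto|]. split; [auto|].
      split; [rewrite update_other by lia; auto|]. split.
      { intros q' Hq'. unfold update. destruct (Nat.eqb_spec q' q); auto.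
        destruct (le_lt_dec q' q); [apply P4 | apply Q4]; lia. }
      eapply lays_agree; [exact FQ'| |exact Q5].
      repeat split; intros i Hi; apply update_other; lia.
    + cbn [lays]. rewrite <- Eq. repeat split; auto.
  - cbn [lays] in LP. destruct LP as (P1 & P2 & P3 & P4 & P5).
    assert (Eq : q = off + length x + length (concat (y :: P)))
      by (unfold q; cbn [concat]; rewrite !length_app; lia).
    rewrite Eq in *. destruct (IH ltac:(discriminate) (off + length x) P5 LQ) as (I1 & I2 & I3).
    split; [lia|]. split; [lia|]. rewrite glue_cons. unfold mstep in *.
    destruct (_ <? _); [|cbn [lays] in *; repeat split; auto; tauto].
    cbn [lays]. cbn [lays] in I3.
    rewrite !update_other by lia. repeat split; auto.
    intros q' Hq'. rewrite update_other by lia. auto.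
Qed.

Definition untouched (lo hi : nat) (f f' : (nat -> nat) * (nat -> nat) * (nat -> nat)) : Prop :=
  let '(eo, so, ct) := f in let '(eo', so', ct') := f' in
  (forall i, i < lo \/ hi <= i -> eo' i = eo i) /\ (forall i, i <= lo \/ hi < i -> so' i = so i) /\
  (forall i, i <= lo \/ hi <= i -> ct' i = ct i).

Definition letters (lo hi : nat) (f : (nat -> nat) * (nat -> nat) * (nat -> nat)) : Prop :=
  let '(eo, so, ct) := f in
  forall i, lo <= i < hi -> eo i = i + 1 /\ so (i + 1) = i /\ ct (i + 1) = 1.

Lemma phrases_nonnil s t : phrases s t <> [].
Proof.
  intros E. pose proof (phrases_concat s t) as H. rewrite E in H. cbn in H.
  pose proof (yield_pos t). rewrite <- H in *. cbn in *. lia.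
Qed.

(** The reversed preorder of the junctions treats the right subtree, the left subtree and the root
    junction in this order. Each subtree changes the arrays only between its own borders, so the
    phrases of the right one survive the work on the left one. *)
Lemma merge_tree s t : 1 <= s -> forall off f, letters off (off + length (yield t)) f ->
  let f' := fold_left (mstep s) (rev (junctions t off)) f in
  lays off (phrases s t) f' /\ untouched off (off + length (yield t)) f f'.
Proof.
  intros Hs.
  assert (F1 : forall t, Forall (fun u => 1 <= length u) (phrases s t)).
  { intros t'. eapply Forall_impl; [|apply phrases_length; auto]. cbn. tauto. }
  induction t as [X b|X l IHl r IHr]; intros off f HL.
  - destruct f as [[eo so] ct]. cbn in *. specialize (HL off ltac:(lia)). destruct HL as (H1 & H2 & H3).
    repeat split; auto; intros; lia.
  - cbn [junctions yield phrases] in *. rewrite length_app in *.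
    set (q := off + length (yield l)) in *.
    cbn [rev]. rewrite rev_app_distr, <- app_assoc, !fold_left_app. cbn [fold_left].
    pose proof (yield_pos l). pose proof (yield_pos r).
    destruct (IHr q f) as (R1 & R2).
    { destruct f as [[eo so] ct]. intros i Hi. apply HL. unfold q in Hi. lia. }
    set (f1 := fold_left (mstep s) (rev (junctions r q)) f) in *. clearbody f1.
    destruct (IHl off f1) as (L1 & L2).
    { destruct f as [[eo so] ct], f1 as [[eo1 so1] ct1]. destruct R2 as (A1 & A2 & A3).
      intros i Hi. fold q in Hi. rewrite A1, A2, A3 by lia. apply HL. unfold q in Hi. lia. }
    set (f2 := fold_left (mstep s) (rev (junctions l off)) f1) in *. clearbody f2. fold q in L2.
    assert (R3 : lays q (phrases s r) f2).
    { eapply lays_agree; [apply F1| |exact R1].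
      destruct f1 as [[eo1 so1] ct1], f2 as [[eo2 so2] ct2]. destruct L2 as (A1 & A2 & A3).
      repeat split; intros; [apply A1 | apply A2 | apply A3]; lia. }
    destruct f as [[eo so] ct], f1 as [[eo1 so1] ct1], f2 as [[eo2 so2] ct2].
    assert (E : off + length (concat (phrases s l)) = q) by (now rewrite phrases_concat).
    pose proof (glue_lays s (phrases s l) (phrases s r) off eo2 so2 ct2
      (phrases_nonnil s l) (phrases_nonnil s r) (F1 l) (F1 r)) as HG.
    cbv zeta in HG. rewrite E, phrases_concat in HG. destruct (HG L1 R3) as (G1 & G2 & G3).
    split; [exact G3|]. unfold mstep. destruct R2 as (A1 & A2 & A3), L2 as (B1 & B2 & B3).
    assert (Q : q = off + length (yield l)) by reflexivity. clearbody q.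
    destruct (_ <? _); repeat split; intros i Hi.
    all: rewrite ?update_other by lia.
    + rewrite B1, A1 by lia. reflexivity.
    + rewrite B2, A2 by lia. reflexivity.
    + rewrite B3, A3 by lia. reflexivity.
    + rewrite B1, A1 by lia. reflexivity.
    + rewrite B2, A2 by lia. reflexivity.
    + rewrite B3, A3 by lia. reflexivity.
Qed.

Lemma lays_next off P eo so ct p :
  Forall (fun u => 1 <= length u) P -> lays off P (eo, so, ct) ->
  off <= p < off + length (concat P) -> p = off \/ ct p <> 0 ->
  exists u, In u P /\ 1 <= length u /\ p + length u <= off + length (concat P) /\ ct (p + length u) = 1 /\
    (forall q, p < q < p + length u -> ct q = 0) /\
    firstn (length u) (skipn (p - off) (concat P)) = u.
Proof.
  intros HF. revert off. induction HF as [|x P Hx HF IH]; intros off HL Hp Hc; cbn [concat length] in *; [lia|].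
  rewrite length_app in *. cbn [lays] in HL. destruct HL as (H1 & H2 & H3 & H4 & H5).
  destruct (le_lt_dec (off + length x) p) as [Hpx|Hpx].
  - destruct (IH (off + length x) H5) as (u & U1 & U2 & U3 & U4 & U5 & U6); try lia.
    exists u. split; [cbn; auto|]. split; [auto|]. split; [lia|]. split; [auto|]. split; [auto|].
    rewrite skipn_app, skipn_all2 by lia. cbn [app].
    replace (p - off - length x) with (p - (off + length x)) by lia. exact U6.
  - assert (p = off) as ->.
    { destruct Hc as [|Hc]; auto. destruct (Nat.eq_dec p off); auto. rewrite H4 in Hc by lia. lia. }
    exists x. split; [cbn; auto|]. split; [auto|]. split; [lia|]. split; [auto|]. split; [auto|].
    rewrite Nat.sub_diag. cbn [skipn]. rewrite firstn_app, Nat.sub_diag, firstn_all. cbn. apply app_nil_r.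
Qed.

Lemma lays_cover s off P eo so ct p :
  Forall (fun u => 1 <= length u <= s) P -> lays off P (eo, so, ct) ->
  off <= p < off + length (concat P) ->
  exists e, p < e <= p + s /\ e <= off + length (concat P) /\ ct e = 1.
Proof.
  intros HF. revert off. induction HF as [|x P Hx HF IH]; intros off HL Hp; cbn [concat length] in *; [lia|].
  rewrite length_app in *. cbn [lays] in HL. destruct HL as (H1 & H2 & H3 & H4 & H5).
  destruct (le_lt_dec (off + length x) p) as [Hpx|Hpx].
  - destruct (IH (off + length x) H5) as (e & E1 & E2 & E3); try lia. exists e. repeat split; auto; lia.
  - exists (off + length x). repeat split; auto; lia.
Qed.

Lemma lays_last off P eo so ct : P <> [] -> lays off P (eo, so, ct) -> ct (off + length (concat P)) = 1.
Proof.
  revert off. induction P as [|x P IH]; intros off HP HL; [contradiction|].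
  cbn [lays concat] in *. rewrite length_app, Nat.add_assoc. destruct HL as (H1 & H2 & H3 & H4 & H5).
  destruct P as [|y P].
  - cbn. now rewrite Nat.add_0_r.
  - apply IH; auto. discriminate.
Qed.

(** Between the outer two of three cuts lie at least two whole consecutive phrases. *)
Lemma lays_spaced s off P eo so ct q1 q2 q3 :
  spaced s P -> Forall (fun u => 1 <= length u) P -> lays off P (eo, so, ct) ->
  off <= q1 -> q1 < q2 -> q2 < q3 -> q3 <= off + length (concat P) ->
  q1 = off \/ ct q1 <> 0 -> ct q2 <> 0 -> ct q3 <> 0 -> q1 + s < q3.
Proof.
  intros HS HF. revert off HS. induction HF as [|x P Hx HF IH];
    intros off HS HL Ha Hb Hc Hd C1 C2 C3; cbn [concat length] in *; [lia|].
  rewrite length_app in *. cbn [lays] in HL. destruct HL as (H1 & H2 & H3 & H4 & H5).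
  destruct (le_lt_dec (off + length x) q1) as [Hq|Hq].
  - apply (IH (off + length x)); auto; try lia. destruct P; cbn in *; tauto.
  - assert (q1 = off) as ->.
    { destruct C1 as [|C1]; auto. destruct (Nat.eq_dec q1 off); auto. rewrite H4 in C1 by lia. lia. }
    assert (off + length x <= q2) by (destruct (le_lt_dec (off + length x) q2); auto; rewrite H4 in C2 by lia; lia).
    destruct P as [|y P]; [cbn in *; lia|]. destruct HS as (HS & _).
    cbn [lays] in H5. destruct H5 as (K1 & K2 & K3 & K4 & _).
    destruct (le_lt_dec (off + length x + length y) q3); [lia|]. rewrite K4 in C3 by lia. lia.
Qed.

Section Partition.
Variables (rs : list rhs) (t : tree) (s n : nat) (EO SO CT : nat -> nat).
Hypothesis Ht : deriv rs t.
Hypothesis Hn : n = length (yield t).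
Hypothesis Hs : 1 <= s.
Hypothesis Hlay : lays 0 (phrases s t) (EO, SO, CT).

Let F1 : Forall (fun u => 1 <= length u) (phrases s t).
Proof. eapply Forall_impl; [|apply phrases_length; auto]. cbn. tauto. Qed.

Lemma part_last : CT n = 1.
Proof.
  rewrite Hn, <- (phrases_concat s t). apply (lays_last 0 _ EO SO CT); auto. apply phrases_nonnil.
Qed.

Lemma part_cover p : p < n -> exists e, p < e <= p + s /\ e <= n /\ CT e = 1.
Proof.
  intros Hp. rewrite Hn, <- (phrases_concat s t) in *.
  destruct (lays_cover s 0 (phrases s t) EO SO CT p) as (e & H); auto; [|lia|].
  - now apply phrases_length.
  - exists e. cbn in H. tauto.
Qed.

Lemma part_spaced q1 q2 q3 : q1 < q2 -> q2 < q3 -> q3 <= n ->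
  q1 = 0 \/ CT q1 <> 0 -> CT q2 <> 0 -> CT q3 <> 0 -> q1 + s < q3.
Proof.
  intros. rewrite Hn, <- (phrases_concat s t) in *.
  apply (lays_spaced s 0 (phrases s t) EO SO CT q1 q2 q3); auto; try lia. apply phrases_spaced.
Qed.

Lemma part_few : exists D, length D = length rs /\
  forall p, p < n -> p = 0 \/ CT p <> 0 -> exists u, In u D /\ 1 <= length u /\ p + length u <= n /\
    CT (p + length u) = 1 /\ (forall q, p < q < p + length u -> CT q = 0) /\
    firstn (length u) (skipn p (yield t)) = u.
Proof.
  destruct (few_phrases s rs t Ht) as (D & D1 & D2). exists D. split; [exact D1|].
  intros p Hp Hc. rewrite Hn, <- (phrases_concat s t) in *.
  destruct (lays_next 0 (phrases s t) EO SO CT p F1 Hlay) as (u & U1 & U2 & U3 & U4 & U5 & U6); auto; try lia.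
  rewrite Nat.sub_0_r in U6. exists u. repeat (split; [auto|]). exact U6.
Qed.
End Partition.

(** * Counting phrases and phrase types *)

Lemma filter_or_length {A} (f g h : A -> bool) l :
  (forall x, In x l -> h x = true -> f x = true \/ g x = true) ->
  length (filter h l) <= length (filter f l) + length (filter g l).
Proof.
  induction l as [|x l IH]; cbn; intros H; [lia|].
  specialize (IH (fun y Hy => H y (or_intror Hy))). specialize (H x (or_introl eq_refl)).
  destruct (h x), (f x), (g x); cbn; try lia.
Qed.

Lemma first_selected (c : nat -> bool) len lo k :
  S k <= length (filter c (seq lo len)) ->
  exists q, lo <= q < lo + len /\ c q = true /\ k <= length (filter c (seq (S q) (lo + len - S q))).
Proof.
  revert lo. induction len as [|len IH]; cbn [seq filter length]; intros lo H; [lia|].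
  destruct (c lo) eqn:E; cbn [length] in H.
  - exists lo. replace (lo + S len - S lo) with len by lia. repeat split; auto; lia.
  - destruct (IH (S lo) H) as (q & Q1 & Q2 & Q3). exists q.
    replace (lo + S len - S q) with (S lo + len - S q) by lia. repeat split; auto; lia.
Qed.

(** Of three selected positions the outer two are more than [s] apart, so [s + 1] consecutive
    positions contain at most two of them. *)
Lemma spaced_count (c : nat -> bool) s len lo :
  (forall q1 q2 q3, lo <= q1 -> q1 < q2 -> q2 < q3 -> q3 < lo + len ->
     c q1 = true -> c q2 = true -> c q3 = true -> q1 + s < q3) ->
  length (filter c (seq lo len)) <= 2 * (len / (s + 1) + 1).
Proof.
  revert lo. induction len as [len IH] using (well_founded_induction lt_wf). intros lo H.
  destruct (le_lt_dec len (s + 1)) as [Hl|Hl].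
  - destruct (le_lt_dec (length (filter c (seq lo len))) 2); [lia|]. exfalso.
    destruct (first_selected c len lo 2 l) as (q1 & A1 & A2 & A3).
    destruct (first_selected c _ _ 1 A3) as (q2 & B1 & B2 & B3).
    destruct (first_selected c _ _ 0 B3) as (q3 & C1 & C2 & _).
    specialize (H q1 q2 q3 ltac:(lia) ltac:(lia) ltac:(lia) ltac:(lia) A2 B2 C2). lia.
  - replace len with ((s + 1) + (len - (s + 1))) at 1 by lia. rewrite seq_app, filter_app, length_app.
    assert (E : len / (s + 1) = (len - (s + 1)) / (s + 1) + 1).
    { replace len with (len - (s + 1) + 1 * (s + 1)) at 1 by lia. apply Nat.div_add. lia. }
    specialize (IH (len - (s + 1)) ltac:(lia) (lo + (s + 1))).
    assert (H2 : length (filter c (seq lo (s + 1))) <= 2).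
    { destruct (le_lt_dec (length (filter c (seq lo (s + 1)))) 2); [lia|]. exfalso.
      destruct (first_selected c (s + 1) lo 2 l) as (q1 & A1 & A2 & A3).
      destruct (first_selected c _ _ 1 A3) as (q2 & B1 & B2 & B3).
      destruct (first_selected c _ _ 0 B3) as (q3 & C1 & C2 & _).
      specialize (H q1 q2 q3 ltac:(lia) ltac:(lia) ltac:(lia) ltac:(lia) A2 B2 C2). lia. }
    rewrite E. enough (length (filter c (seq (lo + (s + 1)) (len - (s + 1)))) <= 2 * ((len - (s + 1)) / (s + 1) + 1)) by lia.
    apply IH. intros. apply (H q1 q2 q3); auto; lia.
Qed.

Lemma near_multiple L a q : 1 <= L -> a mod L = 0 -> a <= q <= a + 2 * L ->
  q mod L = 0 \/ (q + 1) mod L = 0 -> In q [a; a + L - 1; a + L; a + 2 * L - 1; a + 2 * L].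
Proof.
  intros HL Ha Hq H.
  assert (Ea : a = L * (a / L)) by (pose proof (Nat.div_mod_eq a L); lia).
  destruct H as [H|H].
  - assert (Eq : q = L * (q / L)) by (pose proof (Nat.div_mod_eq q L); lia).
    set (j := a / L) in *. set (k := q / L) in *.
    assert (j <= k <= j + 2) by nia.
    assert (k = j \/ k = j + 1 \/ k = j + 2) as [E|[E|E]] by lia; rewrite E in Eq; cbn [In]; lia.
  - assert (Eq : q + 1 = L * ((q + 1) / L)) by (pose proof (Nat.div_mod_eq (q + 1) L); lia).
    set (j := a / L) in *. set (k := (q + 1) / L) in *.
    assert (Hj : L * j <= L * k - 1 <= L * j + 2 * L) by lia.
    (* For [L = 1] the candidates coincide in part and the quotient may also be [j + 3]; but then
       they cover the whole interval. *)
    destruct (Nat.eq_dec L 1) as [->|]; [cbn [In]; lia|].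
    assert (j + 1 <= k <= j + 2) by nia.
    assert (k = j + 1 \/ k = j + 2) as [E|E] by lia; rewrite E in Eq; cbn [In]; lia.
Qed.

Lemma NoDup_map_seq {A} (f : nat -> A) k :
  (forall U V, U < V -> V < k -> f V <> f U) -> NoDup (map f (seq 0 k)).
Proof.
  induction k as [|k IH]; intros H; [constructor|].
  rewrite seq_S, map_app. cbn [map Nat.add]. apply NoDup_app.
  - apply IH. intros. apply H; lia.
  - constructor; [intros []|constructor].
  - intros x Hx [<-|[]]. apply in_map_iff in Hx. destruct Hx as (U & E & HU). apply in_seq in HU.
    apply (H U k); auto; lia.
Qed.

(** * Prefix counts of a bit string *)

Definition ones (l : list bool) : nat := count_occ bool_dec l true.

Definition prefix_ones (B : list bool) (i : nat) : nat := ones (firstn i B).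

Lemma ones_app u v : ones (u ++ v) = ones u + ones v.
Proof. apply count_occ_app. Qed.

Lemma ones_le u : ones u <= length u.
Proof. apply count_occ_bound. Qed.

Lemma prefix_ones_sub B p x : prefix_ones B (p + x) = prefix_ones B p + ones (firstn x (skipn p B)).
Proof.
  unfold prefix_ones. rewrite <- ones_app. f_equal.
  rewrite <- (firstn_skipn p B) at 1. rewrite firstn_app, length_firstn, firstn_firstn.
  destruct (le_lt_dec p (length B)).
  - rewrite !Nat.min_r, Nat.min_l by lia. do 2 f_equal. lia.
  - rewrite !skipn_all2 by lia. rewrite !firstn_nil, !app_nil_r. rewrite !firstn_all2; auto; lia.
Qed.

Lemma prefix_ones_lip B i j : i <= j -> prefix_ones B i <= prefix_ones B j <= prefix_ones B i + (j - i).
Proof.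
  intros. replace j with (i + (j - i)) at 1 2 by lia. rewrite prefix_ones_sub.
  pose proof (ones_le (firstn (j - i) (skipn i B))). rewrite length_firstn in *. lia.
Qed.

Lemma prefix_ones_le B i : prefix_ones B i <= i.
Proof. unfold prefix_ones. pose proof (ones_le (firstn i B)). rewrite length_firstn in *. lia. Qed.

(** * The cuts of one level: phrases of the grammar and block boundaries *)

Section LevelCuts.
Variables (rs : list rhs) (t : tree) (B : list bool) (n L s : nat).
Variables (EO SO CT CT' ST NX : nat -> nat).
Let cut := is_cut CT'.
Hypothesis Ht : deriv rs t.
Hypothesis HB : yield t = B.
Hypothesis Hn : n = length B.
Hypothesis Hs : 1 <= s.
Hypothesis HsL : s <= L.
Hypothesis Hlay : lays 0 (phrases s t) (EO, SO, CT).
Hypothesis Hcut : forall i, 1 <= i <= n -> cut i =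
  negb (CT i =? 0) || (i mod L =? 0) || ((i + 1) mod L =? 0).
Hypothesis ST_cut : forall i, i <= n ->
  ST i <= i /\ cut (ST i) = true /\ forall q, ST i < q <= i -> cut q = false.
Hypothesis NX_cut : forall i, i < n ->
  i < NX i <= n /\ cut (NX i) = true /\ forall q, i < q < NX i -> cut q = false.

Definition extra (q : nat) : bool := (q mod L =? 0) || ((q + 1) mod L =? 0).

Let Hn' : n = length (yield t).
Proof. congruence. Qed.

Lemma cut_cases q : q <= n -> cut q = true -> (q = 0 \/ CT q <> 0) \/ extra q = true.
Proof.
  intros Hq Hc. destruct (Nat.eq_dec q 0); [tauto|]. rewrite Hcut in Hc by lia.
  rewrite <- orb_assoc in Hc. fold (extra q) in Hc. destruct (extra q); [tauto|].
  rewrite orb_false_r in Hc. left. right. intros E. rewrite E in Hc. discriminate.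
Qed.

Lemma cut_part q : q <= n -> CT q <> 0 -> cut q = true.
Proof.
  intros Hq Hc. destruct (Nat.eq_dec q 0) as [->|]; [reflexivity|]. rewrite Hcut by lia.
  destruct (Nat.eqb_spec (CT q) 0); [contradiction|reflexivity].
Qed.

Lemma cut_at_end : cut n = true.
Proof. apply cut_part; auto. rewrite (part_last t s n EO SO CT); auto. Qed.

Lemma cut_at_mod q : q <= n -> q mod L = 0 \/ (q + 1) mod L = 0 -> cut q = true.
Proof.
  intros Hq Hc. destruct (Nat.eq_dec q 0) as [->|]; [reflexivity|]. rewrite Hcut by lia.
  destruct Hc as [->| ->]; rewrite ?orb_true_r; reflexivity.
Qed.

(** A phrase of the grammar ends within [s] positions after [p], and the added cuts only bring the
    next cut closer. *)
Lemma cut_short p : p < n -> cut p = true -> NX p <= p + s.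
Proof.
  intros Hp _. destruct (part_cover t s n EO SO CT Hn' Hs Hlay p Hp) as (e & E1 & E2 & E3).
  destruct (NX_cut p Hp) as (N1 & N2 & N3).
  destruct (le_lt_dec (NX p) e); [lia|].
  rewrite <- (cut_part e) in * by lia. rewrite N3 in * by lia.
  pose proof (cut_part e E2 ltac:(lia)). rewrite N3 in H by lia. discriminate.
Qed.

(** Two cuts of the grammar in each stretch of [s + 1] positions, and the four block cuts
    [a + L - 1], [a + L], [a + 2 * L - 1] and [a + 2 * L]. *)
Definition phrase_bound : nat := 2 * (2 * L / (s + 1) + 1) + 4.

Lemma few_cuts a : a <= n -> a mod L = 0 -> ncut cut a (Nat.min n (a + 2 * L)) <= phrase_bound.
Proof.
  intros Ha Hm. unfold ncut. set (len := Nat.min n (a + 2 * L) - a).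
  assert (Hlen : len <= 2 * L) by lia.
  eapply Nat.le_trans; [apply (filter_or_length (fun q => negb (CT q =? 0)) extra)|].
  { intros q Hq Hc. apply in_seq in Hq. destruct (cut_cases q ltac:(lia) Hc) as [[->|H]|H]; auto; [lia|].
    left. destruct (Nat.eqb_spec (CT q) 0); [contradiction|auto]. }
  unfold phrase_bound. apply Nat.add_le_mono.
  - eapply Nat.le_trans; [apply (spaced_count _ s)|].
    + intros q1 q2 q3 H1 H2 H3 H4 C1 C2 C3.
      apply (part_spaced t s n EO SO CT Hn' Hs Hlay q1 q2 q3); auto; try lia.
      * right. intros E. rewrite E in C1. discriminate.
      * intros E. rewrite E in C2. discriminate.
      * intros E. rewrite E in C3. discriminate.
    + pose proof (Nat.Div0.div_le_mono len (2 * L) (s + 1) Hlen). lia.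
  - change 4 with (length [a + L - 1; a + L; a + 2 * L - 1; a + 2 * L]).
    apply NoDup_incl_length; [apply NoDup_filter, seq_NoDup|].
    intros q Hq. apply filter_In in Hq. destruct Hq as (Hq & He). apply in_seq in Hq.
    unfold extra in He. apply orb_true_iff in He. rewrite !Nat.eqb_eq in He.
    pose proof (near_multiple L a q ltac:(lia) Hm ltac:(lia) He) as HI. cbn [In] in *. lia.
Qed.

Variable P : nat -> nat.
Hypothesis HP : forall i, i <= n -> P i = prefix_ones B i.

Definition content (p : nat) : list bool := firstn (NX p - p) (skipn p B).

Lemma content_same p r : p < n -> r < n -> content p = content r -> same P NX p r.
Proof.
  intros Hp Hr E. unfold content in E.
  destruct (NX_cut p Hp) as (N1 & _). destruct (NX_cut r Hr) as (N2 & _).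
  assert (El : NX p - p = NX r - r).
  { apply (f_equal (@length _)) in E. rewrite !length_firstn, !length_skipn in E. lia. }
  split; [exact El|]. intros x Hx. rewrite !HP, !prefix_ones_sub by lia.
  assert (E' : firstn x (skipn p B) = firstn x (skipn r B)).
  { rewrite <- El in E. apply (f_equal (firstn x)) in E. rewrite !firstn_firstn in E.
    rewrite Nat.min_l in E by lia. exact E. }
  rewrite E'. lia.
Qed.

(** A phrase may start at one of four block cuts or end at one of four, in which case its start is
    the last cut before that end. Otherwise both of its ends are cuts of the grammar, with none in
    between, and its content is listed in [D]. These are the 8 types beyond the number of rules. *)
Lemma content_classes a D : a <= n -> a mod L = 0 ->
  (forall p, p < n -> p = 0 \/ CT p <> 0 -> exists u, In u D /\ 1 <= length u /\ p + length u <= n /\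
    CT (p + length u) = 1 /\ (forall q, p < q < p + length u -> CT q = 0) /\
    firstn (length u) (skipn p (yield t)) = u) ->
  forall p, a <= p < Nat.min n (a + 2 * L) -> cut p = true ->
  In (content p) (D ++ map content [a; a + L - 1; a + L; a + 2 * L - 1] ++
    map (fun e => content (ST (e - 1))) [a + L - 1; a + L; a + 2 * L - 1; a + 2 * L]).
Proof.
  intros Ha Hm HD p Hp Hc. destruct (NX_cut p ltac:(lia)) as (N1 & N2 & N3).
  assert (Hlim : NX p <= Nat.min n (a + 2 * L)).
  { destruct (le_lt_dec (NX p) (Nat.min n (a + 2 * L))); auto.
    assert (cut (Nat.min n (a + 2 * L)) = true).
    { destruct (le_lt_dec n (a + 2 * L)); [rewrite Nat.min_l by lia; apply cut_at_end|].
      rewrite Nat.min_r by lia. apply cut_at_mod; [lia|]. left. rewrite Nat.Div0.mod_add. exact Hm. }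
    rewrite N3 in H by lia. discriminate. }
  destruct (extra p) eqn:Ep.
  { unfold extra in Ep. apply orb_true_iff in Ep. rewrite !Nat.eqb_eq in Ep.
    pose proof (near_multiple L a p ltac:(lia) Hm ltac:(lia) Ep) as HI.
    apply in_or_app. right. apply in_or_app. left. apply in_map. cbn [In] in *. lia. }
  destruct (extra (NX p)) eqn:Ee.
  { unfold extra in Ee. apply orb_true_iff in Ee. rewrite !Nat.eqb_eq in Ee.
    pose proof (near_multiple L a (NX p) ltac:(lia) Hm ltac:(lia) Ee) as HI.
    apply in_or_app. right. apply in_or_app. right. apply in_map_iff. exists (NX p).
    split; [|cbn [In] in *; lia]. f_equal.
    destruct (ST_cut (NX p - 1) ltac:(lia)) as (S1 & S2 & S3).
    destruct (lt_eq_lt_dec (ST (NX p - 1)) p) as [[H|H]|H]; auto.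
    - rewrite S3 in Hc by lia. discriminate.
    - rewrite N3 in S2 by lia. discriminate. }
  destruct (cut_cases p ltac:(lia) Hc) as [Hp0|]; [|congruence].
  destruct (cut_cases (NX p) ltac:(lia) N2) as [[|He]|]; [lia| |congruence].
  destruct (HD p ltac:(lia) Hp0) as (u & U1 & U2 & U3 & U4 & U5 & U6).
  assert (E : NX p = p + length u).
  { destruct (lt_eq_lt_dec (NX p) (p + length u)) as [[H|H]|H]; auto.
    - rewrite U5 in He by lia. lia.
    - pose proof (cut_part (p + length u) U3 ltac:(lia)) as H2. rewrite N3 in H2 by lia. discriminate. }
  apply in_or_app. left. unfold content. replace (NX p - p) with (length u) by lia.
  rewrite <- HB, U6. exact U1.
Qed.

Lemma few_types a k RP : a <= n -> a mod L = 0 ->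
  (forall U, U < k -> a <= RP U < Nat.min n (a + 2 * L) /\ cut (RP U) = true) ->
  (forall U V, U < V -> V < k -> ~ same P NX (RP V) (RP U)) ->
  k <= Nat.min (phrase_bound + 1) (length rs + 8).
Proof.
  intros Ha Hm H1 H2. apply Nat.min_glb.
  - assert (N : NoDup (map RP (seq 0 k))).
    { apply NoDup_map_seq. intros U V HU HV E. apply (H2 U V HU HV). rewrite E. split; auto. }
    assert (I : incl (map RP (seq 0 k))
      (a :: filter cut (seq (S a) (Nat.min n (a + 2 * L) - a)))).
    { intros q Hq. apply in_map_iff in Hq. destruct Hq as (U & <- & HU). apply in_seq in HU.
      destruct (H1 U ltac:(lia)) as (B1 & B2). destruct (Nat.eq_dec (RP U) a) as [->|]; [left; auto|].
      right. apply filter_In. split; auto. apply in_seq. lia. }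
    pose proof (NoDup_incl_length N I) as HL. rewrite length_map, length_seq in HL. cbn [length] in HL.
    pose proof (few_cuts a Ha Hm). unfold ncut in H. lia.
  - destruct (part_few rs t s n EO SO CT Ht Hn' Hs Hlay) as (D & D1 & D2).
    assert (N : NoDup (map (fun U => content (RP U)) (seq 0 k))).
    { apply NoDup_map_seq. intros U V HU HV E. apply (H2 U V HU HV).
      destruct (H1 U ltac:(lia)), (H1 V HV). apply content_same; auto; lia. }
    assert (I : incl (map (fun U => content (RP U)) (seq 0 k))
      (D ++ map content [a; a + L - 1; a + L; a + 2 * L - 1] ++
       map (fun e => content (ST (e - 1))) [a + L - 1; a + L; a + 2 * L - 1; a + 2 * L])).
    { intros c Hc. apply in_map_iff in Hc. destruct Hc as (U & <- & HU). apply in_seq in HU.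
      destruct (H1 U ltac:(lia)) as (B1 & B2). apply content_classes; auto. }
    pose proof (NoDup_incl_length N I) as HL. rewrite !length_app, !length_map, length_seq in HL.
    cbn [length] in HL. lia.
Qed.
End LevelCuts.

(** * Time of one level *)

(* What [choose_s] achieves: [s] is about [(L / g) ^ (2 / 3)]. *)
Definition good_step (g L s : nat) : Prop :=
  1 <= s /\ s <= L /\ (s = 1 \/ s * s * s * (g * g) <= L * L) /\
  L * L < (s + 1) * (s + 1) * (s + 1) * (g * g).

Definition type_bound (g L s : nat) : nat := Nat.min (phrase_bound L s + 1) (g + 8).

(** The constant is 4 + 7: twice the quotient contributes [4 * L], and the additive 7 is absorbed by
    [s <= L]. *)
Lemma phrase_bound_le L s : 1 <= s -> s <= L -> (phrase_bound L s + 1) * s <= 11 * L.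
Proof.
  intros H1 H2. unfold phrase_bound. pose proof (Nat.Div0.mul_div_le (2 * L) (s + 1)).
  set (d := 2 * L / (s + 1)) in *. clearbody d. lia.
Qed.

(** For [s > 1], the choice of [s] and [g + 8 <= 9 * g] give the second bound; for [s = 1] the
    number of phrases gives it. It makes the tables of a block cost no more than O(L^2 / s), like
    the slides. *)
Lemma type_bound_le g L s : 1 <= g -> good_step g L s ->
  type_bound g L s * s <= 11 * L /\
  type_bound g L s * type_bound g L s * (s * s * s) <= 121 * (L * L).
Proof.
  intros Hg (H1 & H2 & H3 & _). pose proof (phrase_bound_le L s H1 H2) as HP.
  unfold type_bound. set (k := Nat.min _ _).
  assert (K1 : k <= phrase_bound L s + 1) by lia. assert (K2 : k <= 9 * g) by lia. clearbody k.
  assert (K3 : k * s <= 11 * L).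
  { eapply Nat.le_trans; [|exact HP]. apply Nat.mul_le_mono_r. exact K1. }
  split; [exact K3|]. destruct H3 as [->|H3].
  - rewrite Nat.mul_1_r in *. assert (k * k <= (11 * L) * (11 * L)) by (apply Nat.mul_le_mono; auto). lia.
  - assert (k * k <= 9 * g * (9 * g)) by (apply Nat.mul_le_mono; auto).
    assert (k * k * (s * s * s) <= 9 * g * (9 * g) * (s * s * s)) by (apply Nat.mul_le_mono_r; auto). lia.
Qed.

Lemma node_time_le g L s : 1 <= g -> good_step g L s ->
  node_time L s (type_bound g L s) (phrase_bound L s) * s <= 600 * 1000 * (L * L).
Proof.
  intros Hg Hgs. destruct (type_bound_le g L s Hg Hgs) as (T1 & T2).
  destruct Hgs as (H1 & H2 & _). pose proof (phrase_bound_le L s H1 H2) as HP. unfold node_time.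
  set (K := type_bound g L s) in *. set (R := phrase_bound L s) in *. clearbody K R.
  assert (A1 : (R + 1) * ((K + 1) * (150 * (s + 2))) * s <= 11 * L * (450 * (12 * L))).
  { replace ((R + 1) * ((K + 1) * (150 * (s + 2))) * s) with ((R + 1) * s * (150 * ((K + 1) * (s + 2)))) by ring.
    apply Nat.mul_le_mono; [exact HP|].
    assert ((K + 1) * (s + 2) <= (K + 1) * (3 * s)) by (apply Nat.mul_le_mono_l; lia). lia. }
  assert (A2 : K * K * ((s + 1) * (s + 1)) * s <= 484 * (L * L)).
  { assert ((s + 1) * (s + 1) <= 2 * s * (2 * s)) by (apply Nat.mul_le_mono; lia).
    assert (K * K * ((s + 1) * (s + 1)) * s <= K * K * (2 * s * (2 * s)) * s)
      by (apply Nat.mul_le_mono_r, Nat.mul_le_mono_l; auto).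
    lia. }
  assert (A3 : L * (R + 1) * s <= L * (11 * L)).
  { rewrite <- Nat.mul_assoc. apply Nat.mul_le_mono_l. exact HP. }
  assert (A4 : L <= L * L) by (apply le_mul_pos; lia).
  rewrite !Nat.mul_add_distr_r. lia.
Qed.

Definition level_time (g n L s : nat) : nat :=
  60 * (s + 1) + 1000 * (n + 1) + 20 +
  (n / L + 1) * (node_time L s (type_bound g L s) (phrase_bound L s) + 10).

(** There are at most [3 * n / L] blocks of cost O(L^2 / s). The bounds are multiplied by [s] to
    avoid rounding. *)
Lemma level_time_le g n L s : 1 <= n -> L <= 2 * n -> 1 <= g -> good_step g L s ->
  level_time g n L s * s <= 2 * 1000 * 1000 * (n * L).
Proof.
  intros Hn HL Hg Hgs. pose proof (node_time_le g L s Hg Hgs) as HN.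
  destruct Hgs as (H1 & H2 & _). unfold level_time.
  set (N := node_time _ _ _ _) in *. clearbody N.
  pose proof (Nat.Div0.mul_div_le n L) as Hd. set (d := n / L) in *. clearbody d.
  assert (A1 : (N + 10) * s <= 601 * 1000 * (L * L)) by (assert (L <= L * L) by (apply le_mul_pos; lia); lia).
  assert (A2 : (d + 1) * ((N + 10) * s) <= (d + 1) * (601 * 1000 * (L * L))) by (apply Nat.mul_le_mono_l; auto).
  assert (A3 : (d + 1) * L <= 3 * n) by lia.
  assert (A4 : (d + 1) * L * L <= 3 * n * L) by (apply Nat.mul_le_mono_r; auto).
  assert (A5 : (60 * (s + 1) + 1000 * (n + 1) + 20) * s <= (2300 * n) * L) by (apply Nat.mul_le_mono; lia).
  rewrite Nat.mul_add_distr_r.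
  replace ((d + 1) * (N + 10) * s) with ((d + 1) * ((N + 10) * s)) by ring.
  assert (E : forall c, (d + 1) * (c * (L * L)) = c * ((d + 1) * L * L)) by (intros; ring).
  rewrite E in A2.
  lia.
Qed.

(** * All levels *)

Section Levels.
Variables (w AB n b g NB : nat) (B : list bool) (rs : list rhs) (t : tree) (P J : nat -> nat).
Hypothesis Hw : 5 <= w.
Hypothesis HAB : 64 * (AB + g + 1) < 2 ^ w.
Hypothesis Hn : n = length B.
Hypothesis Hn1 : 1 <= n.
Hypothesis Hg : g = length rs.
Hypothesis Hg1 : 1 <= g.
Hypothesis AB1 : 16 * (n + 1) <= AB.
Hypothesis AB2 : (8 * n + 7) * (8 * n + 7) * (4 * n + 1) < AB.
Hypothesis AB3 : 8 * (g * g) <= AB.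
Hypothesis Ht : deriv rs t.
Hypothesis HB : yield t = B.
Hypothesis HP : forall i, i <= n -> P i = prefix_ones B i.
Hypothesis HJ : map J (seq 0 (n - 1)) = junctions t 0.
Hypothesis Hb1 : 1 <= b.
Hypothesis Hbn : b <= n.
Hypothesis H2b : 2 ^ b <= 2 * n.
Hypothesis Hnb : n < 2 ^ b.
Hypothesis HNB : NB = n / b + 1.

Lemma P_lip i j : i <= j -> j <= n -> P i <= P j <= P i + (j - i).
Proof. intros. rewrite !HP by lia. now apply prefix_ones_lip. Qed.

Lemma P_le i : i <= n -> P i <= n.
Proof. intros. rewrite HP by lia. pose proof (prefix_ones_le B i). lia. Qed.

Lemma junctions_range t' off q : In q (junctions t' off) -> off < q < off + length (yield t').
Proof.
  revert off. induction t' as [|X l IHl r IHr]; cbn [junctions yield]; intros off H; [destruct H|].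
  rewrite length_app. pose proof (yield_pos l). pose proof (yield_pos r).
  destruct H as [<-|H]; [lia|]. apply in_app_iff in H. destruct H as [H|H].
  - specialize (IHl _ H). lia.
  - specialize (IHr _ H). lia.
Qed.

Lemma J_range k : k < n - 1 -> 1 <= J k < n.
Proof.
  intros Hk. assert (HI : In (J k) (junctions t 0)).
  { rewrite <- HJ. apply in_map. apply in_seq. lia. }
  apply junctions_range in HI. rewrite HB in HI. lia.
Qed.

Lemma map_seq_rev (f : nat -> nat) m :
  map (fun x => f (m - 1 - x)) (seq 0 m) = rev (map f (seq 0 m)).
Proof.
  apply (nth_ext _ _ 0 0); [now rewrite length_rev, !length_map|].
  intros i Hi. rewrite length_map, length_seq in Hi.
  rewrite rev_nth by (rewrite length_map, length_seq; auto). rewrite length_map, length_seq.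
  rewrite (nth_indep _ _ (f (m - 1 - 0))) by (rewrite length_map, length_seq; auto).
  rewrite (map_nth (fun x => f (m - 1 - x))), seq_nth by auto.
  rewrite (nth_indep _ 0 (f 0)) by (rewrite length_map, length_seq; lia).
  rewrite map_nth, seq_nth by lia. f_equal. lia.
Qed.

Lemma level_ok t0 s0 L hb MS MB XS XB :
  regs s0 0 = g -> arr g (mem s0) aP = P -> arr g (mem s0) aJ = J ->
  arr g (mem s0) aMS = MS -> arr g (mem s0) aMB = MB -> arr g (mem s0) aXS = XS ->
  arr g (mem s0) aXB = XB ->
  regs s0 2 = n -> regs s0 7 = b -> regs s0 10 = L -> regs s0 11 = hb ->
  1 <= L -> L <= 2 * n -> (exists c, 1 <= c /\ L = b * c) -> hb + n / b < AB ->
  run w level t0 s0 (fun t' s' => exists s, good_step g L s /\ t' <= t0 + level_time g n L s /\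
    exists MS' MB' XS' XB', arr g (mem s') aMS = MS' /\ arr g (mem s') aMB = MB' /\
      arr g (mem s') aXS = XS' /\ arr g (mem s') aXB = XB' /\
      (forall c, c < hb -> MS' c = MS c /\ MB' c = MB c /\ XS' c = XS c /\ XB' c = XB c) /\
      encoded n b L P hb MS' MB' XS' XB').
Proof.
  intros R0 AP AJ AMS AMB AXS AXB R2 R7 R10 R11 HL1 HL2 Hdvd Hhb. unfold level.
  assert (HLL : 8 * (L * L) <= AB).
  { assert (L * L <= 2 * n * (2 * n)) by (apply Nat.mul_le_mono; auto). nia. }
  apply run_seq. eapply (run_conseq w g Hw).
  { eapply choose_s_ok with (AB := AB) (n := n) (L := L) (base := g); eauto. }
  cbn beta. intros t1 s1 (s & S12 & Hs1 & HsL & Ht1 & Hs3 & Hs4) F1.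
  assert (Hgs : good_step g L s) by (repeat split; auto).
  apply run_seq. eapply (run_conseq w g Hw).
  { eapply init_cuts_ok with (AB := AB) (n := n) (L := L) (base := g); eauto; lookup_reg. }
  cbn beta. intros t2 s2 (Ht2 & EO & SO & CT & AEO & ASO & ACT & HI) F2.
  assert (HW : wf_phrases n (EO, SO, CT)).
  { repeat split; intros i Hi; [destruct (HI i Hi); lia| |];
      destruct (HI (i - 1) ltac:(lia)) as (_ & I2 & I3); replace (i - 1 + 1) with i in * by lia; lia. }
  apply run_seq. eapply (run_conseq w g Hw).
  { eapply merge_ok with (AB := AB) (n := n) (L := L) (base := g) (s := s) (J := J);
      try exact HW; try lookup_reg; try lookup_arr; auto. exact J_range. }
  cbn beta. intros t3 s3 (Ht3 & HM & HW3) F3.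
  assert (Hlay : lays 0 (phrases s t) (arr g (mem s3) aEO, arr g (mem s3) aSO, arr g (mem s3) aCT)).
  { rewrite HM. replace (map (fun x => J (n - 2 - x)) (seq 0 (n - 1))) with (rev (junctions t 0)).
    - apply merge_tree; auto. rewrite HB, <- Hn. intros i Hi. apply HI. lia.
    - rewrite <- HJ, <- map_seq_rev. apply map_ext. intros x. f_equal. lia. }
  set (EO' := arr g (mem s3) aEO) in *. set (SO' := arr g (mem s3) aSO) in *.
  destruct HW3 as (_ & _ & HW3).
  apply run_seq. eapply (run_conseq w g Hw).
  { eapply forward_ok with (AB := AB) (n := n) (L := L) (base := g) (CT := arr g (mem s3) aCT);
      auto; lookup_reg. }
  cbn beta. intros t4 s4 (Ht4 & CT' & ST & ACT' & AST & HC1 & HST) F4.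
  assert (HC : forall i, 1 <= i <= n -> is_cut CT' i =
     negb (arr g (mem s3) aCT i =? 0) || (i mod L =? 0) || ((i + 1) mod L =? 0))
    by (intros i Hi; apply HC1; auto).
  assert (Hcn : is_cut CT' n = true) by (eapply cut_at_end; eauto).
  apply run_seq. eapply (run_conseq w g Hw).
  { eapply backward_ok with (AB := AB) (n := n) (L := L) (base := g) (CT := CT');
      auto; lookup_reg. }
  cbn beta. intros t5 s5 (Ht5 & NX & ANX & HNX) F5.
  set (KK := type_bound g L s).
  assert (HKK : KK * KK * (2 * s + 1) < AB).
  { eapply Nat.le_lt_trans; [|exact AB2].
    assert (phrase_bound L s <= 4 * L + 6).
    { unfold phrase_bound. pose proof (div_le_self (2 * L) (s + 1)). lia. }
    assert (KK <= 8 * n + 7) by (unfold KK, type_bound; lia).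
    apply Nat.mul_le_mono; [apply Nat.mul_le_mono; auto|lia]. }
  apply run_seq. eapply (run_conseq w g Hw).
  { eapply nodes_ok with (AB := AB) (n := n) (L := L) (base := g) (s := s) (P := P) (ST := ST) (NX := NX)
      (cut := is_cut CT') (KK := KK) (PH := phrase_bound L s);
      auto using P_lip, P_le; try lookup_reg; try lookup_arr.
    - intros i Hi Hci. eapply cut_short; eauto.
    - intros q Hq. eapply cut_at_mod; eauto.
    - intros a Ha Hm. eapply few_cuts; eauto.
    - intros a k RP Ha Hm X1 X2. unfold KK, type_bound. rewrite Hg. eapply few_types; eauto. }
  cbn beta. intros t6 s6 (Ht6 & MN & MX & AMN & AMX & Hcov) F6.
  eapply (run_conseq w g Hw).
  { eapply encode_ok with (AB := AB) (n := n) (b := b) (L := L) (base := g) (s := s) (KK := KK) (P := P)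
      (hb := hb) (MN := MN) (MX := MX) (MS := MS) (MB := MB) (XS := XS) (XB := XB);
      auto using P_lip, P_le; try lookup_reg; try lookup_arr; lia. }
  cbn beta. intros t7 s7 (Ht7 & HR) F7.
  exists s. split; [exact Hgs|]. split; [|exact HR]. unfold level_time. fold KK. lia.
Qed.

Variable tau : nat -> R.
Hypothesis Htau : forall L s T, 1 <= L -> L <= 2 * n -> good_step g L s ->
  T * s <= 2 * 1000 * 1000 * (n * L) -> (INR T + 20 <= tau (2 * L) - tau L)%R.

(** A level of block length [L] is charged to [tau (2 * L) - tau L], so the sum over the doublings
    telescopes and no geometric series is summed. The number of levels is bounded through
    [2 ^ h <= 2 * n < 2 ^ S b]. *)
Lemma levels_ok t0 s0 :
  regs s0 0 = g -> arr g (mem s0) aP = P -> arr g (mem s0) aJ = J ->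
  regs s0 2 = n -> regs s0 7 = b -> regs s0 9 = NB ->
  (b + 2) * NB <= AB ->
  run w levels t0 s0 (fun t' s' => exists H MS MB XS XB,
    b * 2 ^ H <= 2 * n < b * 2 ^ S H /\ H <= b /\
    (INR t' <= INR t0 + 20 + (tau (b * 2 ^ S H) - tau b))%R /\
    regs s' 10 = b * 2 ^ S H /\ regs s' 11 = S H * NB /\
    arr g (mem s') aMS = MS /\ arr g (mem s') aMB = MB /\ arr g (mem s') aXS = XS /\
    arr g (mem s') aXB = XB /\
    forall h, h <= H -> encoded n b (b * 2 ^ h) P (h * NB) MS MB XS XB).
Proof.
  intros R0 AP AJ R2 R7 R9 HNB2. unfold levels. steps.
  apply (run_while_ltb w g Hw) with (k0 := S b)
    (I := fun k t s' => exists h, h + k = S b /\ regs s' 10 = b * 2 ^ h /\ regs s' 11 = h * NB /\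
       b * 2 ^ h <= 4 * n /\ (h = 0 \/ b * 2 ^ (h - 1) <= 2 * n) /\
       (INR t <= INR t0 + 4 + (tau (b * 2 ^ h) - tau b))%R /\
       forall h', h' < h -> encoded n b (b * 2 ^ h') P (h' * NB) (arr g (mem s') aMS)
         (arr g (mem s') aMB) (arr g (mem s') aXS) (arr g (mem s') aXB)).
  { exists 0. change (2 ^ 0) with 1. rewrite Nat.mul_1_r. simp_state.
    split; [lia|]. split; [auto|]. split; [lia|]. split; [lia|]. split; [auto|].
    split; [|intros; lia]. rewrite !plus_INR. cbn [INR]. lra. }
  intros k t1 s1 Hf (h & Hk & R10 & R11 & Hh4 & Hh2 & Htm & HE).
  assert (P2 : 2 ^ S h = 2 * 2 ^ h) by apply Nat.pow_succ_r'. pose proof (pow2_pos h) as P3.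
  assert (Hh1 : b * 2 ^ h <= 2 * n -> h <= b).
  { intros Hle. destruct (le_lt_dec h b) as [|Hc]; auto. exfalso.
    assert (2 ^ S b <= 2 ^ h) by (apply Nat.pow_le_mono_r; lia). rewrite Nat.pow_succ_r' in *.
    assert (1 * 2 ^ h <= b * 2 ^ h) by (apply Nat.mul_le_mono_r; auto). lia. }
  do 2 eexists. split; [ev|]. split; [ev|]. cbn [cost]. split.
  - intros Hlt. specialize (Hh1 ltac:(lia)).
    assert (Hhb : h * NB + n / b < AB).
    { assert (h * NB <= b * NB) by (apply Nat.mul_le_mono_r; auto). lia. }
    apply run_seq. eapply (run_conseq w g Hw).
    { eapply level_ok with (L := b * 2 ^ h) (hb := h * NB); auto; try lookup_reg; try lookup_arr; try lia.
      exists (2 ^ h). auto. }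
    cbn beta. intros t2 s2 (s & Hgs & Ht2 & MS' & MB' & XS' & XB' & E1 & E2 & E3 & E4 & Hold & Hnew) F2.
    steps. exists (b - h). split; [lia|]. exists (S h). simp_state.
    assert (Hnext : 2 * (b * 2 ^ h) = b * 2 ^ S h) by (rewrite P2; ring).
    split; [lia|]. split; [exact Hnext|]. split; [lia|]. split; [lia|].
    split; [right; replace (S h - 1) with h by lia; lia|]. split.
    + assert (Hx : 1 <= b * 2 ^ h) by (assert (1 * 1 <= b * 2 ^ h) by (apply Nat.mul_le_mono; auto); lia).
      pose proof (level_time_le g n (b * 2 ^ h) s Hn1 ltac:(lia) Hg1 Hgs) as HT.
      pose proof (Htau (b * 2 ^ h) s (level_time g n (b * 2 ^ h) s) Hx ltac:(lia) Hgs HT) as HT2.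
      rewrite Hnext in HT2. set (T := level_time _ _ _ _) in *.
      apply Rle_trans with (INR (t1 + T + 20)); [apply le_INR; lia|].
      rewrite !plus_INR. replace (INR 20) with 20%R by (cbn; lra). lra.
    + intros h' Hh'. cbn [mem setr]. rewrite E1, E2, E3, E4.
      destruct (Nat.eq_dec h' h) as [->|]; [exact Hnew|].
      intros y Hy. assert (Hyb : y / b <= n / b) by (apply Nat.Div0.div_le_mono; lia).
      assert (Hc : h' * NB + y / b < h * NB).
      { assert ((h' + 1) * NB <= h * NB) by (apply Nat.mul_le_mono_r; lia). lia. }
      destruct (Hold _ Hc) as (O1 & O2 & O3 & O4). unfold decode. rewrite O1, O2, O3, O4.
      apply (HE h' ltac:(lia) y Hy).
  - intros Hge. destruct h as [|h].
    { change (2 ^ 0) with 1 in Hge. lia. }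
    clear Hh1. destruct Hh2 as [|Hh2]; [lia|]. replace (S h - 1) with h in Hh2 by lia.
    exists h. do 4 eexists. split; [lia|]. split.
    { destruct (le_lt_dec h b) as [|Hc]; auto. exfalso.
      assert (2 ^ S b <= 2 ^ h) by (apply Nat.pow_le_mono_r; lia). rewrite (Nat.pow_succ_r' 2 b) in *.
      assert (1 * 2 ^ h <= b * 2 ^ h) by (apply Nat.mul_le_mono_r; auto). lia. }
    split.
    { apply Rle_trans with (INR (t1 + 16)); [apply le_INR; lia|].
      rewrite plus_INR. replace (INR 16) with 16%R by (cbn; lra). lra. }
    split; [auto|]. split; [auto|]. do 4 (split; [reflexivity|]).
    intros h' Hh'. apply HE. lia.
Qed.
End Levels.

(** * Expanding the grammar *)

Fixpoint size (t : tree) : nat :=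
  match t with Leaf _ _ => 1 | Node _ l r => S (size l + size r) end.

Lemma size_yield t : size t + 1 = 2 * length (yield t).
Proof. induction t; cbn; rewrite ?length_app; lia. Qed.

Lemma junctions_length t off : length (junctions t off) + 1 = length (yield t).
Proof.
  revert off. induction t as [|X l IHl r IHr]; intros off; cbn; auto.
  rewrite !length_app. specialize (IHl off). specialize (IHr (off + length (yield l))). lia.
Qed.

Lemma nth_flat_encode rs X r j : nth_error rs X = Some r -> j < 3 ->
  nth (3 * X + j) (flat_map encode_rhs rs) 0 = nth j (encode_rhs r) 0.
Proof.
  revert X. induction rs as [|r' rs IH]; intros [|X] H Hj; cbn [nth_error flat_map] in *; try discriminate.
  - injection H as ->. rewrite app_nth1; [f_equal; lia|]. destruct r; cbn; lia.
  - rewrite app_nth2; destruct r'; cbn [encode_rhs length]; try lia;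
      replace (3 * S X + j - 3) with (3 * X + j) by lia; auto.
Qed.

(* Right siblings still to be expanded, each with its preorder number. *)
Fixpoint pending_yield (stk : list (tree * nat)) : list bool :=
  match stk with [] => [] | (t, _) :: r => yield t ++ pending_yield r end.

Fixpoint pending_junctions (stk : list (tree * nat)) (off : nat) : list nat :=
  match stk with
  | [] => []
  | (t, _) :: r => junctions t off ++ pending_junctions r (off + length (yield t))
  end.

(** [off] is the position at which the topmost pending tree will begin. Being a right sibling, it
    begins exactly at the junction whose number is stored with it. *)
Fixpoint stack_ok (rs : list rhs) (F : list nat) (kj off : nat) (stk : list (tree * nat)) (Z K : nat -> nat) : Prop :=
  match stk with
  | [] => True
  | (t, k) :: r =>
      Z (length r) = root t /\ K (length r) = k /\ deriv rs t /\ k < kj /\ nth k F 0 = off /\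
      stack_ok rs F kj (off + length (yield t)) r Z K
  end.

Lemma stack_ok_ext rs F kj kj' off stk Z K Z' K' :
  kj <= kj' -> (forall i, i < length stk -> Z' i = Z i /\ K' i = K i) ->
  stack_ok rs F kj off stk Z K -> stack_ok rs F kj' off stk Z' K'.
Proof.
  intros Hk. revert off. induction stk as [|[t k] r IH]; intros off HE; cbn [stack_ok]; auto.
  destruct (HE (length r) (Nat.lt_succ_diag_r _)) as (-> & ->).
  intros (H1 & H2 & H3 & H4 & H5 & H6). repeat split; auto; try lia.
  apply IH; auto. intros i Hi. apply HE. cbn. lia.
Qed.

Fixpoint sizes (stk : list (tree * nat)) : nat :=
  match stk with [] => 0 | (t, _) :: r => size t + sizes r end.

Lemma pending_length stk : length stk <= length (pending_yield stk).
Proof.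
  induction stk as [|[t k] r IH]; cbn; auto. rewrite length_app. pose proof (yield_pos t). lia.
Qed.

Section Traverse.
Variables (w AB n g : nat) (B : list bool) (rs : list rhs) (t : tree).
Hypothesis Hw : 5 <= w.
Hypothesis HAB : 64 * (AB + g + 1) < 2 ^ w.
Hypothesis Hn : n = length B.
Hypothesis Hn1 : 1 <= n.
Hypothesis Hg : g = length rs.
Hypothesis AB1 : 16 * (n + 1) <= AB.
Hypothesis Ht : deriv rs t.
Hypothesis HB : yield t = B.

Definition rules_at (m : nat -> nat) : Prop :=
  forall a, a < 3 * g -> m a = nth a (flat_map encode_rhs rs) 0.

Lemma rules_at_seta s k x v : rules_at (mem s) -> rules_at (mem (seta g s k x v)).
Proof. intros H a Ha. rewrite mem_seta_low by lia. auto. Qed.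

Lemma rule_words m X r : rules_at m -> nth_error rs X = Some r ->
  X < g /\ m (3 * X) = nth 0 (encode_rhs r) 0 /\ m (3 * X + 1) = nth 1 (encode_rhs r) 0 /\
  m (3 * X + 2) = nth 2 (encode_rhs r) 0.
Proof.
  intros Hm HX. assert (X < length rs) by (apply nth_error_Some; congruence).
  repeat split; try lia; rewrite Hm by lia; [rewrite <- (Nat.add_0_r (3 * X))| |]; apply nth_flat_encode; auto.
Qed.

(** Junctions are numbered on the way down, so those below [kj] have numbers already; their cells
    are correct except for those whose right sibling is still on the stack. *)
Definition visiting (F : list nat) (k tm : nat) (s : state) : Prop :=
  exists tc stk i kj, regs s 6 = 1 /\
    regs s 3 = root tc /\ regs s 2 = i /\ regs s 4 = kj /\ regs s 5 = length stk /\
    k = size tc + sizes stk /\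
    deriv rs tc /\ rules_at (mem s) /\
    i + length (yield tc ++ pending_yield stk) = n /\ skipn i B = yield tc ++ pending_yield stk /\
    (forall j, j <= i -> arr g (mem s) aP j = prefix_ones B j) /\
    skipn kj F = junctions tc i ++ pending_junctions stk (i + length (yield tc)) /\ kj <= length F /\
    stack_ok rs F kj (i + length (yield tc)) stk (arr g (mem s) aZ) (arr g (mem s) aK) /\
    (forall j, j < kj -> ~ In j (map snd stk) -> arr g (mem s) aJ j = nth j F 0).

Definition visited (F : list nat) (s : state) : Prop :=
  regs s 6 = 0 /\ regs s 2 = n /\
  (forall j, j <= n -> arr g (mem s) aP j = prefix_ones B j) /\
  (forall j, j < length F -> arr g (mem s) aJ j = nth j F 0).

(** Each round visits one node of the derivation tree, which has [2 * n - 1] nodes. *)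
Lemma traverse_ok t0 s0 :
  regs s0 0 = g -> regs s0 1 = root t -> regs s0 2 = 0 -> regs s0 4 = 0 -> regs s0 5 = 0 ->
  rules_at (mem s0) -> arr g (mem s0) aP 0 = 0 ->
  run w traverse t0 s0 (fun t' s' => t' <= t0 + 300 * n /\ regs s' 2 = n /\
    exists P J, arr g (mem s') aP = P /\ arr g (mem s') aJ = J /\
      (forall i, i <= n -> P i = prefix_ones B i) /\ map J (seq 0 (n - 1)) = junctions t 0).
Proof.
  intros R0 R1 R2 R4 R5 Hrules HP0. set (F := junctions t 0).
  assert (HF : length F + 1 = n) by (unfold F; rewrite junctions_length, HB; auto).
  unfold traverse. steps.
  apply (run_while_ltb w g Hw) with (k0 := size t)
    (I := fun k tm s => tm + 90 * k <= t0 + 20 + 180 * n /\ (visiting F k tm s \/ k = 0 /\ visited F s)).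
  { pose proof (size_yield t) as HS. rewrite HB in HS. split; [lia|]. left.
    exists t, [], 0, 0. simp_state. cbn [mem setr pending_yield pending_junctions stack_ok sizes].
    rewrite !app_nil_r, HB. split; [auto|]. split; [auto|]. split; [auto|]. split; [auto|]. split; [auto|].
    split; [lia|]. split; [auto|]. split; [auto|]. split; [lia|]. split; [reflexivity|].
    split. { intros j Hj. replace j with 0 by lia. rewrite HP0. reflexivity. }
    split; [reflexivity|]. split; [lia|]. split; [exact I|]. intros; lia. }
  intros k tm s1 Hf (Htm & [HV|(-> & V1 & V2 & V3 & V4)]).
  2: { do 2 eexists. split; [ev|]. split; [ev|]. cbn [cost]. split; [intros; lia|]. intros _.
    split; [lia|]. split; [auto|]. do 2 eexists. do 2 (split; [reflexivity|]). split; [exact V3|].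
    apply (nth_ext _ _ 0 0); [rewrite length_map, length_seq; fold F; lia|].
    intros j Hj. rewrite length_map, length_seq in Hj.
    rewrite (nth_indep _ 0 (arr g (mem s1) 1 0)) by (rewrite length_map, length_seq; auto).
    rewrite map_nth, seq_nth by auto. apply V4. lia. }
  destruct HV as (tc & stk & i & kj & R6 & S3 & S2 & S4 & S5 & Hk & Htc & Hrl & Hlen & Hskip & HP & HJ & Hkj & HS & HJd).
  pose proof (yield_pos tc) as Hy. pose proof (pending_length stk) as Hpl. rewrite length_app in Hlen.
  pose proof (size_yield tc) as Hsz.
  do 2 eexists. split; [ev|]. split; [ev|]. cbn [cost]. split; [|lia]. intros _.
  destruct tc as [X b|X l r].
  - cbn [deriv root yield size length] in *. destruct (rule_words (mem s1) X _ Hrl Htc) as (HX & M0 & M1 & M2).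
    cbn [encode_rhs nth] in M0, M1, M2.
    assert (HP1 : arr g (mem s1) aP i + Nat.b2n b = prefix_ones B (i + 1)).
    { rewrite HP, prefix_ones_sub, Hskip by lia. cbn [app firstn]. destruct b; cbn; lia. }
    pose proof (prefix_ones_le B (i + 1)).
    assert (Hb : Nat.b2n b <= 1) by (destruct b; cbn; lia).
    eapply run_if_ltb; [exact Hw|ev|ev|intros; lia|intros _]. cbn [cost].
    step; try lia. step; try lia. rewrite HP1.
    assert (HPn : forall j, j <= i + 1 -> update (arr g (mem s1) aP) (i + 1) (prefix_ones B (i + 1)) j = prefix_ones B j).
    { intros j Hj. destruct (Nat.eq_dec j (i + 1)) as [->|]; [apply update_same|].
      rewrite update_other by auto. apply HP. lia. }
    destruct stk as [|[t2 k2] stk].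
    + cbn [length pending_yield] in *. step; try lia. steps.
      exists 0. split; [cbn in Hk; lia|]. split; [lia|]. right. split; [auto|].
      unfold visited. simp_state. simp_arr.
      split; [auto|]. split; [lia|]. split; [intros j Hj; apply HPn; lia|].
      intros j Hj. apply HJd; [|intros []].
      cbn [junctions pending_junctions app] in HJ.
      apply (f_equal (@length _)) in HJ. rewrite length_skipn in HJ. cbn in HJ. lia.
    + cbn [length pending_yield stack_ok map snd sizes] in *.
      destruct HS as (Z1 & K1 & D1 & K2 & N1 & HS). rewrite length_app in *.
      pose proof (yield_pos t2).
      assert (Hk2 : k2 <= AB) by lia.
      step; try lia. steps; replace (S (length stk) - 1) with (length stk) in * by lia; rewrite ?K1; [lia|].
      exists (size t2 + sizes stk). split; [lia|].
      split; [lia|]. left.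
      exists t2, stk, (i + 1), kj. simp_state. simp_arr. rewrite length_app.
      split; [auto|]. split; [exact Z1|]. split; [auto|]. split; [auto|]. split; [auto|]. split; [auto|].
      split; [auto|]. split; [do 2 apply rules_at_seta; exact Hrl|].
      split; [lia|]. split.
      { rewrite Nat.add_1_r. change (S i) with (1 + i). rewrite <- skipn_skipn, Hskip. reflexivity. }
      split; [exact HPn|]. split; [exact HJ|]. split; [auto|]. split; [exact HS|].
      intros j Hj Hin. destruct (Nat.eq_dec j k2) as [->|].
      * rewrite update_same. auto.
      * rewrite update_other by auto. apply HJd; auto. intros [E|E]; auto.
  - cbn [deriv root yield size length] in *. destruct Htc as (HX & Dl & Dr).
    destruct (rule_words (mem s1) X _ Hrl HX) as (HXg & M0 & M1 & M2).
    cbn [encode_rhs nth] in M0, M1, M2. rewrite length_app in *.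
    pose proof (yield_pos l). pose proof (yield_pos r).
    eapply run_if_ltb; [exact Hw|ev|ev|intros _|intros; lia]. cbn [cost].
    assert (Hkn : kj < length F).
    { cbn [junctions] in HJ. apply (f_equal (@length _)) in HJ. rewrite length_skipn in HJ. cbn in HJ. lia. }
    assert (Hll : root l < g /\ root r < g) by (rewrite Hg; split; apply deriv_root_lt; auto).
    steps.
    exists (size l + sizes ((r, kj) :: stk)). split; [cbn [sizes]; lia|].
    split; [cbn [sizes]; lia|]. left.
    exists l, ((r, kj) :: stk), i, (kj + 1). simp_state. simp_arr.
    assert (HJ' : skipn kj F = (i + length (yield l)) :: junctions l i ++
       junctions r (i + length (yield l)) ++ pending_junctions stk (i + length (yield l) + length (yield r))).
    { rewrite HJ. cbn [junctions app]. rewrite <- app_assoc, Nat.add_assoc. reflexivity. }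
    split; [auto|]. split; [auto|]. split; [auto|]. split; [auto|]. split; [cbn; lia|]. split; [auto|].
    split; [auto|]. split; [do 2 apply rules_at_seta; exact Hrl|].
    cbn [pending_yield pending_junctions stack_ok map snd length].
    split; [rewrite !length_app; lia|]. split; [rewrite Hskip, app_assoc; reflexivity|].
    split; [auto|]. split.
    { rewrite Nat.add_1_r. change (S kj) with (1 + kj). rewrite <- skipn_skipn, HJ'. reflexivity. }
    split; [lia|]. split.
    { rewrite !update_same. split; [auto|]. split; [auto|]. split; [auto|]. split; [lia|]. split.
      - rewrite <- (Nat.add_0_r kj), <- nth_skipn, HJ'. reflexivity.
      - rewrite <- Nat.add_assoc. eapply stack_ok_ext; [|  |exact HS]; [lia|].
        intros j Hj. rewrite !update_other by lia. auto. }
    intros j Hj Hin. apply HJd; [|intros E; apply Hin; cbn; auto].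
    destruct (Nat.eq_dec j kj) as [->|]; [|lia]. exfalso. apply Hin. cbn. auto.
Qed.
End Traverse.

(** * Tables and the structure for short windows *)

Section Structure.
Variables (n : nat) (P : nat -> nat) (b NB : nat).

Definition pop_table (T : nat -> nat) : Prop := forall x, x < 2 ^ b -> T x = popn b x.

Definition low_table (T : nat -> nat) : Prop :=
  forall x, 0 < x -> x < 2 ^ b -> exists y, x = 2 ^ T x * (2 * y + 1).

Lemma popn_le k x : popn k x <= k.
Proof.
  revert x. induction k as [|k IH]; intros x; cbn [popn]; [lia|].
  specialize (IH (x / 2)). pose proof (Nat.mod_upper_bound x 2). lia.
Qed.

(* [v] encodes the least nonempty superblock from [lo] on as its number plus
   one, and as 0 if there is none. *)
Definition first_from (ne : nat -> Prop) (lo v : nat) : Prop :=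
  (v = 0 /\ forall S, lo <= S -> ~ ne S) \/
  (exists S, v = Datatypes.S S /\ lo <= S /\ ne S /\ forall S', lo <= S' -> S' < S -> ~ ne S').

(** The room reserved for one [m] in each array: a count is at most [m < b], and
    [S * (m + 1) <= 2 * (n / b)], since the number of superblocks shrinks as the number of counts
    grows. *)
Definition stride : nat := 2 * NB + b + 2.

Definition cell (m S c : nat) : nat := m * stride + c + S * (m + 1).

Definition superblocks (m : nat) : nat := n / m / b.

Definition nonempty (BM : nat -> nat) (m c S : nat) : Prop :=
  S <= superblocks m /\ BM (cell m S c) <> 0.

(* The structure for the windows of length [m] starting at [i0] or later. *)
Definition small_ok (BM NS HD : nat -> nat) (m i0 : nat) : Prop :=
  (forall c S k, c <= m -> S <= superblocks m -> k < b ->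
     (Nat.testbit (BM (cell m S c)) k = true <->
      exists i, i0 <= i /\ i + m <= n /\ i / m = S * b + k /\ P (i + m) - P i = c)) /\
  (forall c S, c <= m -> S <= superblocks m -> BM (cell m S c) < 2 ^ b) /\
  (forall c, c <= m -> first_from (nonempty BM m c) 0 (HD (m * stride + c))) /\
  (forall c S, c <= m -> nonempty BM m c S ->
     first_from (nonempty BM m c) (Datatypes.S S) (NS (cell m S c))).

Lemma cell_inj m S c S' c' : c <= m -> c' <= m -> cell m S c = cell m S' c' -> S = S' /\ c = c'.
Proof.
  unfold cell. intros Hc Hc' E.
  destruct (Nat.div_mod_unique (m + 1) S S' c c') as [E1 E2]; lia.
Qed.

Lemma head_bound m c : c <= m -> m < b -> m * stride <= m * stride + c < (m + 1) * stride.
Proof. intros. unfold stride. rewrite Nat.mul_add_distr_r, Nat.mul_1_l. lia. Qed.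

Lemma first_from_ext ne ne' lo v : (forall S, lo <= S -> ne S <-> ne' S) -> first_from ne lo v -> first_from ne' lo v.
Proof.
  intros H [(H1 & H2)|(S & H1 & H2 & H3 & H4)].
  - left. split; auto. intros S HS. rewrite <- H by auto. auto.
  - right. exists S. repeat split; auto; [now apply H|]. intros S' HS1 HS2. rewrite <- H by auto. auto.
Qed.

Lemma lor_pow2_lt a r k : a < 2 ^ k -> r < k -> Nat.lor a (2 ^ r) < 2 ^ k.
Proof.
  intros Ha Hr. assert (Hnz : Nat.lor a (2 ^ r) <> 0).
  { intros E. apply Nat.lor_eq_0_iff in E. pose proof (Nat.pow_nonzero 2 r). lia. }
  apply Nat.log2_lt_pow2; [lia|]. rewrite Nat.log2_lor, Nat.log2_pow2 by lia.
  destruct (Nat.eq_dec a 0) as [->|]; [change (Nat.log2 0) with 0; lia|].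
  assert (Nat.log2 a < k) by (apply Nat.log2_lt_pow2; lia). lia.
Qed.

Lemma nonempty_window BM NS HD m i0 c S : small_ok BM NS HD m i0 -> c <= m -> nonempty BM m c S ->
  exists i, i0 <= i /\ i + m <= n /\ i / m / b = S /\ P (i + m) - P i = c.
Proof.
  intros (H1 & H2 & _) Hc (HS & HN). specialize (H2 c S Hc HS).
  set (v := BM (cell m S c)) in *.
  assert (Hk : Nat.log2 v < b) by (apply Nat.log2_lt_pow2; lia).
  destruct (proj1 (H1 c S (Nat.log2 v) Hc HS Hk) (Nat.bit_log2 v HN)) as (i & I1 & I2 & I3 & I4).
  exists i. split; [auto|]. split; [auto|]. split; [|auto].
  symmetry. apply (Nat.div_unique _ _ _ (Nat.log2 v)); lia.
Qed.

Lemma small_ok_start BM NS HD m :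
  (forall x, m * stride <= x -> BM x = 0 /\ HD x = 0) -> small_ok BM NS HD m (n + 1 - m).
Proof.
  intros Hz. assert (HB : forall c S, BM (cell m S c) = 0) by (intros; apply Hz; unfold cell; lia).
  assert (HN : forall c S, ~ nonempty BM m c S) by (intros c S (_ & X); apply X, HB).
  split; [|split; [|split]].
  - intros c S k _ _ _. rewrite HB, Nat.bits_0. split; [discriminate|]. intros (i & I1 & I2 & _). lia.
  - intros. rewrite HB. pose proof (pow2_pos b). lia.
  - intros c Hc. left. split; [|auto]. apply Hz. lia.
  - intros c S Hc H. now apply HN in H.
Qed.

Hypothesis Hb1 : 1 <= b.

Lemma popn_half x : x < 2 ^ b -> popn b x = x mod 2 + popn b (x / 2).
Proof.
  intros Hx. destruct b as [|k]; [lia|]. rewrite (popn_S k (x / 2)); [reflexivity|].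
  rewrite Nat.pow_succ_r' in Hx. apply Nat.Div0.div_lt_upper_bound. lia.
Qed.

Hypothesis HNB : NB = n / b + 1.

(** Exchanging the divisions by [m] and [b] gives [S * m <= n / b], and [m + 1 <= 2 * m]. *)
Lemma cell_bound m S c : 1 <= m -> m < b -> c <= m -> S <= superblocks m ->
  m * stride <= cell m S c < (m + 1) * stride.
Proof.
  intros Hm1 Hm2 Hc HS. unfold cell.
  assert (H : S * m <= n / b).
  { unfold superblocks in HS. rewrite Nat.Div0.div_div, Nat.mul_comm, <- Nat.Div0.div_div in HS.
    pose proof (Nat.Div0.mul_div_le (n / b) m).
    assert (m * S <= m * (n / b / m)) by (apply Nat.mul_le_mono_l; auto). lia. }
  assert (S * (m + 1) <= 2 * (n / b)) by (rewrite Nat.mul_add_distr_l; nia).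
  unfold stride. rewrite Nat.mul_add_distr_r, Nat.mul_1_l. lia.
Qed.

Lemma small_ok_ext BM NS HD BM' NS' HD' m i0 : 1 <= m -> m < b ->
  (forall x, m * stride <= x < (m + 1) * stride -> BM' x = BM x /\ NS' x = NS x /\ HD' x = HD x) ->
  small_ok BM NS HD m i0 -> small_ok BM' NS' HD' m i0.
Proof.
  intros Hm1 Hm2 HE (H1 & H2 & H3 & H4).
  assert (EB : forall c S, c <= m -> S <= superblocks m -> BM' (cell m S c) = BM (cell m S c))
    by (intros; apply HE, cell_bound; auto).
  assert (EN : forall c S, c <= m -> nonempty BM m c S <-> nonempty BM' m c S).
  { intros c S Hc. unfold nonempty. split; intros (X1 & X2); split; auto; [rewrite EB|rewrite <- EB]; auto. }
  split; [|split; [|split]].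
  - intros c S k Hc HS Hk. rewrite EB by auto. auto.
  - intros c S Hc HS. rewrite EB by auto. auto.
  - intros c Hc. destruct (HE (m * stride + c) (head_bound m c Hc Hm2)) as (_ & _ & ->).
    eapply first_from_ext; [|exact (H3 c Hc)]. intros; apply EN; auto.
  - intros c S Hc HN. apply EN in HN; auto.
    destruct (HE (cell m S c) (cell_bound m S c Hm1 Hm2 Hc (proj1 HN))) as (_ & -> & _).
    eapply first_from_ext; [|exact (H4 c S Hc HN)]. intros; apply EN; auto.
Qed.

Hypothesis P_lip : forall i j, i <= j -> j <= n -> P i <= P j <= P i + (j - i).

Lemma small_ok_step BM NS HD NS' HD' m i :
  1 <= m -> m < b -> i + m <= n -> small_ok BM NS HD m (S i) ->
  let c := P (i + m) - P i in
  let S := i / m / b in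
  let x := cell m S c in
  let h := m * stride + c in
  (BM x = 0 -> NS' = update NS x (HD h) /\ HD' = update HD h (S + 1)) ->
  (BM x <> 0 -> NS' = NS /\ HD' = HD) ->
  small_ok (update BM x (Nat.lor (BM x) (2 ^ (i / m mod b)))) NS' HD' m i.
Proof.
  intros Hm1 Hm2 Hi (H1 & H2 & H3 & H4) c S x h Hz Hnz.
  set (r := i / m mod b). set (v := Nat.lor (BM x) (2 ^ r)).
  assert (Hr : r < b) by (apply Nat.mod_upper_bound; lia).
  assert (Hc : c <= m) by (unfold c; pose proof (P_lip i (i + m) ltac:(lia) Hi); lia).
  assert (HS : S <= superblocks m)
    by (unfold S, superblocks; apply Nat.Div0.div_le_mono, Nat.Div0.div_le_mono; lia).
  assert (Hk : i / m = S * b + r) by (unfold S, r; pose proof (Nat.div_mod_eq (i / m) b); lia).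
  assert (Hv : v <> 0).
  { intros E. apply Nat.lor_eq_0_iff in E. pose proof (Nat.pow_nonzero 2 r). lia. }
  assert (Hne : forall c' S', c' <= m ->
     nonempty (update BM x v) m c' S' <-> nonempty BM m c' S' \/ (c' = c /\ S' = S)).
  { intros c' S' Hc'. unfold nonempty. destruct (Nat.eq_dec (cell m S' c') x) as [E|E].
    - destruct (cell_inj m S' c' S c Hc' Hc E) as (-> & ->). fold x. rewrite update_same. tauto.
    - rewrite update_other by auto. split; [tauto|]. intros [|(-> & ->)]; [auto|contradiction]. }
  (* Windows are added from right to left, so [S] is the least superblock so far. *)
  assert (Hleast : forall S', nonempty BM m c S' -> S <= S').
  { intros S' HN. destruct (nonempty_window BM NS HD m (Datatypes.S i) c S' (conj H1 (conj H2 (conj H3 H4))) Hc HN)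
      as (i' & I1 & _ & <- & _).
    apply Nat.Div0.div_le_mono, Nat.Div0.div_le_mono. lia. }
  assert (HL : (forall c', c' <= m -> first_from (nonempty (update BM x v) m c') 0 (HD' (m * stride + c'))) /\
    (forall c' S', c' <= m -> nonempty (update BM x v) m c' S' ->
      first_from (nonempty (update BM x v) m c') (Datatypes.S S') (NS' (cell m S' c')))).
  { destruct (Nat.eq_dec (BM x) 0) as [E|E].
    - destruct (Hz E) as (-> & ->).
      assert (HSnew : ~ nonempty BM m c S) by (intros (_ & X); auto).
      split.
      + intros c' Hc'. destruct (Nat.eq_dec c' c) as [->|Hcc].
        * fold h. rewrite update_same. right. exists S. split; [lia|]. split; [lia|].
          split; [apply Hne; auto|]. intros S' _ HS' HN. apply Hne in HN; auto.
          destruct HN as [HN|(_ & ->)]; [|lia]. apply Hleast in HN. lia.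
        * rewrite update_other by (unfold h; lia). eapply first_from_ext; [|exact (H3 c' Hc')].
          intros S' _. rewrite (Hne c' S' Hc'). tauto.
      + intros c' S' Hc' HN. apply Hne in HN; auto.
        destruct (Nat.eq_dec (cell m S' c') x) as [Ex|Ex].
        * destruct (cell_inj m S' c' S c Hc' Hc Ex) as (-> & ->). rewrite Ex, update_same.
          eapply first_from_ext; [intros S' HS'; symmetry; apply Hne; auto|].
          unfold h. destruct (H3 c Hc) as [(E1 & E2)|(S' & E1 & E2 & E3 & E4)].
          -- left. split; auto. intros S' HS' [HN'|(_ & ->)]; [apply (E2 S'); auto; lia | lia].
          -- right. exists S'. pose proof (Hleast S' E3) as Hls.
             assert (S <> S') by (intros ->; auto).
             split; [auto|]. split; [lia|]. split; [auto|].
             intros S2 B1 B2 [HN'|(_ & ->)]; [apply (E4 S2); auto; lia | lia].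
        * rewrite update_other by auto. destruct HN as [HN|(-> & ->)]; [|contradiction].
          eapply first_from_ext; [|exact (H4 c' S' Hc' HN)].
          intros S2 HS2. rewrite (Hne c' S2 Hc'). split; [auto|]. intros [|(-> & ->)]; auto.
          apply Hleast in HN. lia.
    - destruct (Hnz E) as (-> & ->).
      assert (Hsame : forall c' S', c' <= m -> nonempty BM m c' S' <-> nonempty (update BM x v) m c' S').
      { intros c' S' Hc'. rewrite (Hne c' S' Hc'). split; [auto|]. intros [|(-> & ->)]; auto. split; auto. }
      split.
      + intros c' Hc'. eapply first_from_ext; [|exact (H3 c' Hc')]. intros; apply Hsame; auto.
      + intros c' S' Hc' HN. apply Hsame in HN; auto.
        eapply first_from_ext; [|exact (H4 c' S' Hc' HN)]. intros; apply Hsame; auto. }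
  split; [|split; [|exact HL]].
  - intros c' S' k Hc' HS' Hkb. destruct (Nat.eq_dec (cell m S' c') x) as [E|E].
    + destruct (cell_inj m S' c' S c Hc' Hc E) as (-> & ->). fold x. rewrite update_same. unfold v.
      rewrite Nat.lor_spec, orb_true_iff, Nat.pow2_bits_eqb, Nat.eqb_eq.
      pose proof (H1 c S k Hc HS Hkb) as HB. fold x in HB. rewrite HB. split.
      * intros [(i' & I1 & I2 & I3 & I4)|<-]; [exists i'; repeat split; auto; lia|].
        exists i. auto.
      * intros (i' & I1 & I2 & I3 & I4). destruct (Nat.eq_dec i' i) as [->|]; [right; lia|].
        left. exists i'. repeat split; auto; lia.
    + rewrite update_other by auto. rewrite (H1 c' S' k Hc' HS' Hkb). split.
      * intros (i' & I1 & I2 & I3 & I4). exists i'. repeat split; auto; lia.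
      * intros (i' & I1 & I2 & I3 & I4). destruct (Nat.eq_dec i' i) as [->|]; [|exists i'; repeat split; auto; lia].
        exfalso. apply E. unfold x. fold c in I4. subst c'. f_equal.
        unfold S. apply (Nat.div_unique _ _ _ k); lia.
  - intros c' S' Hc' HS'. destruct (Nat.eq_dec (cell m S' c') x) as [E|E].
    + rewrite E, update_same. apply lor_pow2_lt; auto. apply H2; auto.
    + rewrite update_other by auto. auto.
Qed.

End Structure.

(** * Running the programs for tables, short windows and output *)

Section Small.
Variables (w AB n g : nat) (P : nat -> nat).
Hypothesis Hw : 5 <= w.
Hypothesis HAB : 64 * (AB + g + 1) < 2 ^ w.
Hypothesis Hn1 : 1 <= n.
Hypothesis AB1 : 16 * (n + 1) <= AB.
Hypothesis P_lip : forall i j, i <= j -> j <= n -> P i <= P j <= P i + (j - i).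
Hypothesis P_le : forall i, i <= n -> P i <= n.

Lemma find_b_ok t0 s0 :
  regs s0 0 = g -> regs s0 2 = n ->
  run w find_b t0 s0 (fun t' s' => t' <= t0 + 40 * (n + 1) /\ exists b, b = bitlen n /\
    1 <= b /\ b <= n /\ n < 2 ^ b /\ 2 ^ b <= 2 * n /\
    regs s' 7 = b /\ regs s' 8 = 2 ^ b /\ regs s' 9 = n / b + 1).
Proof.
  intros R0 R2. unfold find_b. steps. apply run_seq.
  (* [b <= 2 ^ (b - 1) <= n] is carried along to obtain [b <= n] at the exit. *)
  apply (run_while_ltb w g Hw) with (k0 := n)
    (I := fun k t s => exists b, b + k = n + 1 /\ 1 <= b /\ b <= 2 ^ (b - 1) /\ 2 ^ (b - 1) <= n /\
       regs s 7 = b /\ regs s 8 = 2 ^ b /\ t <= t0 + 4 + 20 * b).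
  { exists 1. simp_state. change (2 ^ (1 - 1)) with 1. change (2 ^ 1) with 2. repeat split; lia. }
  intros k t1 s1 Hf (b & Hk & H1 & H2 & H3 & R7 & R8 & Ht).
  assert (P2 : 2 ^ b = 2 * 2 ^ (b - 1)) by (rewrite <- Nat.pow_succ_r'; f_equal; lia).
  do 2 eexists. split; [ev|]. split; [ev|]. cbn [cost]. split.
  - intros Hlt. steps. exists (k - 1).
    assert (b + 1 <= 2 ^ b) by lia.
    split; [lia|]. exists (b + 1). simp_state. replace (b + 1 - 1) with b by lia.
    rewrite Nat.pow_add_r. change (2 ^ 1) with 2. repeat split; lia.
  - intros Hge. pose proof (div_le_self n b). steps. split; [lia|]. exists b. split.
    { unfold bitlen. assert (E : Nat.log2 n = b - 1); [|lia].
      apply Nat.log2_unique; [lia|]. replace (S (b - 1)) with b by lia. lia. }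
    split; [lia|]. split; [lia|]. split; [lia|]. split; [lia|].
    split; [lookup_reg|]. split; [lookup_reg|]. lookup_reg.
Qed.

Variables (b NB : nat).
Hypothesis Hb1 : 1 <= b.
Hypothesis Hbn : b <= n.
Hypothesis Hnb : n < 2 ^ b.
Hypothesis H2b : 2 ^ b <= 2 * n.
Hypothesis HNB : NB = n / b + 1.

Lemma tables_ok t0 s0 :
  regs s0 0 = g -> regs s0 8 = 2 ^ b -> arr g (mem s0) aPOP 0 = 0 ->
  run w tables t0 s0 (fun t' s' => t' <= t0 + 200 * (n + 1) /\
    exists POP LOW, arr g (mem s') aPOP = POP /\ arr g (mem s') aLOW = LOW /\
      pop_table b POP /\ low_table b LOW).
Proof.
  intros R0 R8 HP0. unfold tables.
  eapply (run_for w g Hw) with (lo := 1) (hi := 2 ^ b) (c := 80)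
    (I := fun y s' => (forall x, x < y -> arr g (mem s') aPOP x = popn b x) /\
       (forall x, 0 < x -> x < y -> arr g (mem s') aLOW x <= x /\
         exists z, x = 2 ^ arr g (mem s') aLOW x * (2 * z + 1)));
    auto; try ev; try lia.
  { split; [|intros; lia]. intros x Hx. replace x with 0 by lia. cbn [mem setr]. rewrite HP0, popn_0. auto. }
  { intros. ev. }
  - intros y t1 s1 Hy1 Hy2 Hf R13 (I1 & I2).
    pose proof (Nat.div_mod_eq y 2) as E. pose proof (Nat.mod_upper_bound y 2 ltac:(lia)) as Em.
    assert (Hy : y / 2 < y) by lia.
    pose proof (I1 (y / 2) Hy) as Ep. pose proof (popn_le b (y / 2)).
    pose proof (popn_half b Hb1 y Hy2) as Eh.
    assert (HP : forall x, x < S y -> update (arr g (mem s1) aPOP) y (popn b y) x = popn b x).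
    { intros x Hx. destruct (Nat.eq_dec x y) as [->|]; [apply update_same|].
      rewrite update_other by auto. apply I1. lia. }
    assert (HL : forall v, v <= y -> (exists z, y = 2 ^ v * (2 * z + 1)) ->
      forall x, 0 < x -> x < S y -> update (arr g (mem s1) aLOW) y v x <= x /\
        exists z, x = 2 ^ update (arr g (mem s1) aLOW) y v x * (2 * z + 1)).
    { intros v Hv Hz x Hx1 Hx2. destruct (Nat.eq_dec x y) as [->|]; [rewrite update_same; auto|].
      rewrite update_other by auto. apply I2; lia. }
    assert (Ev : arr g (mem s1) 4 (y / 2) + y mod 2 = popn b y) by lia.
    step; try lia. rewrite Ev.
    destruct (Nat.eq_dec (y mod 2) 0) as [Hz|Hz].
    + destruct (I2 (y / 2) ltac:(lia) Hy) as (L1 & z & Ez).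
      step; try contradiction; try lia. steps. split; [lia|]. simp_arr. split; [exact HP|].
      apply HL; [lia|]. exists z. rewrite Nat.add_1_r, Nat.pow_succ_r', <- Nat.mul_assoc, <- Ez. lia.
    + step; try contradiction; try lia. steps. split; [lia|]. simp_arr. split; [exact HP|].
      apply HL; [lia|]. exists (y / 2). change (2 ^ 0) with 1. lia.
  - cbn [cost]. intros t1 s1 Hf R13 (I1 & I2) Ht. split; [lia|].
    do 2 eexists. do 2 (split; [reflexivity|]). split; [exact I1|].
    intros x Hx1 Hx2. destruct (I2 x Hx1 Hx2) as (_ & HE). exact HE.
Qed.

Lemma small_step_ok t0 s0 m y BM NS HD :
  regs s0 0 = g -> regs s0 2 = n -> regs s0 7 = b -> regs s0 41 = stride b NB -> regs s0 42 = m ->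
  regs s0 13 = y -> arr g (mem s0) aP = P -> arr g (mem s0) aBM = BM ->
  arr g (mem s0) aNS = NS -> arr g (mem s0) aHD = HD ->
  1 <= m -> m < b -> y + m <= n -> (b + 1) * stride b NB <= AB -> small_ok n P b NB BM NS HD m (n + 1 - m - y) ->
  run w small_step t0 s0 (fun t' s' => t' <= t0 + 150 /\ exists BM' NS' HD',
    arr g (mem s') aBM = BM' /\ arr g (mem s') aNS = NS' /\ arr g (mem s') aHD = HD' /\
    small_ok n P b NB BM' NS' HD' m (n + 1 - m - S y) /\
    (forall x, x < m * stride b NB \/ (m + 1) * stride b NB <= x -> BM' x = BM x /\ NS' x = NS x /\ HD' x = HD x)).
Proof.
  intros R0 R2 R7 R41 R42 R13 AP ABM ANS AHD Hm1 Hm2 Hy Hst HOK.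
  set (i := n - m - y).
  assert (Hi : i + m <= n) by (unfold i; lia).
  pose proof (P_lip i (i + m) ltac:(lia) Hi) as HP1. pose proof (P_le (i + m) Hi) as HP2.
  assert (Hc : P (i + m) - P i <= m) by lia.
  set (c := P (i + m) - P i) in *.
  assert (HS : i / m / b <= superblocks n b m)
    by (unfold superblocks; apply Nat.Div0.div_le_mono, Nat.Div0.div_le_mono; lia).
  set (S := i / m / b) in *. set (r := i / m mod b).
  assert (Hr : r < b) by (apply Nat.mod_upper_bound; lia).
  destruct (cell_bound n b NB Hb1 HNB m S c Hm1 Hm2 Hc HS) as (C1 & C2). destruct (head_bound b NB m c Hc Hm2) as (C3 & C4).
  assert (Hms : (m + 1) * stride b NB <= AB) by (eapply Nat.le_trans; [apply Nat.mul_le_mono_r|exact Hst]; lia).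
  assert (Hst1 : stride b NB <= AB) by (eapply Nat.le_trans; [apply (le_mul_pos _ (b + 1)); lia|rewrite Nat.mul_comm; exact Hst]).
  replace (n + 1 - m - y) with (Datatypes.S i) in HOK by (unfold i; lia).
  replace (n + 1 - m - Datatypes.S y) with i by (unfold i; lia).
  pose proof (small_ok_step n P b NB Hb1 HNB P_lip BM NS HD) as Hstep.
  destruct HOK as (O1 & O2 & O3 & O4). pose proof (O2 c S Hc HS) as O2c.
  assert (HOK : small_ok n P b NB BM NS HD m (Datatypes.S i)) by exact (conj O1 (conj O2 (conj O3 O4))).
  assert (Hpr : 2 ^ r <= 2 * n) by (eapply Nat.le_trans; [apply Nat.pow_le_mono_r|exact H2b]; lia).
  assert (Hlor : Nat.lor (BM (cell b NB m S c)) (1 * 2 ^ r) < 2 ^ b)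
    by (rewrite Nat.mul_1_l; apply lor_pow2_lt; auto).
  pose proof (div_le_self i m) as D1. pose proof (div_le_self (i / m) b) as D2. fold S in D2.
  assert (Hsm : S * (m + 1) <= AB) by (unfold cell in C2; lia).
  clear O1 O2 O3 O4.
  assert (Hout : forall x, x < m * stride b NB \/ (m + 1) * stride b NB <= x -> x <> cell b NB m S c /\ x <> m * stride b NB + c) by lia.
  specialize (fun NS' HD' => Hstep NS' HD' m i Hm1 Hm2 Hi HOK). cbv zeta in Hstep.
  fold c S r in Hstep.
  unfold small_step. change (cell b NB m S c) with (m * stride b NB + c + S * (m + 1)) in *.
  assert (Ei : n - m - y = i) by reflexivity.
  assert (Eone : forall z, Nat.lor z (1 * 2 ^ r) = Nat.lor z (2 ^ r)) by (intros; now rewrite Nat.mul_1_l).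
  assert (HU : forall f v, forall z, z < m * stride b NB \/ (m + 1) * stride b NB <= z ->
     update f (m * stride b NB + c + S * (m + 1)) v z = f z /\ update f (m * stride b NB + c) v z = f z).
  { intros f v z Hz. destruct (Hout z Hz). split; apply update_other; auto. }
  assert (U1 : m * stride b NB + c + S * (m + 1) < AB) by lia.
  assert (U2 : m * stride b NB + c < AB) by lia.
  assert (Ec : P (i + m) - P i = c) by reflexivity. assert (ES : i / m / b = S) by reflexivity.
  assert (Er : (i / m) mod b = r) by reflexivity.
  assert (U3 : 1 * 2 ^ ((i / m) mod b) < 2 ^ w) by (fold r; lia).
  assert (U4 : Nat.lor (BM (m * stride b NB + c + S * (m + 1))) (1 * 2 ^ ((i / m) mod b)) < 2 ^ w) by (fold r; lia).
  clear Hout Hms Hst.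
  steps; (split; [lia|]); simp_arr; rewrite ABM, ANS, AHD; fold r; rewrite ?Eone.
  - do 3 eexists. do 3 (split; [reflexivity|]). split.
    + apply Hstep; [auto | contradiction].
    + intros z Hz. split; [apply HU|split; [apply HU|]]; auto. now apply HU.
  - do 3 eexists. do 3 (split; [reflexivity|]). split.
    + apply Hstep; [contradiction | auto].
    + intros z Hz. split; [apply HU|]; auto.
Qed.

Definition index_small (BM NS HD : nat -> nat) : Prop := forall m, 1 <= m -> m < b -> small_ok n P b NB BM NS HD m 0.

Lemma small_structure_ok t0 s0 :
  regs s0 0 = g -> regs s0 2 = n -> regs s0 7 = b -> regs s0 9 = NB ->
  arr g (mem s0) aP = P -> (b + 1) * stride b NB <= AB ->
  (forall x, arr g (mem s0) aBM x = 0) -> (forall x, arr g (mem s0) aHD x = 0) ->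
  run w small t0 s0 (fun t' s' => t' <= t0 + 200 * (b * (n + 1)) /\ regs s' 41 = stride b NB /\
    exists BM NS HD, arr g (mem s') aBM = BM /\ arr g (mem s') aNS = NS /\ arr g (mem s') aHD = HD /\
      index_small BM NS HD).
Proof.
  intros R0 R2 R7 R9 AP Hst HB0 HD0. unfold small.
  assert (Hst1 : stride b NB <= AB) by (eapply Nat.le_trans; [apply (le_mul_pos _ (b + 1)); lia|rewrite Nat.mul_comm; exact Hst]).
  pose proof (eq_refl (stride b NB)) as Es. unfold stride in Es at 1, Hst1.
  steps. rewrite Es.
  eapply (run_for w g Hw) with (lo := 1) (hi := b) (c := 170 * (n + 1) + 20)
    (I := fun m s' => (forall m', 1 <= m' -> m' < m ->
        small_ok n P b NB (arr g (mem s') aBM) (arr g (mem s') aNS) (arr g (mem s') aHD) m' 0) /\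
      (forall x, m * stride b NB <= x -> arr g (mem s') aBM x = 0 /\ arr g (mem s') aHD x = 0));
    auto; try ev; try lia.
  { split; [intros; lia|]. cbn [mem setr]. auto. }
  { intros. ev. }
  - intros m t1 s1 Hm1 Hm2 Hf R42 (I1 & I2).
    eapply (run_for w g Hw) with (lo := 0) (hi := n + 1 - m) (c := 150)
      (I := fun y s' =>
        small_ok n P b NB (arr g (mem s') aBM) (arr g (mem s') aNS) (arr g (mem s') aHD) m (n + 1 - m - y) /\
        (forall x, x < m * stride b NB \/ (m + 1) * stride b NB <= x ->
           arr g (mem s') aBM x = arr g (mem s1) aBM x /\ arr g (mem s') aNS x = arr g (mem s1) aNS x /\
           arr g (mem s') aHD x = arr g (mem s1) aHD x)); auto; try ev; try lia.
    { cbn [mem setr]. split; [|auto]. rewrite Nat.sub_0_r. apply small_ok_start. exact I2. }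
    { intros. ev. }
    + intros y t2 s2 _ Hy Hf2 R13 (J1 & J2). eapply (run_conseq w g Hw).
      { eapply small_step_ok with (m := m) (y := y) (BM := arr g (mem s2) aBM) (NS := arr g (mem s2) aNS)
          (HD := arr g (mem s2) aHD); try reflexivity; try lookup_reg; try lookup_arr; auto; lia. }
      cbn beta. intros t3 s3 (Ht3 & BM' & NS' & HD' & E1 & E2 & E3 & O1 & O2) _. split; [exact Ht3|].
      cbn [mem setr]. rewrite E1, E2, E3. split; [exact O1|].
      intros x Hx. destruct (O2 x Hx) as (-> & -> & ->). auto.
    + cbn [cost]. intros t2 s2 Hf2 R13 (J1 & J2) Ht2. split; [lia|]. cbn [mem setr].
      rewrite Nat.sub_diag in J1. split.
      * intros m' Hm' Hm''. destruct (Nat.eq_dec m' m) as [->|]; [exact J1|].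
        eapply (small_ok_ext n P b NB Hb1 HNB); [auto|lia| |apply (I1 m'); lia].
        intros x Hx. apply J2. left.
        assert ((m' + 1) * stride b NB <= m * stride b NB) by (apply Nat.mul_le_mono_r; lia). lia.
      * intros x Hx. replace (S m) with (m + 1) in Hx by lia.
        destruct (J2 x (or_intror Hx)) as (-> & _ & ->). apply I2.
        assert (m * stride b NB <= (m + 1) * stride b NB) by (apply Nat.mul_le_mono_r; lia). lia.
  - cbn [cost]. intros t1 s1 Hf R42 (I1 & I2) Ht. split.
    { assert ((b - 1) * (170 * (n + 1) + 20 + 1 + 7) <= b * (190 * (n + 1))) by (apply Nat.mul_le_mono; lia).
      assert (1 * 1 <= b * (n + 1)) by (apply Nat.mul_le_mono; lia). lia. }
    split; [lookup_reg|]. do 3 eexists. do 3 (split; [reflexivity|]).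
    intros m Hm1 Hm2. apply I1; auto.
Qed.

Lemma finish_ok t0 s0 LL hh Z :
  regs s0 0 = g -> regs s0 2 = n -> regs s0 7 = b -> regs s0 8 = 2 ^ b -> regs s0 9 = NB ->
  regs s0 10 = LL -> regs s0 11 = hh -> regs s0 41 = Z -> out s0 = [] ->
  NB <= hh -> hh <= AB -> LL <= AB -> 2 ^ b + (b + 1) * Z + 6 <= AB ->
  let N := 32 * (2 ^ b + (b + 1) * Z + 6) in
  run w finish t0 s0 (fun t' s' => t' <= t0 + 40 * N + 200 /\
    out s' = map (fun j => mem s' (j + 32 * g)) (seq 0 N) /\
    (forall k, k < 24 -> arr g (mem s') k = arr g (mem s0) k) /\
    (let H := arr g (mem s') aH in H 0 = n /\ H 1 = b /\ H 2 = NB /\ H 3 = LL / 2 /\ H 4 = hh - NB /\ H 5 = Z)).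
Proof.
  intros R0 R2 R7 R8 R9 R10 R11 R41 Hout H1 H2 H3 H4 N. unfold finish.
  pose proof (div_le_self LL 2). steps.
  eapply (run_for w g Hw) with (lo := 0) (hi := N) (c := 30)
    (I := fun y s' => out s' = map (fun j => mem s' (j + 32 * g)) (seq 0 y)); auto; try ev; try (unfold N; lia).
  { intros. ev. }
  - intros y t1 s1 _ Hy Hf R14 HI.
    eapply run_emit; [ev; unfold N in Hy; lia|]. cbn [cost]. split; [lia|].
    cbn [setr out mem]. rewrite HI, seq_S, map_app. reflexivity.
  - cbn [cost]. intros t1 s1 Hf R14 HI Ht. split; [lia|]. split; [exact HI|]. split.
    + intros k Hk. rewrite (proj1 (proj2 Hf) k eq_refl ltac:(lia)).
      cbn [mem setr]. rewrite !arr_seta_other by lia. reflexivity.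
    + rewrite (proj1 (proj2 Hf) 24 eq_refl ltac:(lia)). simp_arr.
      rewrite ?update_same. repeat split; unfold update; cbn [Nat.eqb]; auto.
Qed.
End Small.

(** * Queries *)

Section Occ.
Variables (n : nat) (P : nat -> nat) (m c : nat).

Definition hit (i : nat) : bool := (i + m <=? n) && (P (i + m) =? P i + c).

Definition occs_in (lo hi : nat) : list nat := filter hit (seq lo (hi - lo)).

Lemma hit_true i : hit i = true <-> i + m <= n /\ P (i + m) = P i + c.
Proof. unfold hit. rewrite andb_true_iff, Nat.leb_le, Nat.eqb_eq. reflexivity. Qed.

Lemma in_occ lo hi i : In i (occs_in lo hi) <-> lo <= i < hi /\ hit i = true.
Proof. unfold occs_in. rewrite filter_In, in_seq. intuition lia. Qed.

Lemma occ_app lo mid hi : lo <= mid -> mid <= hi -> occs_in lo hi = occs_in lo mid ++ occs_in mid hi.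
Proof.
  intros H1 H2. unfold occs_in. rewrite <- filter_app.
  replace (hi - lo) with ((mid - lo) + (hi - mid)) by lia. rewrite seq_app.
  do 3 f_equal. lia.
Qed.

Lemma occ_nil lo hi : (forall i, lo <= i < hi -> hit i = true -> False) -> occs_in lo hi = [].
Proof.
  intros H. destruct (occs_in lo hi) as [|i l] eqn:E; [auto|]. exfalso.
  assert (Hi : In i (occs_in lo hi)) by (rewrite E; now left).
  apply in_occ in Hi. destruct Hi as (H1 & H2). exact (H i H1 H2).
Qed.

Lemma occ_pos lo hi i : lo <= i < hi -> hit i = true -> 1 <= length (occs_in lo hi).
Proof.
  intros H1 H2. assert (Hi : In i (occs_in lo hi)) by (apply in_occ; auto).
  destruct (occs_in lo hi); [contradiction|cbn; lia].
Qed.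

Lemma occ_S lo y : lo <= y -> occs_in lo (S y) = occs_in lo y ++ if hit y then [y] else [].
Proof.
  intros H. rewrite (occ_app lo y (S y)) by lia. f_equal. unfold occs_in.
  replace (S y - y) with 1 by lia. reflexivity.
Qed.

Lemma div_between i k : 1 <= m -> (i / m = k <-> k * m <= i < (k + 1) * m).
Proof.
  intros Hm. pose proof (Nat.div_mod_eq i m). pose proof (Nat.mod_upper_bound i m ltac:(lia)). split.
  - intros <-. nia.
  - intros Hi. symmetry. apply (Nat.div_unique _ _ _ (i - k * m)); nia.
Qed.

Lemma occ_blocks_nil K K' :
  1 <= m -> (forall i, K <= i / m -> i / m < K' -> hit i = true -> False) -> occs_in (K * m) (K' * m) = [].
Proof.
  intros Hm H. apply occ_nil. intros i Hi. pose proof (proj1 (div_between i (i / m) Hm) eq_refl) as Hd.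
  apply H; apply Nat.nle_gt || apply Nat.nlt_ge; intros E; nia.
Qed.

Lemma occ_total hi : (forall i, hi <= i -> hit i = true -> False) -> occs_in 0 hi = occs_in 0 (n + 1).
Proof.
  intros H. destruct (Nat.le_ge_cases hi (n + 1)) as [E|E].
  - rewrite (occ_app 0 hi (n + 1)), (occ_nil hi (n + 1)), app_nil_r by
      (auto; try lia; intros i Hi; apply H; lia). reflexivity.
  - rewrite (occ_app 0 (n + 1) hi), (occ_nil (n + 1) hi), app_nil_r by
      (auto; try lia; intros i Hi Hh; apply hit_true in Hh; lia). reflexivity.
Qed.

End Occ.

Section Query.
Variables (w AB n : nat) (P : nat -> nat).
Hypothesis Hw : 5 <= w.
Hypothesis HAB : 64 * (AB + 0 + 1) < 2 ^ w.
Hypothesis AB1 : 16 * (n + 1) <= AB.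
Hypothesis P_lip : forall i j, i <= j -> j <= n -> P i <= P j <= P i + (j - i).
Hypothesis P_le : forall i, i <= n -> P i <= n.
Variables (m c : nat).
Hypothesis Hcm : c <= m.
Hypothesis Hmn : m <= n.

Notation hit := (hit n P m c).
Notation occ := (occs_in n P m c).

Lemma scan_ok e t0 s0 lo len :
  regs s0 0 = 0 -> regs s0 1 = c -> regs s0 2 = m -> regs s0 3 = n -> regs s0 11 = lo ->
  eval w s0 e = len -> arr 0 (mem s0) aP = P -> lo + m <= n -> len <= 2 * n ->
  run w (scan e) t0 s0 (fun t' s' => t' <= t0 + cost e + 40 * len + 40 /\
    out s' = out s0 ++ occ lo (lo + len)).
Proof.
  intros R0 R1 R2 R3 R11 He AP Hlo Hlen. unfold scan.
  apply run_seq. eapply run_assign; [apply ev_add; [ev|exact He|lia]|]. cbn [cost].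
  set (hi := Nat.min (lo + len) (n + 1 - m)).
  assert (Hhi : lo <= hi /\ hi <= lo + len /\ hi + m <= n + 1 /\ hi <= n + 1) by (unfold hi; lia).
  assert (Hocc : occ lo (lo + len) = occ lo hi).
  { rewrite (occ_app n P m c lo hi (lo + len)), (occ_nil n P m c hi (lo + len)) by
      (try lia; intros i Hi Hit; apply hit_true in Hit; unfold hi in Hi; lia).
    apply app_nil_r. }
  apply run_seq. eapply (run_conseq w 0 Hw) with (Q := fun t' s' => t' <= t0 + cost e + 20 /\
    regs s' 12 = hi /\ out s' = out s0).
  { step. split; [lia|]. split; [|reflexivity]. simp_state. unfold hi.
    destruct (Nat.ltb_spec (n + 1) (lo + len + m)); lia. }
  intros t1 s1 (Ht1 & R12 & Ho) Hf1. clearbody hi. rewrite Hocc.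
  eapply (run_for w 0 Hw) with (lo := lo) (hi := hi) (c := 30)
    (I := fun y s' => out s' = out s0 ++ occ lo y); auto; try ev; try lia.
  { cbn [out setr]. rewrite Ho. unfold occs_in. rewrite Nat.sub_diag. cbn. now rewrite app_nil_r. }
  { intros. ev. }
  - intros y t2 s2 Hy1 Hy2 Hf2 R13 HI.
    pose proof (P_lip y (y + m) ltac:(lia) ltac:(lia)) as HL. pose proof (P_le (y + m) ltac:(lia)).
    step; try lia.
    + eapply run_emit; [ev|]. cbn [cost]. split; [lia|]. cbn [out setr].
      rewrite occ_S, HI, <- app_assoc by lia.
      assert (E : hit y = true) by (apply hit_true; split; lia). now rewrite E.
    + apply run_skip. split; [lia|]. cbn [out setr]. rewrite occ_S, HI by lia.
      destruct (hit y) eqn:E; [apply hit_true in E; lia|]. now rewrite app_nil_r.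
  - cbn [cost]. intros t2 s2 Hf2 R13 HI Ht. split; [lia|]. exact HI.
Qed.

Variables (b NB : nat).
Hypothesis Hb1 : 1 <= b.
Hypothesis Hbn : b <= n.
Hypothesis Hnb : n < 2 ^ b.
Hypothesis H2b : 2 ^ b <= 2 * n.
Hypothesis HNB : NB = n / b + 1.
Variables (POP LOW : nat -> nat).
Hypothesis HLOW : low_table b LOW.

(** A set bit stands for [m] consecutive starts of which at least one is an occurrence, and this
    occurrence pays for scanning all of them. *)
Lemma bits_loop_ok t0 s0 K v :
  1 <= m -> v < 2 ^ b ->
  (forall k, k < b -> Nat.testbit v k = true <-> exists i, i / m = K + k /\ hit i = true) ->
  regs s0 0 = 0 -> regs s0 1 = c -> regs s0 2 = m -> regs s0 3 = n -> regs s0 8 = v ->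
  regs s0 9 = K -> arr 0 (mem s0) aP = P -> arr 0 (mem s0) aLOW = LOW ->
  run w bits_loop t0 s0 (fun t' s' => t' <= t0 + 20 + 200 * m * length (occ (K * m) ((K + b) * m)) /\
    out s' = out s0 ++ occ (K * m) ((K + b) * m)).
Proof.
  intros Hm Hv Hbits R0 R1 R2 R3 R8 R9 AP ALOW. unfold bits_loop.
  assert (Hmono : forall x y, x <= y -> x * m <= y * m) by (intros; now apply Nat.mul_le_mono_r).
  apply (run_while_ltb w 0 Hw) with (k0 := b)
    (I := fun k t s => exists j, k = b - j /\ j <= b /\ regs s 8 = v / 2 ^ j /\ regs s 9 = K + j /\
       out s = out s0 ++ occ (K * m) ((K + j) * m) /\
       t <= t0 + 200 * m * length (occ (K * m) ((K + j) * m))).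
  { exists 0. change (2 ^ 0) with 1. rewrite Nat.div_1_r, Nat.add_0_r. unfold occs_in at 1.
    rewrite Nat.sub_diag. cbn [seq filter]. rewrite app_nil_r. repeat split; auto; lia. }
  intros k t1 s1 Hf (j & Hk & Hj & R8' & R9' & Ho & Ht).
  do 2 eexists. split; [ev|]. split; [ev|]. cbn [cost].
  set (x := v / 2 ^ j) in *.
  assert (Hxv : x <= v) by apply div_le_self.
  split.
  (* With [x = 2 ^ l * (2 * z + 1)], bit [j + l] of [v] is set and the bits from [j] to [j + l - 1]
     are clear; shifting by [l + 1] leaves [z]. *)
  - intros Hx. destruct (HLOW x Hx ltac:(lia)) as (z & Ez). set (l := LOW x) in *.
    assert (Hbit : forall i, v / 2 ^ (j + i) = x / 2 ^ i)
      by (intros; unfold x; rewrite Nat.pow_add_r, Nat.Div0.div_div; reflexivity).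
    assert (Hl : x / 2 ^ l = 2 * z + 1).
    { rewrite Ez, Nat.mul_comm. apply Nat.div_mul, Nat.pow_nonzero. lia. }
    assert (Hl1 : x / 2 ^ (l + 1) = z).
    { rewrite Nat.pow_add_r, <- Nat.Div0.div_div, Hl. change (2 ^ 1) with 2.
      symmetry. apply (Nat.div_unique _ _ _ 1); lia. }
    assert (Htrue : Nat.testbit v (j + l) = true).
    { apply Nat.testbit_true. rewrite Hbit, Hl.
      symmetry. apply (Nat.mod_unique _ _ z); lia. }
    assert (Hjl : j + l < b).
    { apply Nat.nle_gt. intros E. assert (v / 2 ^ (j + l) = 0).
      { apply Nat.div_small. eapply Nat.lt_le_trans; [exact Hv|]. apply Nat.pow_le_mono_r; lia. }
      rewrite Hbit, Hl in H. lia. }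
    assert (Hfalse : forall i, i < l -> Nat.testbit v (j + i) = true -> False).
    { intros i Hi E. apply Nat.testbit_true in E. rewrite Hbit, Ez in E.
      replace (2 ^ l) with (2 ^ i * (2 * 2 ^ (l - i - 1))) in E
        by (rewrite <- Nat.pow_succ_r', <- Nat.pow_add_r; f_equal; lia).
      rewrite <- Nat.mul_assoc, Nat.mul_comm, Nat.div_mul in E by (apply Nat.pow_nonzero; lia).
      rewrite <- Nat.mul_assoc, Nat.mul_comm, Nat.Div0.mod_mul in E. discriminate. }
    destruct (proj1 (Hbits (j + l) Hjl) Htrue) as (i & Ei & Hi).
    pose proof (proj1 (hit_true n P m c i) Hi) as (Hin & _).
    pose proof (proj1 (div_between m i (K + (j + l)) Hm) Ei) as Hib.
    assert (HK : K + (j + l) <= (K + (j + l)) * m) by (apply le_mul_pos; lia).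
    assert (Hnil : occ ((K + j) * m) ((K + (j + l)) * m) = []).
    { apply occ_blocks_nil; auto. intros i' H1 H2 H3.
      apply (Hfalse (i' / m - (K + j))); [lia|]. apply Hbits; [lia|]. exists i'. split; [lia|auto]. }
    assert (Hlast : 1 <= length (occ ((K + (j + l)) * m) ((K + (j + l)) * m + m)))
      by (apply (occ_pos n P m c _ _ i); [lia|auto]).
    assert (Hsplit : occ (K * m) ((K + (j + l + 1)) * m) =
      occ (K * m) ((K + j) * m) ++ occ ((K + (j + l)) * m) ((K + (j + l)) * m + m)).
    { replace ((K + (j + l + 1)) * m) with ((K + (j + l)) * m + m) by lia.
      pose proof (Hmono K (K + j) ltac:(lia)). pose proof (Hmono (K + j) (K + (j + l)) ltac:(lia)).
      rewrite (occ_app n P m c (K * m) ((K + j) * m)), (occ_app n P m c ((K + j) * m) ((K + (j + l)) * m)) by lia.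
      now rewrite Hnil. }
    do 3 step. fold l.
    assert (El : K + j + l = K + (j + l)) by lia. rewrite El.
    apply run_seq. eapply (run_conseq w 0 Hw).
    { eapply scan_ok with (lo := (K + (j + l)) * m) (len := m); try lookup_reg; try lookup_arr; auto; try ev; lia. }
    cbn [cost out setr]. intros t2 s2 (Ht2 & Ho2) Hf2.
    step. step. exists (b - (j + l + 1)). split; [lia|]. exists (j + l + 1).
    split; [reflexivity|]. split; [lia|]. simp_state.
    split; [fold l; rewrite <- Nat.add_assoc, Hbit; reflexivity|]. split; [lia|].
    rewrite Hsplit, length_app. split; [rewrite Ho2, Ho, app_assoc; reflexivity|].
    assert (200 * m * 1 <= 200 * m * length (occ ((K + (j + l)) * m) ((K + (j + l)) * m + m)))
      by (apply Nat.mul_le_mono_l; exact Hlast).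
    rewrite Nat.mul_add_distr_l. lia.
  - intros Hx. assert (Hz : x = 0) by lia.
    assert (Hnil : occ ((K + j) * m) ((K + b) * m) = []).
    { apply occ_blocks_nil; auto. intros i' H1 H2 H3.
      assert (E : Nat.testbit v (i' / m - K) = true) by (apply Hbits; [lia|]; exists i'; split; [lia|auto]).
      apply Nat.testbit_true in E. replace (i' / m - K) with (j + (i' / m - K - j)) in E by lia.
      rewrite Nat.pow_add_r, <- Nat.Div0.div_div in E. fold x in E. rewrite Hz, Nat.Div0.div_0_l in E.
      discriminate. }
    rewrite (occ_app n P m c (K * m) ((K + j) * m)), Hnil, app_nil_r by (apply Hmono; lia).
    split; [lia|exact Ho].
Qed.

Lemma query_small_ok t0 s0 BM NS HD :
  1 <= m -> m < b -> small_ok n P b NB BM NS HD m 0 -> (b + 1) * stride b NB <= AB ->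
  regs s0 0 = 0 -> regs s0 1 = c -> regs s0 2 = m -> regs s0 3 = n -> regs s0 4 = b ->
  arr 0 (mem s0) aP = P -> arr 0 (mem s0) aLOW = LOW -> arr 0 (mem s0) aH 5 = stride b NB ->
  arr 0 (mem s0) aBM = BM -> arr 0 (mem s0) aNS = NS -> arr 0 (mem s0) aHD = HD -> out s0 = [] ->
  run w query_small t0 s0 (fun t' s' => t' <= t0 + 60 + 300 * m * length (occ 0 (n + 1)) /\
    out s' = occ 0 (n + 1)).
Proof.
  intros Hm Hmb (O1 & O2 & O3 & O4) Hst R0 R1 R2 R3 R4 AP ALOW AH5 ABM ANS AHD Hout. unfold query_small.
  pose proof (head_bound b NB m c Hcm Hmb) as Hhd.
  assert (Hms : (m + 1) * stride b NB <= AB) by (eapply Nat.le_trans; [apply Nat.mul_le_mono_r|exact Hst]; lia).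
  assert (Hst1 : stride b NB <= AB) by (eapply Nat.le_trans; [apply (le_mul_pos _ (b + 1)); lia|rewrite Nat.mul_comm; exact Hst]).
  assert (Hmono : forall x y, x <= y -> x * b * m <= y * b * m) by (intros; now apply Nat.mul_le_mono_r, Nat.mul_le_mono_r).
  assert (Hhit : forall i, hit i = true -> nonempty n b NB BM m c (i / m / b)).
  { intros i Hi. apply hit_true in Hi. destruct Hi as (Hi1 & Hi2).
    assert (HS : i / m / b <= superblocks n b m)
      by (apply Nat.Div0.div_le_mono, Nat.Div0.div_le_mono; lia).
    split; [exact HS|]. intros E.
    assert (X : Nat.testbit (BM (cell b NB m (i / m / b) c)) (i / m mod b) = true).
    { apply O1; auto; [apply Nat.mod_upper_bound; lia|]. exists i. repeat split; try lia.
      pose proof (Nat.div_mod_eq (i / m) b). lia. }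
    rewrite E, Nat.bits_0 in X. discriminate. }
  assert (Hgap : forall lo hi, (forall S, lo <= S -> S < hi -> ~ nonempty n b NB BM m c S) ->
    occ (lo * b * m) (hi * b * m) = []).
  { intros lo hi H. apply occ_blocks_nil; auto. intros i H1 H2 H3.
    apply (H (i / m / b)); auto.
    - apply Nat.div_le_lower_bound; lia.
    - apply Nat.Div0.div_lt_upper_bound. lia. }
  do 2 (step; rewrite ?AH5; try lia).
  apply (run_while_ltb w 0 Hw) with (k0 := superblocks n b m + 1)
    (I := fun k t s => exists lo, lo <= superblocks n b m + 1 /\ k = superblocks n b m + 1 - lo /\
       first_from (nonempty n b NB BM m c) lo (regs s 6) /\
       out s = occ 0 (lo * b * m) /\ t <= t0 + 50 + 300 * m * length (occ 0 (lo * b * m))).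
  { exists 0. simp_state. split; [lia|]. split; [lia|]. split; [apply O3; auto|].
    unfold occs_in. cbn [Nat.mul Nat.sub seq filter length]. split; [auto|lia]. }
  intros k t1 s1 Hf (lo & Hlo & Hk & Hff & Ho & Ht).
  do 2 eexists. split; [ev|]. split; [ev|]. cbn [cost]. split.
  - intros Hpos. destruct Hff as [(E & _)|(S & E & F1 & F2 & F3)]; [lia|].
    destruct F2 as (F2 & F2'). pose proof (cell_bound n b NB Hb1 HNB m S c Hm Hmb Hcm F2) as Hcell.
    unfold cell in *. set (v := BM (m * stride b NB + c + S * (m + 1))) in *.
    assert (HSb : S * b <= n).
    { unfold superblocks in F2. pose proof (Nat.Div0.mul_div_le (n / m) b). pose proof (div_le_self n m).
      pose proof (Nat.mul_le_mono_l _ _ b F2). lia. }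
    pose proof (O2 c S Hcm F2) as Hv. fold v in Hv.
    assert (Hbits : forall k, k < b -> Nat.testbit v k = true <-> exists i, i / m = S * b + k /\ hit i = true).
    { intros k' Hk'. unfold v. rewrite (O1 c S k' Hcm F2 Hk'). split.
      - intros (i & _ & I1 & I2 & I3). exists i. split; [auto|]. apply hit_true.
        pose proof (P_lip i (i + m) ltac:(lia) I1). lia.
      - intros (i & I1 & I2). apply hit_true in I2. exists i. repeat split; lia. }
    assert (Hsucc : Datatypes.S S - 1 = S) by lia.
    do 3 (step; rewrite ?E, ?AH5, ?Hsucc; try lia).
    apply run_seq. eapply (run_conseq w 0 Hw).
    { eapply bits_loop_ok with (K := S * b) (v := v); try lookup_reg; try lookup_arr; auto. }
    cbn [out setr]. intros t2 s2 (Ht2 & Ho2) Hf2.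
    step; try lia.
    exists (superblocks n b m + 1 - Datatypes.S S). split; [lia|].
    exists (Datatypes.S S). split; [lia|]. split; [reflexivity|]. simp_state.
    split; [apply (O4 c S Hcm (conj F2 F2'))|].
    pose proof (Hmono lo S F1) as M1. pose proof (Hmono S (Datatypes.S S) ltac:(lia)) as M2.
    replace (Datatypes.S S * b) with (S * b + b) in * by lia.
    assert (Hsplit : occ 0 ((S * b + b) * m) = occ 0 (lo * b * m) ++ occ (S * b * m) ((S * b + b) * m)).
    { rewrite (occ_app n P m c 0 (lo * b * m)), (occ_app n P m c (lo * b * m) (S * b * m)) by lia.
      rewrite Hgap by auto. reflexivity. }
    (* A listed superblock is not empty, so one of its occurrences pays for handling it. *)
    assert (Hone : 1 <= length (occ (S * b * m) ((S * b + b) * m))).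
    { assert (Hlog : Nat.log2 v < b) by (apply Nat.log2_lt_pow2; [lia|exact Hv]).
      destruct (proj1 (Hbits (Nat.log2 v) Hlog) (Nat.bit_log2 v F2')) as (i & I1 & I2).
      apply (occ_pos n P m c _ _ i); [|exact I2]. apply (div_between m i _ Hm) in I1.
      assert ((S * b + Nat.log2 v + 1) * m <= (S * b + b) * m) by (apply Nat.mul_le_mono_r; lia).
      assert (S * b * m <= (S * b + Nat.log2 v) * m) by (apply Nat.mul_le_mono_r; lia). lia. }
    rewrite Hsplit, length_app, Nat.mul_add_distr_l. split; [rewrite Ho2, Ho; reflexivity|].
    assert (100 * m * 1 <= 100 * m * length (occ (S * b * m) ((S * b + b) * m)))
      by (apply Nat.mul_le_mono_l; exact Hone).
    lia.
  - intros Hz. destruct Hff as [(E & F1)|(S & E & _)]; [|lia].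
    assert (X : occ 0 (lo * b * m) = occ 0 (n + 1)).
    { apply occ_total. intros i Hi Hh. apply (F1 (i / m / b)); [|apply Hhit; exact Hh].
      apply Nat.div_le_lower_bound; [lia|]. apply Nat.div_le_lower_bound; lia. }
    rewrite X in *. split; [lia|exact Ho].
Qed.
End Query.

(** * Walking over the tree of blocks *)

Lemma intermediate_value (F : nat -> nat) c i j :
  i <= j -> (forall k, i <= k < j -> F (S k) <= F k + 1 /\ F k <= F (S k) + 1) ->
  F i <= c <= F j \/ F j <= c <= F i -> exists k, i <= k <= j /\ F k = c.
Proof.
  intros Hij. replace j with (i + (j - i)) by lia. generalize (j - i) as d.
  intros d. induction d as [|d IH]; intros Hs Hc.
  - rewrite Nat.add_0_r in Hc. exists i. lia.
  - destruct (Nat.eq_dec (F (i + S d)) c) as [E|E]; [exists (i + S d); lia|].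
    specialize (Hs (i + d) ltac:(lia)) as Hd. replace (S (i + d)) with (i + S d) in Hd by lia.
    destruct IH as (k & Hk & E'); [intros; apply Hs; lia|lia|]. exists k. lia.
Qed.

Section Walk.
Variables (w AB n : nat) (P : nat -> nat).
Hypothesis Hw : 5 <= w.
Hypothesis HAB : 64 * (AB + 0 + 1) < 2 ^ w.
Hypothesis AB1 : 16 * (n + 1) <= AB.
Hypothesis P_lip : forall i j, i <= j -> j <= n -> P i <= P j <= P i + (j - i).
Hypothesis P_le : forall i, i <= n -> P i <= n.
Variables (m c : nat).
Hypothesis Hcm : c <= m.
Hypothesis Hmn : m <= n.
Variables (b NB H : nat).
Hypothesis Hb1 : 1 <= b.
Hypothesis Hbm : b <= m.
Hypothesis HNB : NB = n / b + 1.
Hypothesis HH : b * 2 ^ H <= 2 * n < b * 2 ^ S H.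

Notation hit := (hit n P m c).
Notation occ := (occs_in n P m c).
Notation len h := (b * 2 ^ h).
(** Beyond every position that the walk reaches: it visits blocks at [p <= n], of length at most
    [2 * n]. *)
Notation far := (4 * n).

Lemma len_S h : len (S h) = 2 * len h.
Proof. rewrite Nat.pow_succ_r'. lia. Qed.

Lemma len_pos h : b <= len h.
Proof. pose proof (pow2_pos h). nia. Qed.

Lemma len_le h h' : h <= h' -> len h <= len h'.
Proof. intros. apply Nat.mul_le_mono_l, Nat.pow_le_mono_r; lia. Qed.

Lemma occ_skip p p' :
  p <= p' -> p' <= far -> (forall i, p <= i < p' -> hit i = true -> False) -> occ p far = occ p' far.
Proof. intros H1 H2 H3. rewrite (occ_app n P m c p p' far), (occ_nil n P m c p p') by auto. reflexivity. Qed.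

Lemma occ_head p o l : occ p far = o :: l -> p <= o /\ hit o = true /\ forall i, p <= i -> hit i = true -> o <= i.
Proof.
  intros E. assert (Ho : In o (occ p far)) by (rewrite E; now left).
  apply in_occ in Ho. destruct Ho as (Ho & Hh). split; [lia|]. split; [auto|].
  intros i Hi Hhi. destruct (le_lt_dec o i) as [|Hlt]; [auto|]. exfalso.
  rewrite (occ_app n P m c p o far) in E by lia.
  destruct (occ p o) as [|o' l'] eqn:E'.
  - assert (Hin : In i (occ p o)) by (apply in_occ; auto; lia). rewrite E' in Hin. contradiction.
  - cbn [app] in E. injection E as -> _.
    assert (Hin : In o (occ p o)) by (rewrite E'; now left). apply in_occ in Hin. lia.
Qed.

(* The number of nodes visited from node [p] of level [h] before the next leaf
   is scanned, or until the end.  If the next occurrence lies below the parent,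
   then the walk only descends, with at most one step to a sibling on each
   level; otherwise it first ascends in the same way. *)
Definition potential (p h : nat) : nat :=
  let e := if p mod (2 * len h) =? 0 then 1 else 0 in
  match occ p far with
  | [] => 2 * (H - h) + e
  | o :: _ => if o <? 2 * len h * (p / (2 * len h)) + 2 * len h then 2 * h + e
              else 2 * H + 2 + 2 * (H - h) + e
  end.

Lemma potential_le p h : h <= H -> potential p h <= 4 * H + 3.
Proof.
  intros Hh. unfold potential. destruct (p mod (2 * len h) =? 0), (occ p far) as [|o l]; try lia;
    destruct (o <? _); lia.
Qed.

(* [p] is child number [e] of node [q] of level [h + 1] *)
Lemma potential_child q e p h :
  p = 2 * len h * q + e * len h -> e <= 1 ->
  potential p h =
  match occ p far with
  | [] => 2 * (H - h) + (1 - e)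
  | o :: _ => if o <? 2 * len h * q + 2 * len h then 2 * h + (1 - e)
              else 2 * H + 2 + 2 * (H - h) + (1 - e)
  end.
Proof.
  intros Hp He. pose proof (len_pos h). unfold potential. set (L := len h) in *.
  assert (E1 : p / (2 * L) = q) by (symmetry; apply (Nat.div_unique _ _ _ (e * L)); nia).
  assert (E2 : p mod (2 * L) = e * L) by (symmetry; apply (Nat.mod_unique _ _ q); nia).
  rewrite E1, E2. destruct e as [|[|e]]; [| |lia].
  - reflexivity.
  - destruct (Nat.eqb_spec (1 * L) 0); [lia|]. reflexivity.
Qed.

Definition next_level (e h : nat) : nat := if (h <? H) && (e =? 1) then S h else h.

(** A step to a sibling loses the correction of 1. A step to the next block one level up lowers the
    ascending term by 2 and regains at most 1. If the next occurrence now lies below the new parent,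
    the offset [2 * H + 2] pays for the change to descending. *)
Lemma potential_miss q e p h :
  p = 2 * len h * q + e * len h -> e <= 1 -> h <= H -> p <= n ->
  (forall i, p <= i < p + len h -> hit i = true -> False) ->
  potential (p + len h) (next_level e h) < potential p h.
Proof.
  intros Hp He Hh Hpn Hno. pose proof (len_pos h) as HL. pose proof (len_le h H Hh) as HLH.
  pose proof (occ_skip p (p + len h) ltac:(lia) ltac:(lia) Hno) as Eo.
  rewrite (potential_child q e p h Hp He), Eo. unfold next_level.
  assert (Ho : forall o l, occ (p + len h) far = o :: l -> p + len h <= o)
    by (intros o l E; apply (occ_head _ _ _ E)).
  destruct e as [|[|e]]; [| |lia].
  - rewrite andb_false_r. rewrite (potential_child q 1 (p + len h) h) by lia.
    destruct (occ (p + len h) far) as [|o l]; [lia|]. destruct (o <? _); lia.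
  - assert (HhH : h < H).
    (* On the top level a right child would begin beyond [n], as [n < len H]. *)
    { destruct (Nat.eq_dec h H) as [->|]; [|lia]. exfalso. rewrite len_S in HH. lia. }
    destruct (Nat.ltb_spec h H); [|lia]. cbn [andb Nat.eqb].
    pose proof (Nat.div_mod_eq (q + 1) 2) as Dq. pose proof (Nat.mod_upper_bound (q + 1) 2 ltac:(lia)) as Mq.
    rewrite (potential_child ((q + 1) / 2) ((q + 1) mod 2) (p + len h) (S h));
      [|rewrite len_S, Hp; set (L := len h) in *; nia|lia].
    destruct (occ (p + len h) far) as [|o l]; [lia|]. specialize (Ho o l eq_refl).
    destruct (Nat.ltb_spec o (2 * len h * q + 2 * len h)); [lia|].
    destruct (o <? _); lia.
Qed.

(** The next occurrence lies in the block, hence below the parent on both levels; the descending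
    term drops by 2 and the correction adds at most 1. *)
Lemma potential_descend q p h i :
  p = len (S h) * q -> S h <= H -> p <= i < p + len (S h) -> hit i = true ->
  potential p h < potential p (S h).
Proof.
  intros Hp Hh Hi Hit. rewrite len_S in *.
  pose proof (Nat.div_mod_eq q 2) as Dq. pose proof (Nat.mod_upper_bound q 2 ltac:(lia)) as Mq.
  rewrite (potential_child q 0 p h) by lia.
  rewrite (potential_child (q / 2) (q mod 2) p (S h)); rewrite ?len_S; [| |lia].
  2: { rewrite Hp. set (L := len h) in *. nia. }
  assert (Hin : In i (occ p far)).
  { apply in_occ. split; [|auto]. apply hit_true in Hit. lia. }
  destruct (occ p far) as [|o l] eqn:E; [contradiction|].
  destruct (occ_head _ _ _ E) as (O1 & O2 & O3). specialize (O3 i ltac:(lia) Hit).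
  destruct (Nat.ltb_spec o (2 * len h * q + 2 * len h)); [|lia].
  destruct (Nat.ltb_spec o (2 * (2 * len h) * (q / 2) + 2 * (2 * len h))) as [|Hc]; [lia|].
  exfalso. set (L := len h) in *. nia.
Qed.
Variables (MS MB XS XB POP : nat -> nat).
Hypothesis HE : forall h, h <= H -> encoded n b (len h) P (h * NB) MS MB XS XB.

Lemma node_range p h q :
  p = len h * q -> m < len h -> p + m <= n -> h <= H ->
  is_range (ones_at P m) p (Nat.min (p + len h - 1) (n - m))
    (decode b (h * NB) MS MB (p + m)) (decode b (h * NB) XS XB (p + m)).
Proof.
  intros Hp Hm Hpm Hh. pose proof (HE h Hh (p + m) Hpm) as Hc. unfold covers, last_start in Hc.
  assert (Eq : (p + m) / len h = q) by (symmetry; apply (Nat.div_unique _ _ _ m); lia).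
  rewrite Eq, <- Hp in Hc. replace (p + m - p) with m in Hc by lia.
  replace (p + n - (p + m)) with (n - m) in Hc by lia. exact Hc.
Qed.

Lemma node_hit p h q :
  p = len h * q -> m < len h -> p + m <= n -> h <= H ->
  decode b (h * NB) MS MB (p + m) <= c <= decode b (h * NB) XS XB (p + m) ->
  exists i, p <= i < p + len h /\ hit i = true.
Proof.
  intros Hp Hm Hpm Hh Hc. destruct (node_range p h q Hp Hm Hpm Hh) as (_ & (i & Hi & Ei) & (j & Hj & Ej)).
  assert (Hstep : forall k, k + 1 + m <= n ->
     ones_at P m (S k) <= ones_at P m k + 1 /\ ones_at P m k <= ones_at P m (S k) + 1).
  { intros k Hk. unfold ones_at. pose proof (P_lip k (S k) ltac:(lia) ltac:(lia)).
    pose proof (P_lip (k + m) (S k + m) ltac:(lia) ltac:(lia)).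
    pose proof (P_lip k (k + m) ltac:(lia) ltac:(lia)).
    pose proof (P_lip (S k) (S k + m) ltac:(lia) ltac:(lia)). lia. }
  assert (Hk : exists k, p <= k < p + len h /\ k + m <= n /\ ones_at P m k = c).
  { destruct (Nat.le_ge_cases i j) as [Hij|Hij].
    - destruct (intermediate_value (ones_at P m) c i j Hij) as (k & Hk & E); [intros; apply Hstep; lia|lia|].
      exists k. lia.
    - destruct (intermediate_value (ones_at P m) c j i Hij) as (k & Hk & E); [intros; apply Hstep; lia|lia|].
      exists k. lia. }
  destruct Hk as (k & Hk1 & Hk2 & Hk3). exists k. split; [auto|]. apply hit_true. split; [auto|].
  unfold ones_at in Hk3. pose proof (P_lip k (k + m) ltac:(lia) Hk2). lia.
Qed.

Lemma node_miss p h q :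
  p = len h * q -> m < len h -> p + m <= n -> h <= H ->
  (c < decode b (h * NB) MS MB (p + m) \/ decode b (h * NB) XS XB (p + m) < c) ->
  forall i, p <= i < p + len h -> hit i = true -> False.
Proof.
  intros Hp Hm Hpm Hh Hc i Hi Hit. destruct (node_range p h q Hp Hm Hpm Hh) as (HR & _).
  apply hit_true in Hit. destruct Hit as (I1 & I2).
  specialize (HR i ltac:(lia)). unfold ones_at in HR. lia.
Qed.

Hypothesis Hbn : n < 2 ^ b.
Hypothesis H2b : 2 ^ b <= 2 * n.
Hypothesis Hcells : (b + 2) * NB <= AB.
Hypothesis HHb : H <= b.
Hypothesis HPOP : pop_table b POP.
Hypothesis HMB : forall x, MB x < 2 ^ w.
Hypothesis HXB : forall x, XB x < 2 ^ w.

Lemma advance_ok t0 s0 q e p h :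
  p = 2 * len h * q + e * len h -> e <= 1 -> h <= H -> p <= n ->
  regs s0 5 = p -> regs s0 6 = len h -> regs s0 7 = h * NB -> regs s0 14 = len H -> regs s0 15 = NB ->
  run w advance t0 s0 (fun t' s' => t' <= t0 + 40 /\ regs s' 5 = p + len h /\
    regs s' 6 = len (next_level e h) /\ regs s' 7 = next_level e h * NB).
Proof.
  intros Hp He Hh Hpn R5 R6 R7 R14 R15. pose proof (len_pos h) as HL. pose proof (len_le h H Hh) as HLH.
  assert (Hcell : H * NB + 2 * NB <= AB).
  { rewrite <- Nat.mul_add_distr_r. eapply Nat.le_trans; [apply Nat.mul_le_mono_r|exact Hcells]. lia. }
  assert (HhNB : h * NB <= H * NB) by (now apply Nat.mul_le_mono_r).
  assert (Hlt : len h < len H <-> h < H).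
  { split; intros Hx.
    - apply Nat.nle_gt. intros Hy. pose proof (len_le H h Hy). lia.
    - pose proof (len_le (S h) H Hx) as Hy. rewrite len_S in Hy. lia. }
  assert (Hmod : (p + len h) mod (2 * len h) = (1 - e) * len h).
  { symmetry. apply (Nat.mod_unique _ _ (q + e)).
    - destruct e as [|[|e]]; lia.
    - destruct e as [|[|e]]; lia. }
  pose proof (len_S h) as HS. unfold advance, next_level.
  step; try lia. step.
  - apply Hlt in H0. destruct (Nat.ltb_spec h H); [|lia].
    step; try lia; rewrite Hmod in H2.
    + assert (Ee : e = 1) by (destruct e as [|[|e]]; lia). subst e. cbn [andb Nat.eqb].
      steps. simp_state. split; [lia|]. split; [auto|]. rewrite HS. split; [auto|]. lia.
    + assert (Ee : e = 0) by (destruct e as [|[|e]]; lia). subst e. cbn [andb Nat.eqb].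
      steps. simp_state. auto with arith. split; [lia|]. auto.
  - assert (Eh : h < H -> False) by (intros X; apply Hlt in X; lia).
    destruct (Nat.ltb_spec h H); [lia|]. cbn [andb]. steps. simp_state. split; [lia|]. auto.
Qed.

(** The variant is the potential plus [4 * H + 5] for each occurrence still to come. A scanned block
    contains an occurrence, which pays for the new potential of at most [4 * H + 3] and, through
    [D], for scanning at most [2 * m] positions. *)
Lemma walk_ok t0 s0 :
  regs s0 0 = 0 -> regs s0 1 = c -> regs s0 2 = m -> regs s0 3 = n -> regs s0 4 = b ->
  regs s0 5 = 0 -> regs s0 6 = len H -> regs s0 7 = H * NB -> regs s0 14 = len H -> regs s0 15 = NB ->
  arr 0 (mem s0) aP = P -> arr 0 (mem s0) aMS = MS -> arr 0 (mem s0) aMB = MB ->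
  arr 0 (mem s0) aXS = XS -> arr 0 (mem s0) aXB = XB -> arr 0 (mem s0) aPOP = POP -> out s0 = [] ->
  run w walk t0 s0 (fun t' s' =>
    t' <= t0 + 20 + 150 * potential 0 H + (150 * (4 * H + 5) + 80 * m + 100) * length (occ 0 far) /\
    out s' = occ 0 (n + 1)).
Proof.
  intros R0 R1 R2 R3 R4 R5 R6 R7 R14 R15 AP AMS AMB AXS AXB APOP Hout. unfold walk.
  pose proof (len_S H) as HSH. pose proof (len_pos H) as HLH.
  assert (Hcell : H * NB + 2 * NB <= AB).
  { rewrite <- Nat.mul_add_distr_r. eapply Nat.le_trans; [apply Nat.mul_le_mono_r|exact Hcells]. lia. }
  set (D := 80 * m + 100).
  apply (run_while_ltb w 0 Hw) with (k0 := potential 0 H + (4 * H + 5) * length (occ 0 far))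
    (I := fun k t s => exists p h q, p = len h * q /\ h <= H /\ m < len h /\ p <= far /\
       k = potential p h + (4 * H + 5) * length (occ p far) /\
       regs s 5 = p /\ regs s 6 = len h /\ regs s 7 = h * NB /\ out s = occ 0 p /\
       t + 150 * k + D * length (occ p far) <=
         t0 + 150 * (potential 0 H + (4 * H + 5) * length (occ 0 far)) + D * length (occ 0 far)).
  { exists 0, H, 0. repeat (split; [auto; lia|]). lia. }
  intros k t1 s1 Hf (p & h & q & Hp & Hh & Hm & Hpf & Hk & R5' & R6' & R7' & Ho & Ht).
  do 2 eexists. split; [ev|]. split; [ev|]. cbn [cost].
split.
  2: { intros Hend. assert (Eo : occ 0 p = occ 0 (n + 1)).
    { apply occ_total. intros i Hi Hit. apply hit_true in Hit. lia. }
    rewrite <- Eo. split; [|exact Ho].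
    assert (X : t1 <= t0 + 150 * (potential 0 H + (4 * H + 5) * length (occ 0 far)) + D * length (occ 0 far)) by lia.
    rewrite Nat.mul_add_distr_r. rewrite Nat.mul_add_distr_l, Nat.mul_assoc in X. lia. }
  intros Hpm. assert (Hy : p + m <= n) by lia.
  pose proof (len_le h H Hh) as HhH.
  assert (HhNB : h * NB <= H * NB) by (now apply Nat.mul_le_mono_r).
  assert (Hyb : (p + m) / b <= n / b) by (now apply Nat.Div0.div_le_mono).
  pose proof (Nat.mod_upper_bound (p + m) b ltac:(lia)) as Hr.
  assert (H2r : 2 ^ ((p + m) mod b) <= 2 ^ b) by (apply Nat.pow_le_mono_r; lia).
  pose proof (pow2_pos ((p + m) mod b)) as H2p.
  pose proof (node_range p h q Hp Hm Hy Hh) as HR.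
  pose proof (node_hit p h q Hp Hm Hy Hh) as Hnh. pose proof (node_miss p h q Hp Hm Hy Hh) as Hnm'.
  set (d1 := decode b (h * NB) MS MB (p + m)) in *. set (d2 := decode b (h * NB) XS XB (p + m)) in *.
  assert (Hd : d1 <= m /\ d2 <= m).
  { destruct HR as (_ & (i & Hi & Ei) & (j & Hj & Ej)). unfold ones_at in *.
    pose proof (P_lip i (i + m) ltac:(lia) ltac:(lia)). pose proof (P_lip j (j + m) ltac:(lia) ltac:(lia)). lia. }
  set (x := h * NB + (p + m) / b) in *.
  assert (Hx : x <= AB) by (unfold x; lia).
  assert (Hpop : forall z, z mod (1 * 2 ^ ((p + m) mod b)) <= AB /\
     POP (z mod (1 * 2 ^ ((p + m) mod b))) = popn b (z mod 2 ^ ((p + m) mod b))).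
  { intros z. rewrite Nat.mul_1_l. pose proof (Nat.mod_upper_bound z (2 ^ ((p + m) mod b)) ltac:(lia)).
    split; [lia|]. apply HPOP. lia. }
  assert (E1 : MS x + POP (MB x mod (1 * 2 ^ ((p + m) mod b))) = d1)
    by (rewrite (proj2 (Hpop _)); reflexivity).
  assert (E2 : XS x + POP (XB x mod (1 * 2 ^ ((p + m) mod b))) = d2)
    by (rewrite (proj2 (Hpop _)); reflexivity).
  pose proof (proj1 (Hpop (MB x))) as B1. pose proof (proj1 (Hpop (XB x))) as B2.
  pose proof (HMB x) as B3. pose proof (HXB x) as B4. clearbody d1 d2.
  step. step. step. fold x.
  apply run_seq. eapply (run_conseq w 0 Hw) with (Q := fun t' s' => t' <= t1 + 100 /\
    ((regs s' 16 = 1 /\ d1 <= c <= d2) \/ (regs s' 16 = 0 /\ (c < d1 \/ d2 < c)))).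
  { step; rewrite ?E1; try lia.
    - rewrite E1 in *. step; rewrite ?E2; try lia; rewrite ?E2 in *. split; [lia|]. simp_state.
      destruct (Nat.ltb_spec c (d2 + 1)); [left|right]; (split; [reflexivity|lia]).
    - rewrite E1 in *. steps. split; [lia|]. right. split; [reflexivity|lia]. }
  clear E1 E2 Hpop B1 B2 B3 B4 HR. intros t2 s2 (Ht2 & Hyes) Hf2.
  assert (S5 : regs s2 5 = p) by lookup_reg.
  assert (S6 : regs s2 6 = len h) by lookup_reg.
  assert (S7 : regs s2 7 = h * NB) by lookup_reg.
  assert (S14 : regs s2 14 = len H) by lookup_reg.
  assert (S15 : regs s2 15 = NB) by lookup_reg.
  assert (So : out s2 = occ 0 p) by (rewrite (proj2 (proj2 Hf2) eq_refl); exact Ho).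
  pose proof (len_pos h) as HLh.
  pose proof (Nat.div_mod_eq q 2) as Dq. pose proof (Nat.mod_upper_bound q 2 ltac:(lia)) as Mq.
  assert (Hpq : p = 2 * len h * (q / 2) + (q mod 2) * len h) by (rewrite Hp; set (L := len h) in *; nia).
  assert (Hnl : h <= next_level (q mod 2) h <= H).
  { unfold next_level. destruct (Nat.ltb_spec h H), (_ =? 1); cbn [andb]; lia. }
  assert (Hnm : m < len (next_level (q mod 2) h)).
  { eapply Nat.lt_le_trans; [exact Hm|]. apply len_le. lia. }
  assert (Hnq : exists q', p + len h = len (next_level (q mod 2) h) * q').
  { unfold next_level. destruct (h <? H); cbn [andb]; [|exists (q + 1); lia].
    destruct (Nat.eqb_spec (q mod 2) 1) as [Eq|Eq]; [|exists (q + 1); lia].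
    exists (q / 2 + 1). rewrite len_S. lia. }
  destruct Hnq as (q' & Hq').
  destruct Hyes as [(S16 & Hyes)|(S16 & Hno)].
  - destruct (Hnh Hyes) as (i & Hi & Hit).
    step; [|lia]. step.
    (* On level 0 the block has length [b <= m], so it cannot be split. *)
    + destruct h as [|h']; [change (2 ^ 0) with 1 in *; lia|]. rewrite len_S in *.
      assert (Eh : 2 * len h' / 2 = len h') by (rewrite Nat.mul_comm; apply Nat.div_mul; lia).
      pose proof (potential_descend q p h' i) as Hdec. rewrite len_S in Hdec.
      specialize (Hdec Hp ltac:(lia) Hi Hit).
      steps. exists (potential p h' + (4 * H + 5) * length (occ p far)). split; [lia|].
      exists p, h', (2 * q). simp_state. rewrite Eh.
      split; [lia|]. split; [lia|]. split; [lia|]. split; [lia|]. split; [reflexivity|].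
      split; [lookup_reg|]. split; [auto|]. split; [lia|]. split; [exact So|]. lia.
    + step. apply run_seq. eapply (run_conseq w 0 Hw).
      { eapply scan_ok with (AB := AB) (n := n) (P := P) (m := m) (c := c) (lo := p) (len := len h);
          auto; try lookup_reg; try lookup_arr; try ev; lia. }
      cbn [cost out setr]. intros t3 s3 (Ht3 & Ho3) Hf3.
      eapply (run_conseq w 0 Hw).
      { eapply advance_ok with (q := q / 2) (e := q mod 2) (p := p) (h := h); try lookup_reg; auto; lia. }
      intros t4 s4 (Ht4 & Q5 & Q6 & Q7) Hf4.
      pose proof (potential_le (p + len h) (next_level (q mod 2) h) ltac:(lia)) as Hpl.
      assert (Hsplit : length (occ p far) = length (occ p (p + len h)) + length (occ (p + len h) far)).
      { rewrite <- length_app, <- occ_app by lia. reflexivity. }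
      pose proof (occ_pos n P m c _ _ i Hi Hit) as Hone.
      set (u := length (occ p (p + len h))) in *. set (v := length (occ (p + len h) far)) in *.
      assert (N1 : (4 * H + 5) * 1 <= (4 * H + 5) * u) by (now apply Nat.mul_le_mono_l).
      assert (N2 : D * 1 <= D * u) by (now apply Nat.mul_le_mono_l).
      rewrite Hsplit, !(Nat.mul_add_distr_l _ u v) in *.
      exists (potential (p + len h) (next_level (q mod 2) h) + (4 * H + 5) * v). split; [lia|].
      exists (p + len h), (next_level (q mod 2) h), q'.
      split; [auto|]. split; [lia|]. split; [auto|]. split; [lia|]. split; [reflexivity|].
      split; [auto|]. split; [auto|]. split; [auto|]. split.
      * rewrite (proj2 (proj2 Hf4) eq_refl), Ho3, So. symmetry. apply occ_app; lia.
      * unfold D in *. lia.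
  - step; [lia|]. eapply (run_conseq w 0 Hw).
    { eapply advance_ok with (q := q / 2) (e := q mod 2) (p := p) (h := h); try lookup_reg; auto; lia. }
    intros t4 s4 (Ht4 & Q5 & Q6 & Q7) Hf4.
    pose proof (potential_miss (q / 2) (q mod 2) p h Hpq ltac:(lia) Hh ltac:(lia) (Hnm' Hno)) as Hdec.
    pose proof (occ_skip p (p + len h) ltac:(lia) ltac:(lia) (Hnm' Hno)) as Hsk. rewrite Hsk in *.
    set (v := length (occ (p + len h) far)) in *.
    exists (potential (p + len h) (next_level (q mod 2) h) + (4 * H + 5) * v). split; [lia|].
    exists (p + len h), (next_level (q mod 2) h), q'.
    split; [auto|]. split; [lia|]. split; [auto|]. split; [lia|]. split; [reflexivity|].
    split; [auto|]. split; [auto|]. split; [auto|]. split.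
    + rewrite (proj2 (proj2 Hf4) eq_refl), So.
      rewrite (occ_app n P m c 0 p (p + len h)), (occ_nil n P m c p (p + len h)) by
        (try lia; apply (Hnm' Hno)). symmetry. apply app_nil_r.
    + lia.
Qed.
End Walk.

Section Index.
Variables (n b NB H : nat).

Definition index_ok (A : nat -> nat -> nat) : Prop :=
  pop_table b (A aPOP) /\ low_table b (A aLOW) /\
  (forall h, h <= H -> encoded n b (b * 2 ^ h) (A aP) (h * NB) (A aMS) (A aMB) (A aXS) (A aXB)) /\
  index_small n (A aP) b NB (A aBM) (A aNS) (A aHD) /\
  A aH 0 = n /\ A aH 1 = b /\ A aH 2 = NB /\ A aH 3 = b * 2 ^ H /\ A aH 4 = H * NB /\
  A aH 5 = stride b NB.

Hypothesis Hb1 : 1 <= b.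
Hypothesis HNB : NB = n / b + 1.

Lemma small_ok_counts P P' BM NS HD m i0 :
  (forall i, i <= n -> P' i = P i) -> small_ok n P b NB BM NS HD m i0 -> small_ok n P' b NB BM NS HD m i0.
Proof.
  intros HP (H1 & H2 & H3 & H4). split; [|auto]. intros c S k Hc HS Hk. rewrite (H1 c S k Hc HS Hk).
  split; intros (i & I1 & I2 & I3 & I4); exists i; rewrite !HP in * by lia; auto.
Qed.

Lemma encoded_ext L h P P' MS MB XS XB MS' MB' XS' XB' :
  (forall i, i <= n -> P' i = P i) ->
  (forall x, x < h + NB -> MS' x = MS x /\ MB' x = MB x /\ XS' x = XS x /\ XB' x = XB x) ->
  encoded n b L P h MS MB XS XB -> encoded n b L P' h MS' MB' XS' XB'.
Proof.
  intros HP HA HE y Hy. specialize (HE y Hy).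
  assert (Hx : h + y / b < h + NB) by (pose proof (Nat.Div0.div_le_mono y n b Hy); lia).
  destruct (HA _ Hx) as (E1 & E2 & E3 & E4).
  unfold decode, covers, last_start in *. rewrite E1, E2, E3, E4.
  eapply is_range_ext; [|exact HE]. intros i Hi. unfold ones_at.
  assert (L * (y / L) <= y) by apply Nat.Div0.mul_div_le.
  rewrite !HP by lia. reflexivity.
Qed.

Hypothesis Hnb : n < 2 ^ b.
Hypothesis HH : H <= b.

(** All that a query reads lies among the emitted cells, so arbitrary words elsewhere in the memory
    do no harm. *)
Lemma index_ok_ext A A' :
  (forall k x, k < 32 -> x < 2 ^ b + (b + 1) * stride b NB + 6 -> A' k x = A k x) ->
  index_ok A -> index_ok A'.
Proof.
  intros HA (I1 & I2 & I3 & I4 & I5 & I6 & I7 & I8 & I9 & I10).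
  assert (HP : forall i, i <= n -> A' aP i = A aP i) by (intros; apply HA; lia).
  split; [|split; [|split; [|split]]].
  - intros x Hx. rewrite HA by lia. auto.
  - intros x Hx0 Hx. rewrite HA by lia. auto.
  - intros h Hh. eapply encoded_ext; [exact HP| |apply I3; exact Hh].
    assert (h * NB + NB <= (b + 1) * stride b NB).
    { replace (h * NB + NB) with ((h + 1) * NB) by lia. apply Nat.mul_le_mono; unfold stride; lia. }
    intros x Hx. rewrite !HA by lia. auto.
  - intros m Hm1 Hm2. apply (small_ok_counts (A aP)); [exact HP|].
    eapply (small_ok_ext n (A aP) b NB Hb1 HNB); [auto|auto| |apply I4; auto].
    assert ((m + 1) * stride b NB <= (b + 1) * stride b NB) by (apply Nat.mul_le_mono_r; lia).
    intros x Hx. rewrite !HA by lia. auto.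
  - rewrite !HA by lia. repeat split; auto.
Qed.
End Index.

Lemma query_ok w AB n b NB H m c mem0 :
  let P := arr 0 mem0 aP in
  let s0 := query_input m c mem0 in
  let occs := occs_in n P m c 0 (n + 1) in
  5 <= w -> 64 * (AB + 0 + 1) < 2 ^ w -> 1 <= n -> 16 * (n + 1) <= AB ->
  (forall i j, i <= j -> j <= n -> P i <= P j <= P i + (j - i)) -> (forall i, i <= n -> P i <= n) ->
  1 <= b -> b <= n -> n < 2 ^ b -> 2 ^ b <= 2 * n -> NB = n / b + 1 ->
  b * 2 ^ H <= 2 * n < b * 2 ^ S H -> H <= b -> (b + 2) * NB <= AB -> (b + 1) * stride b NB <= AB ->
  (forall a, mem0 a < 2 ^ w) -> m < 2 ^ w -> index_ok n b NB H (arr 0 mem0) ->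
  run w query 0 s0 (fun t' s' => t' <= 300 + 3000 * Nat.max 1 m * length occs /\ out s' = occs).
Proof.
  intros P s0 occs Hw HAB Hn1 AB1 P_lip P_le Hb1 Hbn Hnb H2b HNB HH HHb Hc1 Hc2 Hmem Hmw
    (I1 & I2 & I3 & I4 & I5 & I6 & I7 & I8 & I9 & I10).
  assert (R0 : regs s0 0 = m) by reflexivity. assert (R1 : regs s0 1 = c) by reflexivity.
  assert (Hout : out s0 = []) by reflexivity.
  assert (M0 : mem s0 = mem0) by reflexivity. rewrite <- M0 in I5, I6, I7, I8, I9, I10.
  assert (EP : arr 0 (mem s0) aP = P) by reflexivity.
  assert (Hnone : forall i, hit n P m c i = true -> i + m <= n /\ c <= m).
  { intros i Hi. apply hit_true in Hi. pose proof (P_lip i (i + m) ltac:(lia) ltac:(lia)). lia. }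
  unfold query. do 3 step. rewrite I5.
  step.
  2: { steps. assert (E : occs = []) by (apply occ_nil; intros i _ Hi; apply Hnone in Hi; lia).
       rewrite E. split; [lia|]. exact Hout. }
  step.
  2: { steps. assert (E : occs = []) by (apply occ_nil; intros i _ Hi; apply Hnone in Hi; lia).
       rewrite E. split; [lia|]. exact Hout. }
  rename H0 into Hmn. rename H1 into Hcm. step. rewrite I6. step.
  - eapply (run_for w 0 Hw) with (lo := 0) (hi := n + 1) (c := 10)
      (I := fun y s' => out s' = seq 0 y); auto; try ev; try lia.
    { intros. ev. }
    + intros y t1 s1 _ Hy Hf R5 HI. step. split; [lia|]. cbn [out setr]. now rewrite HI, seq_S.
    + cbn [cost]. intros t1 s1 Hf R5 HI Ht.
      assert (E : occs = seq 0 (n + 1)).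
      { unfold occs, occs_in. rewrite Nat.sub_0_r. apply forallb_filter_id, forallb_forall. intros i Hi.
        apply in_seq in Hi. apply hit_true. replace (i + m) with i by lia. lia. }
      rewrite E, length_seq. split; [lia|exact HI].
  - step.
    + pose proof (I4 m ltac:(lia) H1) as Hsm.
      eapply (run_conseq w 0 Hw).
      { eapply query_small_ok with (AB := AB) (n := n) (P := P) (m := m) (c := c) (b := b) (NB := NB)
          (LOW := arr 0 mem0 aLOW); try exact Hsm; auto; try lia; try lookup_reg. }
      intros t1 s1 (Ht1 & Ho) _. fold occs in Ht1. split; [|exact Ho].
      replace (Nat.max 1 m) with m by lia.
      rewrite <- Nat.mul_assoc in *. set (u := m * length occs) in *. lia.
    + unfold query_large. step. step. rewrite I8. do 3 step. rewrite I9, I7.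
      assert (Hfar : occs_in n P m c 0 (4 * n) = occs).
      { apply occ_total. intros i Hi Hh. apply Hnone in Hh. lia. }
      eapply (run_conseq w 0 Hw).
      { eapply walk_ok with (AB := AB) (n := n) (P := P) (m := m) (c := c) (b := b) (NB := NB) (H := H)
          (MS := arr 0 mem0 aMS) (MB := arr 0 mem0 aMB) (XS := arr 0 mem0 aXS) (XB := arr 0 mem0 aXB)
          (POP := arr 0 mem0 aPOP); auto; try lia; try lookup_reg; intros; apply Hmem. }
      intros t1 s1 (Ht1 & Ho) _. rewrite Hfar in Ht1. split; [|exact Ho].
      replace (Nat.max 1 m) with m by lia.
      (* Without occurrences the initial potential is only 1, since no ascent is left from the top
         level; otherwise the first occurrence pays for it. *)
      assert (Hpot : potential n P m c b H 0 H <= 1 + (4 * H + 3) * length occs).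
      { destruct (Nat.eq_dec (length occs) 0) as [E|E].
        - apply length_zero_iff_nil in E. unfold potential. rewrite Hfar, E, Nat.Div0.mod_0_l. cbn. lia.
        - assert (potential n P m c b H 0 H <= 4 * H + 3) by (eapply potential_le; eauto; lia).
          assert ((4 * H + 3) * 1 <= (4 * H + 3) * length occs) by (apply Nat.mul_le_mono_l; lia). lia. }
      (* [H <= b <= m] absorbs the logarithmic cost of an occurrence into O(m). *)
      assert (B1 : (4 * H + 3) * length occs <= 7 * m * length occs) by (apply Nat.mul_le_mono_r; lia).
      assert (B2 : (150 * (4 * H + 5) + 80 * m + 100) * length occs <= 1800 * m * length occs)
        by (apply Nat.mul_le_mono_r; lia).
      rewrite <- !Nat.mul_assoc in *. set (u := m * length occs) in *. lia.
Qed.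

(** * The theorem *)

Definition index_cells (n b : nat) : nat := 2 ^ b + (b + 1) * stride b (n / b + 1) + 6.

Lemma length_encoded_rules rs : length (flat_map encode_rhs rs) = 3 * length rs.
Proof. induction rs as [|[] rs IH]; cbn [flat_map encode_rhs app length]; lia. Qed.

(** The rules end at [3 * g], below the arrays. The zeros found there initialize the prefix counts,
    the bit counts, the bitmaps and the list heads. *)
Lemma arr_build_input G k : arr (num_rules G) (mem (build_input G)) k = fun _ => 0.
Proof.
  extensionality x. unfold arr, build_input, of_list. cbn [mem]. apply nth_overflow.
  rewrite length_encoded_rules. unfold num_rules. lia.
Qed.

Lemma build_ok w AB n B G t (tau : nat -> R) :
  let g := num_rules G in let b := bitlen n in
  5 <= w -> 64 * (AB + g + 1) < 2 ^ w -> n = length B -> 1 <= n -> 16 * (n + 1) <= AB ->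
  (8 * n + 7) * (8 * n + 7) * (4 * n + 1) < AB -> 8 * (g * g) <= AB ->
  deriv (rules G) t -> root t = start G -> yield t = B ->
  (b + 2) * (n / b + 1) <= AB -> index_cells n b <= AB ->
  (forall L s T, 1 <= L -> L <= 2 * n -> good_step g L s ->
    T * s <= 2 * 1000 * 1000 * (n * L) -> (INR T + 20 <= tau (2 * L)%nat - tau L)%R) ->
  run w build 0 (build_input G) (fun t' s' =>
    exists H, b * 2 ^ H <= 2 * n < b * 2 ^ S H /\ H <= b /\
    (INR t' <= INR (1000 * (n * (b + 1)) + 2000 * index_cells n b) +
       (tau (b * 2 ^ S H)%nat - tau b))%R /\
    index_ok n b (n / b + 1) H (arr g (mem s')) /\
    (forall i, i <= n -> arr g (mem s') aP i = prefix_ones B i) /\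
    out s' = map (fun j => mem s' (j + 32 * g)) (seq 0 (32 * index_cells n b))).
Proof.
  intros g b Hw HAB Hn Hn1 AB1 AB2 AB3 Ht Hroot HB HNB2 HX Htau.
  assert (Hg1 : 1 <= g).
  { pose proof (deriv_root_lt _ _ Ht). unfold g, num_rules. lia. }
  set (s0 := build_input G).
  assert (Z : forall k, arr g (mem s0) k = fun _ => 0) by (intros; apply arr_build_input).
  unfold build. apply run_seq. eapply (run_conseq w g Hw).
  { eapply traverse_ok with (g := g) (AB := AB) (n := n) (B := B) (rs := rules G) (t := t); auto.
    all: try (rewrite Z; reflexivity). intros a _. reflexivity. }
  cbn beta. intros t1 s1 (Ht1 & R2 & P & J & AP & AJ & HP & HJ) F1.
  assert (R0 : regs s1 0 = g) by lookup_reg.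
  apply run_seq. eapply (run_conseq w g Hw).
  { eapply find_b_ok with (g := g) (AB := AB) (n := n); auto. }
  cbn beta. intros t2 s2 (Ht2 & b' & Eb & Hb1 & Hbn & Hnb & H2b & R7 & R8 & R9) F2.
  fold b in Eb. subst b'. set (NB := n / b + 1) in *.
  assert (P_lip : forall i j, i <= j -> j <= n -> P i <= P j <= P i + (j - i)).
  { intros i j Hij Hj. rewrite !HP by lia. now apply prefix_ones_lip. }
  assert (P_le : forall i, i <= n -> P i <= n).
  { intros i Hi. rewrite HP by lia. pose proof (prefix_ones_le B i). lia. }
  assert (HZ : (b + 1) * stride b NB <= AB) by (unfold index_cells in HX; fold NB in HX; lia).
  apply run_seq. eapply (run_conseq w g Hw).
  { eapply tables_ok with (g := g) (AB := AB) (n := n) (b := b) (NB := NB); auto; try lookup_reg.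
    rewrite (proj1 (proj2 F2) 4 eq_refl), (proj1 (proj2 F1) 4 eq_refl), Z by lia. reflexivity. }
  cbn beta. intros t3 s3 (Ht3 & POP & LOW & APOP & ALOW & HPOP & HLOW) F3.
  apply run_seq. eapply (run_conseq w g Hw).
  { eapply levels_ok with (g := g) (AB := AB) (n := n) (b := b) (NB := NB) (B := B) (rs := rules G) (t := t)
      (P := P) (J := J) (tau := tau); auto; try lookup_reg; try lookup_arr. }
  cbn beta. intros t4 s4 (H & MS & MB & XS & XB & HH & HHb & Ht4 & R10 & R11 & AMS & AMB & AXS & AXB & HE) F4.
  apply run_seq. eapply (run_conseq w g Hw).
  { eapply small_structure_ok with (g := g) (AB := AB) (n := n) (b := b) (NB := NB) (P := P);
      auto; try lookup_reg; try lookup_arr; intros x.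
    - rewrite (proj1 (proj2 F4) 21 eq_refl), (proj1 (proj2 F3) 21 eq_refl),
        (proj1 (proj2 F2) 21 eq_refl), (proj1 (proj2 F1) 21 eq_refl), Z by lia. reflexivity.
    - rewrite (proj1 (proj2 F4) 23 eq_refl), (proj1 (proj2 F3) 23 eq_refl),
        (proj1 (proj2 F2) 23 eq_refl), (proj1 (proj2 F1) 23 eq_refl), Z by lia. reflexivity. }
  cbn beta. intros t5 s5 (Ht5 & R41 & BM & NS & HD & ABM & ANS & AHD & HS) F5.
  assert (HLL : b * 2 ^ S H <= 4 * n) by (rewrite Nat.pow_succ_r'; lia).
  assert (Hhh : S H * NB <= AB) by (eapply Nat.le_trans; [apply Nat.mul_le_mono_r|exact HNB2]; lia).
  eapply (run_conseq w g Hw).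
  { eapply finish_ok with (g := g) (AB := AB) (n := n) (b := b) (NB := NB) (LL := b * 2 ^ S H) (hh := S H * NB)
      (Z := stride b NB); auto; try lookup_reg; try lia.
    - rewrite (proj2 (proj2 F5) eq_refl), (proj2 (proj2 F4) eq_refl), (proj2 (proj2 F3) eq_refl),
        (proj2 (proj2 F2) eq_refl), (proj2 (proj2 F1) eq_refl). reflexivity. }
  cbn beta. intros t6 s6 (Ht6 & Ho & HA & E0 & E1 & E2 & E3 & E4 & E5) _.
  exists H. split; [exact HH|]. split; [exact HHb|]. split; [|split; [|split]].
  - fold (index_cells n b) in *.
    assert (HX6 : 6 <= index_cells n b) by (unfold index_cells; lia).
    assert (EX : 2 ^ b + (b + 1) * stride b NB + 6 = index_cells n b) by reflexivity.
    rewrite EX in *. set (X := index_cells n b) in *. clearbody X.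
    assert (T6 : t6 + t3 + 20 <= t4 + (1000 * (n * (b + 1)) + 2000 * X)) by lia.
    set (W := 1000 * (n * (b + 1)) + 2000 * X) in *. clearbody W.
    apply le_INR in T6. rewrite !plus_INR, (INR_IZR_INZ 20) in T6. change (IZR (Z.of_nat 20)) with 20%R in T6. lra.
  - unfold index_ok. rewrite !HA by lia.
    assert (HP5 : arr g (mem s5) 0 = P) by lookup_arr. rewrite HP5.
    assert (EPOP : arr g (mem s5) 4 = POP) by lookup_arr. rewrite EPOP.
    assert (ELOW : arr g (mem s5) 5 = LOW) by lookup_arr. rewrite ELOW.
    assert (EMS : arr g (mem s5) 17 = MS) by lookup_arr. rewrite EMS.
    assert (EMB : arr g (mem s5) 18 = MB) by lookup_arr. rewrite EMB.
    assert (EXS : arr g (mem s5) 19 = XS) by lookup_arr. rewrite EXS.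
    assert (EXB : arr g (mem s5) 20 = XB) by lookup_arr. rewrite EXB.
    rewrite ABM, ANS, AHD, E0, E1, E2, E3, E4, E5.
    repeat (split; [solve [auto]|]).
    split; [|split; [lia|reflexivity]].
    rewrite Nat.pow_succ_r', (Nat.mul_comm 2), Nat.mul_assoc. apply Nat.div_mul. lia.
  - intros i Hi. rewrite HA by lia. assert (HP5 : arr g (mem s5) 0 = P) by lookup_arr.
    rewrite HP5. auto.
  - exact Ho.
Qed.

(** Tight at [b = 4]. With [2 ^ b <= 2 * n] it gives [b ^ 3 <= 8 * n], which makes the time O(n b)
    for short windows O(n^(4/3)). *)
Lemma cube_le_pow2 b : b * b * b <= 4 * 2 ^ b.
Proof.
  induction b as [|b IH]; [cbn; lia|].
  destruct (le_lt_dec b 3) as [Hb|Hb].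
  - destruct b as [|[|[|[|b]]]]; [now apply Nat.leb_le..|lia].
  - rewrite Nat.pow_succ_r'. nia.
Qed.

Lemma index_size n b :
  1 <= b -> b <= n -> 2 ^ b <= 2 * n ->
  (b + 2) * (n / b + 1) <= 100 * n /\ index_cells n b <= 100 * n /\ b * b * b <= 8 * n.
Proof.
  intros Hb Hbn H2b. pose proof (cube_le_pow2 b) as Hc. pose proof (Nat.Div0.mul_div_le n b) as Hd.
  assert (Hs : b * b * 1 <= b * b * b) by (apply Nat.mul_le_mono_l; lia).
  assert (Hq : n / b <= b * (n / b)) by nia.
  unfold index_cells, stride. set (q := n / b) in *.
  assert (b * b >= b) by nia. split; [|split]; lia.
Qed.

(** * Estimates with fractional powers *)

Open Scope R_scope.

(** Reduces inequalities between expressions with exponents 1/3 and 2/3 to polynomial ones. *)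
Lemma cube_le a b : 0 <= b -> a * a * a <= b * b * b -> a <= b.
Proof.
  intros Hb H. apply Rnot_lt_le. intros Hlt.
  assert (0 < (a - b) * (a * a + a * b + b * b)) by (apply Rmult_lt_0_compat; nra). lra.
Qed.

Lemma Rpower_third x : 0 < x -> Rpower x (1 / 3) * Rpower x (1 / 3) * Rpower x (1 / 3) = x.
Proof.
  intros Hx. rewrite <- !Rpower_plus. replace (1 / 3 + 1 / 3 + 1 / 3) with 1 by lra. now apply Rpower_1.
Qed.

Lemma Rpower_two_thirds x : 0 < x -> Rpower x (2 / 3) * Rpower x (2 / 3) * Rpower x (2 / 3) = x * x.
Proof.
  intros Hx. rewrite <- !Rpower_plus. replace (2 / 3 + 2 / 3 + 2 / 3) with (1 + 1) by lra.
  now rewrite Rpower_plus, Rpower_1.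
Qed.

Lemma Rpower_four_thirds x : 0 < x -> Rpower x (4 / 3) = x * Rpower x (1 / 3).
Proof. intros Hx. replace (4 / 3) with (1 + 1 / 3) by lra. now rewrite Rpower_plus, Rpower_1. Qed.

Lemma Rpower_ge_1 x y : 1 <= x -> 0 <= y -> 1 <= Rpower x y.
Proof. intros Hx Hy. rewrite <- (Rpower_O x) by lra. apply Rle_Rpower; lra. Qed.

Lemma INR_ge_1 n : (1 <= n)%nat -> 1 <= INR n.
Proof. intros H. apply le_INR in H. exact H. Qed.

(** The instance of [tau]: since it is proportional to [L ^ (1 / 3)], its growth when [L] doubles is
    a constant fraction of its value, as for a geometric progression. *)
Definition level_sum (n g L : nat) : R :=
  20 * 1000 * 1000 * (INR n * Rpower (INR g) (2 / 3) * Rpower (INR L) (1 / 3)).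

Lemma level_sum_step n g L s T :
  (1 <= n)%nat -> (1 <= g)%nat -> (1 <= L)%nat -> good_step g L s ->
  (T * s <= 2 * 1000 * 1000 * (n * L))%nat ->
  INR T + 20 <= level_sum n g (2 * L) - level_sum n g L.
Proof.
  intros Hn Hg HL (Hs1 & _ & _ & Hs) HT. unfold level_sum.
  apply INR_ge_1 in Hn, Hg, HL, Hs1. apply lt_INR in Hs. apply le_INR in HT.
  rewrite !mult_INR, !plus_INR in Hs. rewrite !mult_INR in HT.
  rewrite (INR_IZR_INZ 1000), (INR_IZR_INZ 2) in HT. cbn [INR] in Hs.
  change (IZR (Z.of_nat 1000)) with 1000 in HT. change (IZR (Z.of_nat 2)) with 2 in HT.
  rewrite mult_INR. change (INR 2) with 2.
  rewrite <- Rpower_mult_distr by lra.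
  pose proof (Rpower_third 2 ltac:(lra)) as Ez. set (z := Rpower 2 (1 / 3)) in *.
  pose proof (Rpower_third (INR L) ltac:(lra)) as Eu. pose proof (Rpower_ge_1 (INR L) (1 / 3) HL ltac:(lra)) as Hu.
  set (u := Rpower (INR L) (1 / 3)) in *.
  pose proof (Rpower_two_thirds (INR g) ltac:(lra)) as Ev. pose proof (Rpower_ge_1 (INR g) (2 / 3) Hg ltac:(lra)) as Hv.
  set (v := Rpower (INR g) (2 / 3)) in *.
  set (N := INR n) in *. set (S := INR s) in *. set (G := INR g) in *. set (l := INR L) in *. set (T' := INR T) in *.
  (* [(5 / 4) ^ 3 = 125 / 64 < 2]. So a doubling of [L] adds at least a quarter of the value, 5
     million times [M], where the level takes at most 4 million times [M]. *)
  assert (Hz : 5 / 4 <= z).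
  { apply cube_le; [|rewrite Ez; lra]. unfold z, Rpower. left. apply exp_pos. }
  clearbody z u v N S G l T'.
  (* The cube of this is [L ^ 2 <= (2 * s) ^ 3 * g ^ 2], which follows from the maximality of [s].
     It bounds [L / s] by [2 * g ^ (2 / 3) * L ^ (1 / 3)]. *)
  assert (Hu2 : u * u <= 2 * S * v).
  { apply cube_le; [apply Rmult_le_pos; lra|].
    replace (u * u * (u * u) * (u * u)) with ((u * u * u) * (u * u * u)) by ring.
    replace (2 * S * v * (2 * S * v) * (2 * S * v)) with (2 * S * (2 * S) * (2 * S) * (v * v * v)) by ring.
    rewrite Eu, Ev. left. eapply Rlt_le_trans; [exact Hs|].
    apply Rmult_le_compat_r; [nra|].
    apply Rmult_le_compat; [nra|lra| |lra]. apply Rmult_le_compat; lra. }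
  assert (HTu : T' <= 4 * 1000 * 1000 * (N * v * u)).
  { apply Rmult_le_reg_r with S; [lra|]. eapply Rle_trans; [exact HT|]. rewrite <- Eu.
    replace (2 * 1000 * 1000 * (N * (u * u * u))) with (2 * 1000 * 1000 * (N * u) * (u * u)) by ring.
    replace (4 * 1000 * 1000 * (N * v * u) * S) with (2 * 1000 * 1000 * (N * u) * (2 * S * v)) by ring.
    apply Rmult_le_compat_l; [|exact Hu2]. apply Rmult_le_pos; [lra|]. apply Rmult_le_pos; lra. }
  assert (H1 : 1 <= N * v * u).
  { assert (1 <= N * v) by nra. nra. }
  set (M := N * v * u) in *.
  replace (20 * 1000 * 1000 * (N * v * (z * u)) - 20 * 1000 * 1000 * M)
    with (20 * 1000 * 1000 * (M * (z - 1))) by (unfold M; ring).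
  assert (M * (1 / 4) <= M * (z - 1)) by (apply Rmult_le_compat_l; lra). lra.
Qed.

(** The last argument of [level_sum] is at most [4 * n], so its cube root is at most
    [2 * n ^ (1 / 3)]; the same bound holds for [b], which covers the terms outside the levels. *)
Lemma build_time n g b H t :
  (1 <= n)%nat -> (1 <= g)%nat -> (1 <= b)%nat -> (b * b * b <= 8 * n)%nat ->
  (b * 2 ^ S H <= 4 * n)%nat -> (index_cells n b <= 100 * n)%nat ->
  INR t <= INR (1000 * (n * (b + 1)) + 2000 * index_cells n b) +
    (level_sum n g (b * 2 ^ S H) - level_sum n g b) ->
  INR t <= INR (100 * 1000 * 1000) * (Rpower (INR g) (2 / 3) * Rpower (INR n) (4 / 3)).
Proof.
  intros Hn Hg Hb Hb3 HL HX Ht. unfold level_sum in Ht.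
  apply INR_ge_1 in Hn, Hg. assert (Hb' := INR_ge_1 b Hb).
  assert (HbR : INR b * INR b * INR b <= 8 * INR n).
  { apply le_INR in Hb3. rewrite !mult_INR in Hb3. replace (INR 8) with 8 in Hb3 by (cbn; ring). exact Hb3. }
  assert (HL1 : 1 <= INR (b * 2 ^ S H)).
  { apply INR_ge_1. pose proof (Nat.pow_nonzero 2 (S H)). nia. }
  apply le_INR in HL. rewrite (mult_INR 4) in HL. replace (INR 4) with 4 in HL by (cbn; ring).
  assert (Hother : INR (1000 * (n * (b + 1)) + 2000 * index_cells n b) <=
     1000 * (INR n * (INR b + 1)) + 200 * 1000 * INR n).
  { eapply Rle_trans; [apply le_INR, Nat.add_le_mono_l, Nat.mul_le_mono_l, HX|].
    rewrite plus_INR, !mult_INR, plus_INR, !INR_IZR_INZ.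
    change (IZR (Z.of_nat 1000)) with 1000. change (IZR (Z.of_nat 2000)) with 2000.
    change (IZR (Z.of_nat 100)) with 100. change (IZR (Z.of_nat 1)) with 1. lra. }
  rewrite Rpower_four_thirds, !mult_INR, (INR_IZR_INZ 1000), (INR_IZR_INZ 100) by lra.
  change (IZR (Z.of_nat 1000)) with 1000. change (IZR (Z.of_nat 100)) with 100.
  pose proof (Rpower_ge_1 (INR g) (2 / 3) Hg ltac:(lra)) as Hv. set (v := Rpower (INR g) (2 / 3)) in *.
  pose proof (Rpower_third (INR n) ltac:(lra)) as Ex. pose proof (Rpower_ge_1 (INR n) (1 / 3) Hn ltac:(lra)) as Hx.
  set (x := Rpower (INR n) (1 / 3)) in *.
  pose proof (Rpower_third (INR (b * 2 ^ S H)) ltac:(lra)) as Ey.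
  set (y := Rpower (INR (b * 2 ^ S H)) (1 / 3)) in *.
  assert (Hy0 : 0 < Rpower (INR b) (1 / 3)) by apply exp_pos.
  set (y0 := Rpower (INR b) (1 / 3)) in *.
  set (N := INR n) in *. set (l := INR (b * 2 ^ S H)) in *. set (b' := INR b) in *.
  clearbody v x y y0 N l b'.
  assert (Hyx : y <= 2 * x) by (apply cube_le; lra).
  assert (Hbx : b' <= 2 * x) by (apply cube_le; lra).
  assert (HNv : 1 <= N * v) by nia || nra.
  assert (Hy0' : 0 <= N * v * y0) by (apply Rmult_le_pos; lra).
  assert (Hy' : N * v * y <= N * v * (2 * x)) by (apply Rmult_le_compat_l; lra).
  assert (HNx : N <= N * x) by nra.
  assert (HNxv : N * x <= N * x * v) by nra.
  assert (HNb : N * b' <= N * (2 * x)) by (apply Rmult_le_compat_l; lra).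
  replace (v * (N * x)) with (N * x * v) by ring.
  replace (N * v * (2 * x)) with (2 * (N * x * v)) in Hy' by ring. lra.
Qed.

Close Scope R_scope.

Lemma occ_occurrences B n P m c :
  length B = n -> (forall i, i <= n -> P i = prefix_ones B i) ->
  occs_in n P m c 0 (n + 1) = occurrences B m c.
Proof.
  intros Hn HP. rewrite <- (occ_total n P m c (S n - m)).
  2: { intros i Hi Hh. apply hit_true in Hh. lia. }
  unfold occs_in, occurrences. rewrite Nat.sub_0_r, Hn. apply filter_ext_in. intros i Hi. apply in_seq in Hi.
  unfold hit. rewrite !HP by lia. rewrite prefix_ones_sub. unfold ones.
  destruct (Nat.leb_spec (i + m) n); [|lia]. cbn [andb].
  set (u := count_occ _ _ _). set (v := prefix_ones B i). clearbody u v.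
  destruct (Nat.eqb_spec (v + u) (v + c)), (Nat.eqb_spec u c); auto; lia.
Qed.

Lemma bitlen_spec n :
  1 <= n -> 1 <= bitlen n /\ bitlen n <= n /\ n < 2 ^ bitlen n /\ 2 ^ bitlen n <= 2 * n.
Proof.
  intros Hn. unfold bitlen. pose proof (Nat.log2_spec n Hn). pose proof (Nat.log2_lt_lin n Hn).
  rewrite (Nat.pow_succ_r' 2 (Nat.log2 n)) in *. lia.
Qed.

(** For base 0 the 32 arrays partition the whole memory. A query stores nothing, so the index
    survives it. *)
Lemma frame_mem w c s t s' :
  5 <= w -> (forall k, modk k c = false) -> exec w c s t s' -> mem s' = mem s.
Proof.
  intros Hw Hk He. destruct (exec_frame w 0 Hw _ _ _ _ He) as (_ & HF & _). extensionality a.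
  pose proof (Nat.div_mod_eq a 32) as Ea. pose proof (Nat.mod_upper_bound a 32 ltac:(lia)) as Ha.
  specialize (HF (a mod 32) (Hk _) Ha). apply (f_equal (fun f => f (a / 32))) in HF.
  unfold arr in HF. now replace (32 * (a / 32 + 0) + a mod 32) with a in HF by lia.
Qed.

(** The cube of [2 ^ q] comes from the tables, whose size is bounded by the product of three linear
    factors, and 256 is 8 * 8 * 4. With [19 = 3 + 16] and [q >= 1], a factor of at least [2 ^ 16]
    remains for [256 * 64] and the lower terms. *)
Lemma word_size_ok n g q w :
  1 <= n -> 1 <= g -> n + g < 2 ^ q -> 19 * q <= w ->
  let AB := 256 * (2 ^ q * 2 ^ q * 2 ^ q) in
  5 <= w /\ 64 * (AB + g + 1) < 2 ^ w /\ 16 * (n + 1) <= AB /\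
  (8 * n + 7) * (8 * n + 7) * (4 * n + 1) < AB /\ 8 * (g * g) <= AB /\ 100 * n <= AB.
Proof.
  intros Hn Hg Hq Hw AB.
  assert (Hq1 : 1 <= q) by (destruct q; [change (2 ^ 0) with 1 in Hq; lia|lia]).
  assert (Hp : 2 ^ (19 * q) <= 2 ^ w) by (apply Nat.pow_le_mono_r; lia).
  assert (E : 2 ^ (19 * q) = 2 ^ q * 2 ^ q * 2 ^ q * 2 ^ (16 * q)).
  { rewrite <- !Nat.pow_add_r. f_equal. lia. }
  assert (E2 : 256 * 256 <= 2 ^ (16 * q)).
  { change 256 with (2 ^ 8). rewrite <- Nat.pow_add_r. apply Nat.pow_le_mono_r; lia. }
  unfold AB. set (Q := 2 ^ q) in *. set (Z := 2 ^ (16 * q)) in *. clearbody Q Z. clear AB.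
  assert (Q1 : Q * 1 <= Q * Q) by (apply Nat.mul_le_mono_l; lia).
  assert (Q2 : Q * Q * 1 <= Q * Q * Q) by (apply Nat.mul_le_mono_l; lia).
  assert (Q3 : Q * Q * Q * (256 * 256) <= Q * Q * Q * Z) by (now apply Nat.mul_le_mono_l).
  assert (Q4 : (8 * n + 7) * (8 * n + 7) * (4 * n + 1) <= 8 * Q * (8 * Q) * (4 * n + 1))
    by (apply Nat.mul_le_mono_r, Nat.mul_le_mono; lia).
  assert (Q5 : 8 * Q * (8 * Q) * (4 * n + 1) < 8 * Q * (8 * Q) * (4 * Q))
    by (apply Nat.mul_lt_mono_pos_l; lia).
  assert (Q6 : g * g <= Q * Q) by (apply Nat.mul_le_mono; lia).
  split; [lia|]. split; [lia|]. split; [lia|]. split; [lia|]. split; lia.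
Qed.

(* Words have Theta(log n) bits: the multiple of log(n + g) needed from below is
   a constant of the algorithm, the one allowed from above is an arbitrary
   constant K on which only the hidden constant C may depend.  The index I is
   what the building program outputs. *)
Theorem theorem2 :
  exists (build query : com) (kappa : nat),
  forall K : nat,
  exists C : nat,
  forall (n : nat) (B : list bool) (G : slp) (w : nat),
    length B = n ->
    slp_for G B ->
    kappa * bitlen (n + num_rules G) <= w ->
    w <= K * bitlen n ->
    exists (t : nat) (s : state),
      exec w build (build_input G) t s /\
      (INR t <= INR C * (Rpower (INR (num_rules G)) (2 / 3)
                         * Rpower (INR n) (4 / 3)))%R /\
      length (out s) * w <= C * (n * bitlen n) /\
      (forall m c : nat,
         m < 2 ^ w -> c < 2 ^ w ->
         answers w C query (out s) B m c).
Proof.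
  (* The first summand is the constant of the running times; [3200 * K] is for 32 arrays of at most
     [100 * n] words of at most [K * bitlen n] bits. *)
  exists build, query, 19. intros K. exists (100 * 1000 * 1000 + 3200 * K). intros n B G w Hn HG Hw1 Hw2.
  destruct (slp_tree G B HG) as (t & Ht & Hroot & HB).
  assert (Hn1 : 1 <= n) by (rewrite <- Hn, <- HB; apply yield_pos).
  assert (Hg1 : 1 <= num_rules G) by (pose proof (deriv_root_lt _ _ Ht); unfold num_rules; lia).
  set (g := num_rules G) in *. set (q := bitlen (n + g)) in *.
  assert (Hq : n + g < 2 ^ q) by (apply Nat.log2_spec; lia).
  destruct (word_size_ok n g q w Hn1 Hg1 Hq Hw1) as (Hw & HAB & AB1 & AB2 & AB3 & AB4).
  set (AB := 256 * (2 ^ q * 2 ^ q * 2 ^ q)) in *. clearbody AB.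
  set (b := bitlen n) in *.
  destruct (bitlen_spec n Hn1) as (Hb1 & Hbn & Hnb & H2b). fold b in Hb1, Hbn, Hnb, H2b.
  destruct (index_size n b Hb1 Hbn H2b) as (HNB2 & HX & Hb3).
  destruct (build_ok w AB n B G t (level_sum n g)) as
    (d & s & Hex & H & HH & HHb & Htime & Hidx & HP & Hout); auto; try exact HAB; try (fold b; lia).
  { intros L s T HL _ Hgs HT. now apply (level_sum_step n g L s T). }
  fold b g in HH, HHb, Htime, Hidx, HP, Hout.
  assert (HZ : (b + 1) * stride b (n / b + 1) <= AB) by (unfold index_cells in HX; lia).
  assert (HLL : b * 2 ^ S H <= 4 * n) by (rewrite Nat.pow_succ_r'; lia).
  exists d, s. split; [exact Hex|]. split; [|split].
  - eapply Rle_trans; [apply (build_time n g b H d); auto|].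
    apply Rmult_le_compat_r; [|apply le_INR; lia].
    apply Rmult_le_pos; left; apply exp_pos.
  - rewrite Hout, length_map, length_seq.
    eapply Nat.le_trans; [apply Nat.mul_le_mono; [apply Nat.mul_le_mono_l, HX|exact Hw2]|].
    fold b. replace (32 * (100 * n) * (K * b)) with (3200 * K * (n * b)) by lia.
    apply Nat.mul_le_mono_r. lia.
  - intros m c Hm Hc mem0 (Hm0 & HI).
    set (X := index_cells n b) in *.
    assert (HA : forall k x, k < 32 -> x < X -> arr 0 mem0 k x = arr g (mem s) k x).
    { intros k x Hk Hx. unfold arr. rewrite HI, Hout.
      - rewrite (nth_indep _ 0 (mem s (0 + 32 * g))) by (rewrite length_map, length_seq; lia).
        rewrite (map_nth (fun j => mem s (j + 32 * g))), seq_nth by lia. f_equal. lia.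
      - rewrite Hout, length_map, length_seq. lia. }
    assert (HP0 : forall i, i <= n -> arr 0 mem0 aP i = prefix_ones B i).
    { intros i Hi. rewrite HA by (unfold X, index_cells; lia). auto. }
    assert (Hidx0 : index_ok n b (n / b + 1) H (arr 0 mem0)).
    { eapply index_ok_ext; [auto..| |exact Hidx]. exact HA. }
    destruct (query_ok w AB n b (n / b + 1) H m c mem0) as (t' & s' & Hex' & Ht' & Ho'); auto; try lia.
    { intros i j Hij Hj. rewrite !HP0 by lia. now apply prefix_ones_lip. }
    { intros i Hi. rewrite HP0 by lia. pose proof (prefix_ones_le B i). lia. }
    rewrite (occ_occurrences B n _ m c Hn HP0) in *.
    exists t', s'. split; [exact Hex'|]. split; [rewrite Ho'; apply Permutation_refl|]. split.
    + rewrite <- Nat.mul_assoc in Ht'. set (u := Nat.max 1 m * length (occurrences B m c)) in *.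
      assert (3000 * (u + 1) <= (100 * 1000 * 1000 + 3200 * K) * (u + 1)) by (apply Nat.mul_le_mono_r; lia).
      lia.
    + assert (Em : mem s' = mem0) by (apply (frame_mem w query (query_input m c mem0) t' s' Hw); auto).
      rewrite Em. split; auto.
Qed.
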